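(* Let $\{l_j\}_{j\ge0}$ be real random variables and let $L_n=\mathrm{LScirc}(l_0,l_1,\dots,l_{n-1})$ be the $n\times n$ left skew-circulant matrix. Then the following hold. (i) If the $l_j$ are independent with mean $0$, variance $1$ and $\sup_j\mathbb{E}|l_j|^k<\infty$ for every $k\ge 1$, then $n^{-1/2}L_n$, as an element of $(\mathcal{M}_n,\varphi_n=n^{-1}\mathbb{E}\,\mathrm{Tr})$, converges in $*$-distribution to a self-adjoint variable whose odd moments vanish and whose $(2m)$th moment equals $m!$ for each $m\ge1$. (ii) If the $l_j$ are i.i.d. with mean $0$ and variance $1$, then the ESD of $n^{-1/2}L_n$ converges weakly almost surely to the symmetrized Rayleigh distribution.
   Context: The left skew-circulant matrix $\mathrm{LScirc}(l_0,\dots,l_{n-1})$ has $(i,j)$ entry ($0\le i,j\le n-1$) equal to $l_{i+j}$ if $i+j\le n-1$ and $-l_{i+j-n}$ if $i+j\ge n$; it is symmetric. The ESD (empirical spectral distribution) of an $n\times n$ matrix with eigenvalues $\lambda_1,\dots,\lambda_n$ is $n^{-1}\sum_{j}\delta_{\lambda_j}$. The (standard) symmetrized Rayleigh distribution is the probability law on $\mathbb{R}$ with density $f_R(x)=|x|e^{-x^2}$, $-\infty<x<\infty$. An NCP (non-commutative $*$-probability space) $(\mathcal{A},\varphi)$ is a unital complex $*$-algebra with a complex linear functional $\varphi$ satisfying $\varphi(1_{\mathcal{A}})=1$; $a\in\mathcal{A}$ is self-adjoint if $a=a^*$, and its $k$th moment is $\varphi(a^k)$. $\mathcal{M}_n$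 is the $*$-algebra of $n\times n$ random matrices all of whose entries have finite moments of all orders. Elements $a_n$ of NCPs $(\mathcal{A}_n,\varphi_n)$ converge in $*$-distribution to $a\in\mathcal{A}$ if $\varphi_n(Q(a_n))\to\varphi(Q(a))$ for every monomial $Q$ in the non-commuting indeterminates $x,x^*$. *)

(* Defs.v *)
From HB Require Import structures.
From mathcomp Require Import all_boot all_order all_algebra.
From mathcomp Require Import complex polyrcf.
From mathcomp Require Import all_classical all_reals all_analysis.
From mathcomp Require Import measurable_realfun.
From mathcomp Require Import ring lra.

Set Implicit Arguments.
Unset Strict Implicit.
Unset Printing Implicit Defensive.

Import Order.TTheory GRing.Theory Num.Theory.
Import numFieldNormedType.Exports.

Local Open Scope classical_set_scope.
Local Open Scope ring_scope.

Definition LScirc (V : zmodType) (n : nat) (l : nat -> V) : 'M[V]_n :=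
  \matrix_(i < n, j < n)
    if (i + j < n)%N then l (i + j)%N else - l (i + j - n)%N.

Lemma LScirc_sym (V : zmodType) n (l : nat -> V) : (LScirc n l)^T = LScirc n l.
Proof. by apply/matrixP => i j; rewrite !mxE addnC. Qed.

(* A non-commutative *-probability space. *)
Record ncp (C : numClosedFieldType) := NCP {
  ncp_alg :> algType C;
  star : ncp_alg -> ncp_alg;
  starK : involutive star;
  starD : {morph star : x y / x + y};
  starM : forall x y, star (x * y) = star y * star x;
  starZ : forall c x, star (c *: x) = c^* *: star x;
  phi : {scalar ncp_alg};
  phi1 : phi 1 = 1 }.
Arguments star {C n} _.
Arguments phi {C} _.

(* The monomials in the non-commuting indeterminates x, x^* are the words over
   bool, with false standing for x and true for x^*. *)
Definition star_monomial (C : numClosedFieldType) (A : ncp C) (a : A)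
    (Q : seq bool) : A :=
  \prod_(b <- Q) (if b then star a else a).

Definition cvg_star_distribution (C : numClosedFieldType) (A : nat -> ncp C)
    (a : forall n, A n) (B : ncp C) (b : B) : Prop :=
  forall Q : seq bool,
    phi (A n) (star_monomial (a n) Q) @[n --> \oo] --> phi B (star_monomial b Q).

Section fct_alg.
Variables (T : pointedType) (K : comPzRingType) (A : algType K).

Let fct_scalerAl (k : K) (f g : T -> A) : k *: (f * g) = k *: f * g.
Proof. by apply/funext => x; exact: scalerAl. Qed.

HB.instance Definition _ := GRing.Lmodule_isLalgebra.Build K (T -> A) fct_scalerAl.

Let fct_scalerAr (k : K) (f g : T -> A) : k *: (f * g) = f * (k *: g).
Proof. by apply/funext => x; exact: scalerAr. Qed.

HB.instance Definition _ := GRing.Lalgebra_isAlgebra.Build K (T -> A) fct_scalerAr.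
End fct_alg.

Section random_matrices.
Context {d : measure_display} {T : measurableType d} {R : realType}.
Variable P : probability T R.

Definition cplx_measurable (f : T -> R[i]) : Prop :=
  measurable_fun setT (fun t => complex.Re (f t)) /\
  measurable_fun setT (fun t => complex.Im (f t)).

Definition all_moments (f : T -> R[i]) : Prop :=
  cplx_measurable f /\
  forall k : nat, P.-integrable setT (fun t => (Normc.normc (f t) ^+ k)%:E : \bar R).

Let normc_ge0 (z : R[i]) : 0 <= Normc.normc z.
Proof. by case: z => a b; exact: sqrtr_ge0. Qed.

Let measurable_normcX (f : T -> R[i]) k : cplx_measurable f ->
  measurable_fun setT (fun t => (Normc.normc (f t) ^+ k)%:E : \bar R).
Proof.
move=> [mr mi]; apply/measurable_EFinP; apply: measurable_funX.
rewrite (_ : (fun t => _) = Num.sqrt \o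
  (fun t => complex.Re (f t) ^+ 2 + complex.Im (f t) ^+ 2)); last first.
  by apply/funext => t /=; case: (f t).
apply: measurableT_comp.
  apply: continuous_measurable_fun => x; exact: sqrt_continuous.
by apply: measurable_funD; apply: measurable_funX.
Qed.

Lemma all_moments_Re f : all_moments f ->
  P.-integrable setT (EFin \o (fun t => complex.Re (f t))).
Proof.
move=> [[mr mi] H]; apply: (le_integrable measurableT _ _ (H 1%N)).
  exact/measurable_EFinP.
move=> t _ /=; rewrite lee_fin expr1; case: (f t) => a b /=.
rewrite [leRHS]ger0_norm ?sqrtr_ge0// -sqrtr_sqr ler_wsqrtr// lerDl.
exact: sqr_ge0.
Qed.

Lemma all_moments_Im f : all_moments f ->
  P.-integrable setT (EFin \o (fun t => complex.Im (f t))).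
Proof.
move=> [[mr mi] H]; apply: (le_integrable measurableT _ _ (H 1%N)).
  exact/measurable_EFinP.
move=> t _ /=; rewrite lee_fin expr1; case: (f t) => a b /=.
rewrite [leRHS]ger0_norm ?sqrtr_ge0// -sqrtr_sqr ler_wsqrtr// lerDr.
exact: sqr_ge0.
Qed.

Lemma all_moments_cst c : all_moments (cst c).
Proof.
split; first by split; exact: measurable_cst.
move=> k.
exact: (finite_measure_integrable_cst P (Normc.normc c ^+ k) measurableT).
Qed.

Let dominated (f : T -> R[i]) (k : nat) (g : T -> R) : cplx_measurable f ->
  (forall t, Normc.normc (f t) ^+ k <= g t) ->
  P.-integrable setT (EFin \o g) ->
  P.-integrable setT (fun t => (Normc.normc (f t) ^+ k)%:E : \bar R).
Proof.
move=> mf fg; apply: le_integrable => //; first exact: measurable_normcX.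
move=> t _ /=; rewrite lee_fin ger0_norm ?exprn_ge0//.
exact: le_trans (fg t) (ler_norm _).
Qed.

Lemma all_moments_conj f : all_moments f -> all_moments (fun t => (f t)^*).
Proof.
move=> [[mr mi] H]; split.
  split.
    by congr (measurable_fun _ _): mr; apply/funext => t; case: (f t).
  have := measurableT_comp (@oppr_measurable R setT) mi.
  by congr (measurable_fun _ _); apply/funext => t /=; case: (f t).
move=> k; congr (integrable _ _ _): (H k).
apply/funext => t /=; congr (_ ^+ _)%:E.
by case: (f t) => a b /=; rewrite sqrrN.
Qed.

Lemma all_momentsD f g : all_moments f -> all_moments g ->
  all_moments (fun t => f t + g t).
Proof.
move=> [[mrf mif] Hf] [[mrg mig] Hg].
have m : cplx_measurable (fun t => f t + g t).
  split.
    rewrite (_ : (fun t => _) = fun t => complex.Re (f t) + complex.Re (g t)).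
      exact: measurable_funD.
    by apply/funext => t /=; case: (f t) => ? ?; case: (g t).
  rewrite (_ : (fun t => _) = fun t => complex.Im (f t) + complex.Im (g t)).
    exact: measurable_funD.
  by apply/funext => t /=; case: (f t) => ? ?; case: (g t).
split=> // k.
apply: (dominated (g := fun t => 2 ^+ k *
  (Normc.normc (f t) ^+ k + Normc.normc (g t) ^+ k))) => //; last first.
  exact: (integrableZl measurableT (2 ^+ k)
           (integrableD measurableT (Hf k) (Hg k))).
move=> t; set a := Normc.normc (f t); set b := Normc.normc (g t).
have a0 : 0 <= a by exact: normc_ge0.
have b0 : 0 <= b by exact: normc_ge0.
have ab : Normc.normc (f t + g t) <= 2 * Num.max a b.
  apply: le_trans (le_normcD _ _) _.
  by rewrite mulr_natl mulr2n lerD// le_max lexx ?orbT.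
apply: le_trans (lerXn2r k _ _ ab) _; rewrite ?nnegrE//.
  by rewrite mulr_ge0// le_max a0.
rewrite exprMn ler_wpM2l ?exprn_ge0//.
by rewrite /Num.max; case: ifP => _; rewrite ?lerDl ?lerDr exprn_ge0.
Qed.

Lemma all_momentsM f g : all_moments f -> all_moments g ->
  all_moments (fun t => f t * g t).
Proof.
move=> [[mrf mif] Hf] [[mrg mig] Hg].
have m : cplx_measurable (fun t => f t * g t).
  split.
    rewrite (_ : (fun t => _) = fun t =>
        complex.Re (f t) * complex.Re (g t) - complex.Im (f t) * complex.Im (g t)).
      by apply: measurable_funB; exact: measurable_funM.
    by apply/funext => t /=; case: (f t) => ? ?; case: (g t).
  rewrite (_ : (fun t => _) = fun t =>
      complex.Re (f t) * complex.Im (g t) + complex.Im (f t) * complex.Re (g t)).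
    by apply: measurable_funD; exact: measurable_funM.
  by apply/funext => t /=; case: (f t) => ? ?; case: (g t).
split=> // k.
apply: (dominated (g := fun t =>
  (Normc.normc (f t) ^+ (k * 2) + Normc.normc (g t) ^+ (k * 2)))) => //;
  last exact: (integrableD measurableT (Hf _) (Hg _)).
move=> t; rewrite Normc.normcM exprMn !exprM.
have := sqr_ge0 (Normc.normc (f t) ^+ k - Normc.normc (g t) ^+ k).
have : 0 <= Normc.normc (f t) ^+ k * Normc.normc (g t) ^+ k.
  by rewrite mulr_ge0// exprn_ge0.
move: (_ ^+ k) (_ ^+ k) => a b; nra.
Qed.

Lemma all_moments_sum n (f : 'I_n -> T -> R[i]) :
  (forall i, all_moments (f i)) -> all_moments (fun t => \sum_i f i t).
Proof.
elim: n f => [|n IH] f Hf.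
  by congr all_moments: (all_moments_cst 0); apply/funext => t; rewrite big_ord0.
under [X in all_moments X]eq_fun do rewrite big_ord_recl.
by apply: all_momentsD; [exact: Hf|apply: IH => i; exact: Hf].
Qed.

(* M_n: two random matrices are equal when they agree at every sample point
   (not merely almost surely); the size is n.+1 since a non-commutative
   probability space is a non-zero ring. *)

Definition random_mx_pred n : {pred (T -> 'M[R[i]]_n.+1)} :=
  fun X => `[< forall i j, all_moments (fun t => X t i j) >].

Record random_mx n := RandomMx {
  random_mx_val :> T -> 'M[R[i]]_n.+1;
  random_mxP : random_mx_val \in @random_mx_pred n }.

HB.instance Definition _ n := [isSub for @random_mx_val n].
HB.instance Definition _ n := [Choice of random_mx n by <:].

Lemma random_mx_subalg n : GRing.subsemialg_closed (@random_mx_pred n).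
Proof.
split; [|split|..].
- apply/asboolP => i j; rewrite (_ : (fun t => _) = cst ((i == j)%:R)).
    exact: all_moments_cst.
  by apply/funext => t; rewrite mxE.
- apply/asboolP => i j; rewrite (_ : (fun t => _) = cst 0).
    exact: all_moments_cst.
  by apply/funext => t; rewrite mxE.
- move=> X Y /asboolP HX /asboolP HY; apply/asboolP => i j.
  rewrite (_ : (fun t => _) = fun t => X t i j + Y t i j).
    exact: all_momentsD.
  by apply/funext => t; rewrite mxE.
- move=> c X /asboolP HX; apply/asboolP => i j.
  rewrite (_ : (fun t => _) = fun t => cst c t * X t i j).
    by apply: all_momentsM => //; exact: all_moments_cst.
  by apply/funext => t; rewrite mxE.
- move=> X Y /asboolP HX /asboolP HY; apply/asboolP => i j.
  rewrite (_ : (fun t => _) = fun t => \sum_k X t i k * Y t k j).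
    by apply: all_moments_sum => k; exact: all_momentsM.
  by apply/funext => t; rewrite mxE.
Qed.

HB.instance Definition _ n :=
  GRing.SubChoice_isSubAlgebra.Build R[i] _ _ (random_mx n)
    (@random_mx_subalg n).

Lemma random_mx_all_moments n (X : random_mx n) i j :
  all_moments (fun t => X t i j).
Proof. by have /asboolP := random_mxP X; exact. Qed.

Lemma random_mx_star_subproof n (X : random_mx n) :
  (fun t => map_mx Num.conj (X t)^T) \in @random_mx_pred n.
Proof.
apply/asboolP => i j.
rewrite (_ : (fun t => _) = fun t => (X t j i)^*).
  exact/all_moments_conj/random_mx_all_moments.
by apply/funext => t; rewrite !mxE.
Qed.

Definition random_mx_star n (X : random_mx n) : random_mx n :=
  RandomMx (random_mx_star_subproof X).

Definition cplx_expectation (f : T -> R[i]) : R[i] :=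
  Complex (\int[P]_t complex.Re (f t)) (\int[P]_t complex.Im (f t)).

Definition random_mx_phi n (X : random_mx n) : R[i] :=
  n.+1%:R^-1 * cplx_expectation (fun t => \tr (X t)).

Lemma cplx_expectation_scalar (c : R[i]) f g : all_moments f -> all_moments g ->
  cplx_expectation (fun t => c * f t + g t) =
  c * cplx_expectation f + cplx_expectation g.
Proof.
move=> Hf Hg; case: c => a b.
have rf := all_moments_Re Hf; have if_ := all_moments_Im Hf.
have rg := all_moments_Re Hg; have ig := all_moments_Im Hg.
have iZ (r : R) (h : T -> R) : P.-integrable setT (EFin \o h) ->
    P.-integrable setT (EFin \o (fun t => r * h t)).
  by move=> ih; exact: (integrableZl measurableT r ih).
have iD (h1 h2 : T -> R) : P.-integrable setT (EFin \o h1) ->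
    P.-integrable setT (EFin \o h2) ->
    P.-integrable setT (EFin \o (fun t => h1 t + h2 t)).
  by move=> i1 i2; exact: (integrableD measurableT i1 i2).
rewrite /cplx_expectation; set A := \int[P]_t complex.Re (f t).
set B := \int[P]_t complex.Im (f t).
have -> : \int[P]_t complex.Re (Complex a b * f t + g t) =
    a * A + - b * B + \int[P]_t complex.Re (g t).
  rewrite -!RintegralZl// -RintegralD//; [|exact: iZ..].
  rewrite -RintegralD//; last by apply: iD; exact: iZ.
  apply: eq_Rintegral => t _.
  by case: (f t) => ? ?; case: (g t) => ? ? /=; rewrite mulNr.
have -> : \int[P]_t complex.Im (Complex a b * f t + g t) =
    a * B + b * A + \int[P]_t complex.Im (g t).
  rewrite -!RintegralZl// -RintegralD//; [|exact: iZ..].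
  rewrite -RintegralD//; last by apply: iD; exact: iZ.
  apply: eq_Rintegral => t _.
  by case: (f t) => ? ?; case: (g t) => ? ? /=.
by apply/eqP; rewrite eq_complex /= mulNr !eqxx.
Qed.

Lemma cplx_expectation_cst c : cplx_expectation (cst c) = c.
Proof.
have E (r : R) : \int[P]_t r = r.
  rewrite Rintegral_cst// (_ : fine _ = 1) ?mulr1//.
  by rewrite -[1]/(fine 1%E); congr fine; exact: probability_setT.
by rewrite /cplx_expectation !E; case: c.
Qed.

Lemma all_moments_tr n (X : random_mx n) : all_moments (fun t => \tr (X t)).
Proof. by apply: all_moments_sum => i; exact: random_mx_all_moments. Qed.

Let random_mx_phi_scalar n : scalar (@random_mx_phi n).
Proof.
move=> c X Y; rewrite /random_mx_phi.
have -> : (fun t => \tr ((c *: X + Y : random_mx n) t)) =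
    fun t => c * \tr (X t) + \tr (Y t).
  by apply/funext => t; rewrite -mxtraceZ -mxtraceD.
rewrite cplx_expectation_scalar; [|exact: all_moments_tr..].
by rewrite mulrDr mulrCA.
Qed.

HB.instance Definition _ n :=
  GRing.isLinear.Build R[i] (random_mx n) R[i] _ (@random_mx_phi n)
    (@random_mx_phi_scalar n).

Let random_mx_phi1 n : random_mx_phi (1 : random_mx n) = 1.
Proof.
rewrite /random_mx_phi.
have -> : (fun t => \tr ((1 : random_mx n) t)) = cst (n.+1%:R).
  by apply/funext => t; rewrite -mxtrace1.
by rewrite cplx_expectation_cst mulVf// pnatr_eq0.
Qed.

Let random_mx_starK n : involutive (@random_mx_star n).
Proof.
by move=> X; apply/val_inj/funext => t; apply/matrixP => i j; rewrite !mxE conjCK.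
Qed.

Let random_mx_starD n : {morph @random_mx_star n : X Y / X + Y}.
Proof.
by move=> X Y; apply/val_inj/funext => t; apply/matrixP => i j; rewrite !mxE rmorphD.
Qed.

Let random_mx_starM n (X Y : random_mx n) :
  random_mx_star (X * Y) = random_mx_star Y * random_mx_star X.
Proof.
apply/val_inj/funext => t; rewrite /= /GRing.mul /=.
by rewrite [X in X^T]/(_ *m _) trmx_mul map_mxM.
Qed.

Let random_mx_starZ n c (X : random_mx n) :
  random_mx_star (c *: X) = Num.conj c *: random_mx_star X.
Proof.
by apply/val_inj/funext => t; apply/matrixP => i j; rewrite !mxE rmorphM.
Qed.

Definition random_mx_ncp n : ncp R[i] :=
  @NCP R[i] (random_mx n) (@random_mx_star n) (@random_mx_starK n)
    (@random_mx_starD n) (@random_mx_starM n) (@random_mx_starZ n)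
    (@random_mx_phi n) (random_mx_phi1 n).

End random_matrices.

Section independence.
Context {d : measure_display} {T : measurableType d} {R : realType}.
Variable P : probability T R.

Definition mutually_independent (l : nat -> {RV P >-> R}) : Prop :=
  forall (J : seq nat) (B : nat -> set R), uniq J ->
    (forall j, measurable (B j)) ->
    (P (\bigcap_(j in [set` J]) l j @^-1` B j) =
     \prod_(j <- J) P (l j @^-1` B j))%E.

Definition identically_distributed (l : nat -> {RV P >-> R}) : Prop :=
  forall i j (B : set R), measurable B ->
    distribution P (l i) B = distribution P (l j) B.

End independence.

Lemma char_poly_sim (F : fieldType) n (S D : 'M[F]_n) : S \in unitmx ->
  char_poly (invmx S *m D *m S) = char_poly D.
Proof.
move=> uS; rewrite /char_poly /char_poly_mx !map_mxM.
have VS : map_mx polyC (invmx S) *m map_mx polyC S = 1%:M.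
  by rewrite -map_mxM mulVmx// map_mx1.
rewrite [in LHS](_ : 'X%:M = map_mx polyC (invmx S) *m 'X%:M *m map_mx polyC S); last first.
  by rewrite scalar_mxC -mulmxA VS mulmx1.
rewrite -mulmxBl -mulmxBr !det_mulmx mulrAC -det_mulmx VS det1 mul1r.
by [].
Qed.

Lemma char_poly_symmetric_split (R : realType) n (A : 'M[R]_n) : A^T = A ->
  exists s : seq R, char_poly A = \prod_(x <- s) ('X - x%:P).
Proof.
move=> symA; pose toC := real_complex R; pose B := map_mx toC A.
have hB : B \is hermsymmx.
  apply/is_hermitianmxP; rewrite expr0 scale1r.
  apply/matrixP => i j; rewrite !mxE -{1}symA mxE.
  exact/esym/CrealP/complex_realP/(ex_intro _ (A j i)).
have rD := hermitian_spectral_diag_real hB.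
have /hermitian_normalmx/orthomx_spectralP EB := hB.
exists [seq complex.Re (spectral_diag B 0 i) | i <- index_enum 'I_n].
apply: (map_poly_inj toC); rewrite map_char_poly -/B {1}EB.
rewrite char_poly_sim ?spectral_unit// char_poly_trig ?diag_mx_is_trig//.
rewrite rmorph_prod big_map; apply: eq_bigr => i _ /=.
rewrite rmorphB /= map_polyX map_polyC /= mxE eqxx mulr1n.
by rewrite /toC RRe_real//; have /mxOverP := rD; exact.
Qed.

(* Empirical spectral distribution of a real matrix with real eigenvalues, in
   particular of a symmetric one, see char_poly_eigenvalues
   and size_eigenvalues. *)

Section esd.
Context {R : realType}.

Definition eigenvalues n (A : 'M[R]_n) : seq R :=
  flatten [seq nseq (mup x (char_poly A)) x | x <- rootsR (char_poly A)].

Lemma count_eigenvalues n (A : 'M[R]_n) x :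
  count_mem x (eigenvalues A) = mup x (char_poly A).
Proof.
have p0 : char_poly A != 0 by exact/monic_neq0/char_poly_monic.
have memr y : (y \in rootsR (char_poly A)) = root (char_poly A) y.
  by rewrite -(roots_on_rootsR p0).
rewrite /eigenvalues count_flatten -map_comp sumnE big_map.
under eq_bigr do rewrite /= count_nseq /=.
have [xr|xr] := boolP (x \in rootsR (char_poly A)).
  rewrite (bigD1_seq x) ?uniq_roots//= eqxx mul1n big1 ?addn0// => y /negPf yx.
  by rewrite yx.
rewrite big_seq big1 => [|y yr].
  by rewrite mupNroot// -memr.
by have [yx|//] := eqVneq y x; rewrite -yx yr in xr.
Qed.

Lemma char_poly_eigenvalues n (A : 'M[R]_n) : A^T = A ->
  char_poly A = \prod_(x <- eigenvalues A) ('X - x%:P).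
Proof.
move=> /char_poly_symmetric_split[s Es]; rewrite Es; apply: perm_big.
by apply/allP => x _ /=; rewrite count_eigenvalues Es mu_prod_XsubC.
Qed.

Lemma size_eigenvalues n (A : 'M[R]_n) : A^T = A -> size (eigenvalues A) = n.
Proof.
move=> /char_poly_eigenvalues/(congr1 (fun p : {poly R} => size p)).
by rewrite size_char_poly size_prod_XsubC => -[].
Qed.

Definition esd n (A : 'M[R]_n) : set R -> \bar R :=
  mscale (n%:R^-1)%:nng
    (msum (fun k => \d_((eigenvalues A)`_k)) (size (eigenvalues A))).

HB.instance Definition _ n (A : 'M[R]_n) := Measure.on (esd A).

Definition weak_cvg (mu : nat -> {measure set R -> \bar R})
    (nu : {measure set R -> \bar R}) : Prop :=
  forall f : R -> R, continuous f -> (exists M, forall x, `|f x| <= M) ->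
    (\int[mu n]_x (f x)%:E @[n --> \oo] --> \int[nu]_x (f x)%:E)%E.

End esd.

Definition rayleigh_pdf {R : realType} (x : R) : R := `|x| * expR (- x ^+ 2).

Definition rayleigh {R : realType} (V : set R) : \bar R :=
  (\int[lebesgue_measure]_(x in V) (rayleigh_pdf x)%:E)%E.

Section rayleigh_probability.
Context {R : realType}.
Local Notation mu := (@lebesgue_measure R).

Lemma rayleigh_pdf_ge0 (x : R) : 0 <= rayleigh_pdf x.
Proof. by rewrite mulr_ge0// expR_ge0. Qed.

Lemma continuous_rayleigh_pdf : continuous (@rayleigh_pdf R).
Proof.
move=> x; apply: cvgM; first exact: norm_continuous.
apply: (cvg_comp _ expR); last exact: continuous_expR.
apply: (@cvgN _ R^o); exact: sqr_continuous.
Qed.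

Lemma measurable_rayleigh_pdf : measurable_fun setT (@rayleigh_pdf R).
Proof. by apply: continuous_measurable_fun; exact: continuous_rayleigh_pdf. Qed.

Let rayleigh0 : @rayleigh R set0 = 0%E.
Proof. by rewrite /rayleigh integral_set0. Qed.

Let rayleigh_ge0 (A : set R) : (0 <= rayleigh A)%E.
Proof. by apply: integral_ge0 => x _; rewrite lee_fin rayleigh_pdf_ge0. Qed.

Let rayleigh_sigma_additive : semi_sigma_additive (@rayleigh R).
Proof.
move=> /= F mF tF mUF; rewrite /rayleigh; apply: cvg_toP.
  apply: ereal_nondecreasing_is_cvgn => m n mn.
  apply: lee_sum_nneg_natr => // k _ _; apply: integral_ge0 => /= x Fkx.
  by rewrite lee_fin rayleigh_pdf_ge0.
rewrite ge0_integral_bigcup//=.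
- apply/measurable_funTS/measurableT_comp => //.
  exact: measurable_rayleigh_pdf.
- by move=> x _; rewrite lee_fin rayleigh_pdf_ge0.
Qed.

HB.instance Definition _ := isMeasure.Build _ _ _
  (@rayleigh R) rayleigh0 rayleigh_ge0 rayleigh_sigma_additive.

Let rayleigh_setT : @rayleigh R [set: R] = 1%E.
Proof.
rewrite /rayleigh ge0_symfun_integralT//=; last 3 first.
- exact: rayleigh_pdf_ge0.
- exact: continuous_rayleigh_pdf.
- by move=> x; rewrite /rayleigh_pdf /= normrN sqrrN.
pose F (x : R) := - 2^-1 * expR (- x ^+ 2).
have dF x : is_derive (x : R) (1 : R) F (x * expR (- x ^+ 2)).
  apply: is_derive_eq.
  rewrite /GRing.scale /= ?mulr1.
  by field.
have cF : continuous F.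
  by move=> x; apply/differentiable_continuous/derivable1_diffP; case: (dF x).
rewrite -set_itvcy (@ge0_continuous_FTC2y _ _ F 0 0).
- by rewrite /F expr0n oppr0 expR0 mulr1 sub0e -EFinN opprK -EFinM mulfV// .
- by move=> x _; exact: rayleigh_pdf_ge0.
- by apply: continuous_subspaceT => x; exact: continuous_rayleigh_pdf.
- rewrite -[X in _ --> X](mulr0 (- 2^-1)); apply: cvgMl_tmp.
  apply: (@cvg_comp _ _ _ (fun x : R => x ^+ 2) (fun x => expR (- x)) _ (pinfty_nbhs R)).
    apply/cvgryPge => M; near=> x.
    have x1 : 1 <= x by near: x; apply: nbhs_pinfty_ge; rewrite num_real.
    have xM : M <= x by near: x; apply: nbhs_pinfty_ge; rewrite num_real.
    by rewrite expr2; nra.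
  exact: cvgr_expR.
- by move=> x _; case: (dF x).
- exact/cvg_at_right_filter/cF.
- move=> x; rewrite in_itv/= andbT => x0; rewrite derive1E derive_val.
  by rewrite /rayleigh_pdf gtr0_norm.
Unshelve. all: by end_near. Qed.

HB.instance Definition _ :=
  @Measure_isProbability.Build _ _ R (@rayleigh R) rayleigh_setT.

End rayleigh_probability.

(* Main.v *)
Require Import Defs.
From HB Require Import structures.
From mathcomp Require Import all_boot all_order all_algebra.
From mathcomp Require Import complex.
From mathcomp Require Import all_classical all_reals all_analysis.
From mathcomp Require Import measurable_realfun.
From mathcomp Require Import ring lra zify.

Set Implicit Arguments.
Unset Strict Implicit.
Unset Printing Implicit Defensive.

Import Order.TTheory GRing.Theory Num.Theory.
Import numFieldNormedType.Exports.

Local Open Scope classical_set_scope.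
Local Open Scope ring_scope.

(** Let [M] be the normalized matrix, of size [n], and let [exp (i a_k)] run over
    the [n]-th roots of -1.  The vectors [v_k = (exp (i j a_k))_j / sqrt n] form a
    tight frame, and [M] maps [v_k] to [z_k] times the conjugate of [v_k], where
    [z_k = sum_j l_j exp (i j a_k) / sqrt n].  Hence [M^2] acts on the plane of the
    real and imaginary parts of [v_k] as the scalar [r_k = |z_k|^2], and [M] has
    there the eigenvalues [+- sqrt r_k], unless the root is -1 and the plane a line;
    conjugate roots share a plane.  In terms of traces:
    [Tr M^(2q) = sum_k r_k^q], while the odd traces vanish but for a contribution
    of the root -1, present when [n] is odd ([trace_even_power],
    [trace_odd_power]).  Interpolation extends this to sums of an arbitrary bounded
    function over the spectrum ([eigenvalues_LScirc_sum]).

    For a root other than -1 the coefficients of [z_k] satisfy the identities of a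
    circular complex variable ([frame_circular]), so that [r_k] is nearly
    exponential of mean 1.  This is proved by Stein's method: for smooth [g],
    [E (r g(r)) = E (g(r) + r g'(r))] up to [O(n^(-1/2))] ([stein_exponential]).
    Powers [g = r^m] give the moments [m!], and [g = exp (- t r)] gives the Laplace
    transform [1/(1 + t)], which is that of [x^2] under the symmetrized Rayleigh
    law ([rayleigh_laplace]).

    These estimates concern independent variables with finitely many values, whose
    expectations are iterated finite sums ([prod_mean]).  A standardized variable
    is a limit of standardized finite-valued functions of itself
    ([finite_approximation]), with domination; this carries the moment estimates to
    the given variables.  Part (i) follows by averaging over [k]
    ([mean_trace_cvg]); the limit element is the indeterminate in the algebra of
    polynomials, with the functional that has the prescribed moments.

    For part (ii) consider the average over [k] of [exp (- t r_k)].  For bounded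
    finite-valued entries its fourth moment about [1/(1 + t)] is [O(n^(-2))], by the
    Efron-Stein inequality applied twice ([laplace_fourth_moment]), so that it
    converges almost surely to [1/(1 + t)].  For general entries one discretizes:
    the average is Lipschitz for the normalized Euclidean distance
    ([empirical_laplace_lipschitz]), and the distance to the discretized entries is
    controlled by the upper half of the law of large numbers ([ae_average_le]).
    The Laplace transforms at the integers determine the weak limit, by
    Weierstrass's theorem in the variable [exp (- r)] ([laplace_cvg]). *)

(** * Finite product probability spaces *)

Section coordinate_update.
Context {R : realType}.
Implicit Types (x : nat -> R) (u v : R).

Definition upd x (j : nat) v : nat -> R := fun i => if i == j then v else x i.

Lemma upd_same x j v : upd x j v j = v.
Proof. by rewrite /upd eqxx. Qed.

Lemma upd_upd x j u v : upd (upd x j u) j v = upd x j v.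
Proof. by apply/funext => i; rewrite /upd; case: eqP. Qed.

Lemma upd_comm x i j u v : i != j -> upd (upd x i u) j v = upd (upd x j v) i u.
Proof.
move=> ij; apply/funext => k; rewrite /upd.
by case: eqP => // ->; case: eqP => // ji; rewrite ji eqxx in ij.
Qed.

Lemma upd_id x j : upd x j (x j) = x.
Proof. by apply/funext => i; rewrite /upd; case: eqP => [->|]. Qed.

Definition lin_form (b : nat -> R) n x : R := \sum_(j < n) b j * x j.

Lemma lin_form_upd b n x v : lin_form b n.+1 (upd x n v) = lin_form b n x + b n * v.
Proof.
rewrite /lin_form big_ord_recr /= upd_same; congr (_ + _).
by apply: eq_bigr => i _; rewrite /upd ltn_eqF.
Qed.

Lemma lin_form_reset b n x j v : (j < n)%N ->
  lin_form b n (upd x j v) = lin_form b n x + b j * (v - x j).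
Proof.
move=> jn; rewrite /lin_form (bigD1 (Ordinal jn)) //= [in RHS](bigD1 (Ordinal jn)) //=.
rewrite upd_same; under eq_bigr => i ij.
  rewrite /upd (_ : (nat_of_ord i == j) = false); last first.
    by apply/negbTE; apply: contra ij => /eqP ij; apply/eqP/val_inj.
  over.
ring.
Qed.

End coordinate_update.

Section product_mean.
Context {R : realType}.
Variables (V : nat -> seq R) (w : nat -> R -> R).
Implicit Types (F G : (nat -> R) -> R) (f g : R -> R).

Definition coord_mean j f : R := \sum_(v <- V j) w j v * f v.

(** The expectation over the first [n] coordinates, independent with laws
    [w j] on [V j]; all other coordinates are set to 0.  The iterated form
    makes Fubini's theorem an exchange of finite sums. *)
Fixpoint prod_mean n F : R :=
  if n is m.+1 then prod_mean m (fun x => coord_mean m (fun v => F (upd x m v)))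
  else F (fun=> 0).

Hypothesis w_ge0 : forall j v, 0 <= w j v.
Hypothesis w_sum1 : forall j, \sum_(v <- V j) w j v = 1.

Lemma coord_meanD j f g :
  coord_mean j (fun v => f v + g v) = coord_mean j f + coord_mean j g.
Proof.
by rewrite /coord_mean -big_split; apply: eq_bigr => v _; rewrite mulrDr.
Qed.

Lemma coord_meanZ j c f : coord_mean j (fun v => c * f v) = c * coord_mean j f.
Proof. by rewrite /coord_mean big_distrr; apply: eq_bigr => v _; rewrite mulrCA. Qed.

Lemma coord_mean_cst j c : coord_mean j (fun=> c) = c.
Proof. by rewrite /coord_mean -big_distrl /= w_sum1 mul1r. Qed.

Lemma coord_meanB j f g :
  coord_mean j (fun v => f v - g v) = coord_mean j f - coord_mean j g.
Proof.
by rewrite /coord_mean -sumrB; apply: eq_bigr => v _; rewrite mulrBr.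
Qed.

Lemma coord_mean_sum j (I : Type) (s : seq I) (P : pred I) (f : I -> R -> R) :
  coord_mean j (fun v => \sum_(i <- s | P i) f i v) =
  \sum_(i <- s | P i) coord_mean j (f i).
Proof.
rewrite /coord_mean exchange_big; apply: eq_bigr => v _.
by rewrite big_distrr.
Qed.

Lemma le_coord_mean j f g : (forall v, f v <= g v) ->
  coord_mean j f <= coord_mean j g.
Proof. by move=> fg; apply: ler_sum => v _; apply: ler_wpM2l. Qed.

Lemma coord_mean_sqr j f : coord_mean j f ^+ 2 <= coord_mean j (fun v => f v ^+ 2).
Proof.
set m := coord_mean j f.
have : 0 <= coord_mean j (fun v => (f v - m) ^+ 2).
  by rewrite -(coord_mean_cst j 0); apply: le_coord_mean => v; exact: sqr_ge0.
have -> : (fun v => (f v - m) ^+ 2) =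
    (fun v => (f v ^+ 2 + - 2 * m * f v) + m ^+ 2).
  by apply/funext => v; ring.
by rewrite !coord_meanD coord_mean_cst coord_meanZ -/m; nra.
Qed.

Lemma prod_meanD n F G :
  prod_mean n (fun x => F x + G x) = prod_mean n F + prod_mean n G.
Proof.
elim: n F G => //= n IH F G; rewrite -IH; congr prod_mean.
by apply/funext => x; rewrite coord_meanD.
Qed.

Lemma prod_meanZ n c F : prod_mean n (fun x => c * F x) = c * prod_mean n F.
Proof.
elim: n F => //= n IH F; rewrite -IH; congr prod_mean.
by apply/funext => x; rewrite coord_meanZ.
Qed.

Lemma prod_mean_cst n c : prod_mean n (fun=> c) = c.
Proof.
elim: n => //= n IH; rewrite -[RHS]IH; congr prod_mean.
by apply/funext => x; rewrite coord_mean_cst.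
Qed.

Lemma prod_meanB n F G :
  prod_mean n (fun x => F x - G x) = prod_mean n F - prod_mean n G.
Proof.
elim: n F G => //= n IH F G; rewrite -IH; congr prod_mean.
by apply/funext => x; rewrite coord_meanB.
Qed.

Lemma prod_mean_sum n (I : Type) (s : seq I) (P : pred I) (F : I -> (nat -> R) -> R) :
  prod_mean n (fun x => \sum_(i <- s | P i) F i x) =
  \sum_(i <- s | P i) prod_mean n (F i).
Proof.
elim: n F => //= n IH F; rewrite -IH; congr prod_mean.
by apply/funext => x; rewrite coord_mean_sum.
Qed.

Lemma le_prod_mean n F G : (forall x, F x <= G x) ->
  prod_mean n F <= prod_mean n G.
Proof.
by elim: n F G => //= n IH F G FG; apply: IH => x; exact: le_coord_mean.
Qed.

Lemma prod_mean_ge0 n F : (forall x, 0 <= F x) -> 0 <= prod_mean n F.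
Proof. by move=> F0; rewrite -(prod_mean_cst n 0); exact: le_prod_mean. Qed.

Lemma prod_mean_norm n F : `|prod_mean n F| <= prod_mean n (fun x => `|F x|).
Proof.
rewrite ler_norml; apply/andP; split; last by apply: le_prod_mean => x; exact: ler_norm.
rewrite -mulN1r -prod_meanZ; apply: le_prod_mean => x.
by rewrite mulN1r lerNl -normrN ler_norm.
Qed.

Lemma coord_mean_norm j f : `|coord_mean j f| <= coord_mean j (fun v => `|f v|).
Proof.
rewrite ler_norml; apply/andP; split; last by apply: le_coord_mean => x; exact: ler_norm.
rewrite -mulN1r -coord_meanZ; apply: le_coord_mean => x.
by rewrite mulN1r lerNl -normrN ler_norm.
Qed.

(** Averaging over one coordinate first does not change the expectation: this
    is the form in which independence is used. *)
Lemma prod_mean_coord n j F : (j < n)%N ->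
  prod_mean n (fun x => coord_mean j (fun v => F (upd x j v))) = prod_mean n F.
Proof.
elim: n F => // n IH F; rewrite ltnS leq_eqVlt => /predU1P[->/=|jn /=].
  congr prod_mean; apply/funext => x.
  rewrite -[RHS](coord_mean_cst n); congr coord_mean; apply/funext => v.
  by congr coord_mean; apply/funext => u; rewrite upd_upd.
rewrite -[RHS]IH//; congr prod_mean; apply/funext => x.
rewrite /coord_mean; under eq_bigr do rewrite big_distrr.
rewrite exchange_big; apply: eq_bigr => v _.
rewrite big_distrr; apply: eq_bigr => u _ /=.
by rewrite upd_comm 1?mulrCA// gtn_eqF.
Qed.

(** Efron-Stein inequality.  The reference value 0 for the resampled
    coordinate is harmless because the conditional variance is the least mean
    squared distance to a function of the other coordinates. *)
Lemma efron_stein n F :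
  prod_mean n (fun x => F x ^+ 2) - prod_mean n F ^+ 2 <=
  \sum_(j < n) prod_mean n (fun x => (F x - F (upd x j 0)) ^+ 2).
Proof.
elim: n F => [|n IH] F; first by rewrite big_ord0 /= subrr.
pose G x := coord_mean n (fun v => F (upd x n v)).
rewrite big_ord_recr /= -/(prod_mean n).
have varn : prod_mean n (fun x => coord_mean n (fun v => F (upd x n v) ^+ 2)) -
    prod_mean n (fun x => G x ^+ 2) <=
    prod_mean n (fun x => coord_mean n
      (fun v => (F (upd x n v) - F (upd (upd x n v) n 0)) ^+ 2)).
  rewrite -prod_meanB; apply: le_prod_mean => x.
  set c := F (upd x n 0).
  have -> : (fun v => (F (upd x n v) - F (upd (upd x n v) n 0)) ^+ 2) =
     (fun v => (F (upd x n v) ^+ 2 + - 2 * c * F (upd x n v)) + c ^+ 2).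
    by apply/funext => v; rewrite upd_upd -/c; ring.
  rewrite !coord_meanD coord_meanZ coord_mean_cst -/(G x).
  by have := sqr_ge0 (G x - c); nra.
have varm : \sum_(j < n) prod_mean n (fun x => (G x - G (upd x j 0)) ^+ 2) <=
    \sum_(j < n) prod_mean n (fun x => coord_mean n
      (fun v => (F (upd x n v) - F (upd (upd x n v) j 0)) ^+ 2)).
  apply: ler_sum => j _; apply: le_prod_mean => x.
  rewrite -coord_meanB; apply: le_trans (coord_mean_sqr _ _) _.
  apply: le_coord_mean => v; rewrite (@upd_comm _ x j n)//.
  by rewrite ltn_eqF.
have := IH G; rewrite -/(G _); move: varn varm.
have -> : prod_mean n (fun x => coord_mean n (fun v => F (upd x n v))) = prod_mean n G by [].
lra.
Qed.

End product_mean.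

(** * Taylor estimates and uniform moment bounds *)

Section one_variable.
Context {R : realType}.
Implicit Types (f df ddf : R -> R) (x y v M : R).

Lemma mean_value f df : (forall x, is_derive x 1 f (df x)) ->
  forall x y, exists2 z, `|z - x| <= `|y - x| & f y - f x = df z * (y - x).
Proof.
move=> fd; have cf A : {within A, continuous f}.
  apply: continuous_subspaceT => x; apply/differentiable_continuous.
  by apply/derivable1_diffP; case: (fd x).
move=> x y; have [xy|/ltW yx] := leP x y.
- have [z] := MVT_segment xy (fun z _ => fd z) (cf _).
  rewrite in_itv /= => /andP[xz zy] E; exists z => //.
  by rewrite !ger0_norm ?subr_ge0// lerD2r.
- have [z] := MVT_segment yx (fun z _ => fd z) (cf _).
  rewrite in_itv /= => /andP[xz zy] E; exists z; last by lra.
  by rewrite !ler0_norm ?subr_le0// lerN2 lerD2r.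
Qed.

Lemma taylor1_le f df M v : (forall x, is_derive x 1 f (df x)) ->
  (forall x, `|x| <= `|v| -> `|df x| <= M) -> `|f v - f 0| <= M * `|v|.
Proof.
move=> fd HM; have [z] := mean_value fd 0 v; rewrite !subr0 => zv ->.
by rewrite normrM ler_wpM2r// HM.
Qed.

Lemma taylor2_le f df ddf M v : (forall x, is_derive x 1 f (df x)) ->
  (forall x, is_derive x 1 df (ddf x)) ->
  (forall x, `|x| <= `|v| -> `|ddf x| <= M) ->
  `|f v - f 0 - v * df 0| <= M * `|v| ^+ 2.
Proof.
move=> fd dfd HM; have [z] := mean_value fd 0 v; rewrite !subr0 => zv ->.
rewrite (_ : _ - _ = (df z - df 0) * v); last by ring.
rewrite normrM expr2 mulrA ler_wpM2r//.
have M0 : 0 <= M by apply: le_trans (normr_ge0 (ddf 0)) (HM 0 _); rewrite normr0.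
apply: le_trans (taylor1_le (v := z) (M := M) dfd _) _.
  by move=> x xz; apply: HM; exact: le_trans zv.
by rewrite ler_wpM2l.
Qed.

End one_variable.

Section finite_model.
Context {R : realType}.
Variables (V : nat -> seq R) (w : nat -> R -> R).
Hypothesis w_ge0 : forall j v, 0 <= w j v.
Hypothesis w_sum1 : forall j, \sum_(v <- V j) w j v = 1.
Hypothesis w_mean0 : forall j, coord_mean V w j id = 0.

Local Notation mean := (coord_mean V w).
Local Notation E := (prod_mean V w).

Lemma exprn_double_ge0 (x : R) D : 0 <= x ^+ D.*2.
Proof. by rewrite -mul2n exprM; apply: exprn_ge0; exact: sqr_ge0. Qed.

Lemma sum_pow_le (m Q : nat) (a : 'I_m.+1 -> R) : (forall i, 0 <= a i) ->
  (\sum_i a i) ^+ Q <= m.+1%:R ^+ Q * \sum_i a i ^+ Q.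
Proof.
move=> a0; pose k := [arg max_(i > ord0) a i]%O.
have ak i : a i <= a k.
  by rewrite /k; case: Order.TotalTheory.arg_maxP => // j _ /(_ i isT).
have : \sum_i a i <= m.+1%:R * a k.
  apply: le_trans (ler_sum _ (fun i _ => ak i)) _.
  by rewrite sumr_const card_ord mulr_natl.
move=> /(lerXn2r Q) => /(_ _ _)/le_trans; apply.
- by rewrite nnegrE sumr_ge0.
- by rewrite nnegrE mulr_ge0.
rewrite exprMn ler_wpM2l ?exprn_ge0// (bigD1 k)//= lerDl.
by apply: sumr_ge0 => i _; exact: exprn_ge0.
Qed.

(** Adding one centred term multiplies the moment by at most [1 + C b^2]: the
    linear term averages to zero and all higher ones carry [b^2]. *)
Lemma lin_form_moment_le (D : nat) (K : R) (b : nat -> R) n : 0 <= K ->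
  (forall j i, (i <= D.*2)%N -> mean j (fun v => `|v| ^+ i) <= K) ->
  (forall j, `|b j| <= 1) ->
  1 + E n (fun x => lin_form b n x ^+ D.*2) <=
    2 * expR (4 ^+ D * K * \sum_(j < n) b j ^+ 2).
Proof.
move=> K0 HK b1; have C0 : 0 <= 4 ^+ D * K by rewrite mulr_ge0// exprn_ge0.
elim: n => [|n IH].
  rewrite big_ord0 mulr0 expR0 mulr1 /= /lin_form big_ord0 expr0n.
  by case: (_ == _) => /=; lra.
rewrite big_ord_recr /= mulrDr expRD mulrA.
set S := E n _ in IH.
apply: (@le_trans _ _ ((1 + S) * (1 + 4 ^+ D * K * b n ^+ 2))); last first.
  apply: ler_pM => //; last exact: expR_ge1Dx.
  - by apply: addr_ge0 => //; apply: prod_mean_ge0 => // x; exact: exprn_double_ge0.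
  - by apply: addr_ge0 => //; apply: mulr_ge0 => //; exact: sqr_ge0.
suff : E n (fun x => mean n (fun v => lin_form b n.+1 (upd x n v) ^+ D.*2)) <=
    E n (fun x => lin_form b n x ^+ D.*2 +
       (4 ^+ D * K * b n ^+ 2) * (1 + lin_form b n x ^+ D.*2)).
  rewrite prod_meanD// prod_meanZ// prod_meanD// prod_mean_cst// -/S; nra.
apply: le_prod_mean => // x; set a := lin_form b n x.
under eq_fun do rewrite lin_form_upd -/a.
case: D HK {IH S C0} => [|D] HK.
  rewrite /= !expr0; under eq_fun do rewrite expr0.
  rewrite coord_mean_cst// lerDl; apply: mulr_ge0 => //.
  by apply: mulr_ge0; [exact: mulr_ge0 | exact: sqr_ge0].
have am i : (i <= D.+1.*2)%N -> `|a| ^+ i <= 1 + a ^+ D.+1.*2.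
  move=> iD; have -> : a ^+ D.+1.*2 = `|a| ^+ D.+1.*2.
    by rewrite -mul2n !exprM real_normK// num_real.
  have [a1|/ltW a1] := leP `|a| 1.
    by apply: (@le_trans _ _ 1); rewrite ?exprn_ile1// lerDl exprn_ge0.
  by apply: le_trans (ler_weXn2l a1 iD) _; rewrite lerDr.
set A := 1 + a ^+ D.+1.*2 in am *.
have A0 : 0 <= A by apply: addr_ge0 => //; exact: exprn_double_ge0.
pose T (v : R) : R := \sum_(i < D.+1.*2.+1) 'C(D.+1.*2, i)%:R * `|v| ^+ i.
have step v : (a + b n * v) ^+ D.+1.*2 <=
    (a ^+ D.+1.*2 + (D.+1.*2%:R * a ^+ D.*2.+1 * b n) * v) +
    (b n ^+ 2 * A) * T v.
  rewrite exprDn doubleS big_ord_recl big_ord_recl /=.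
  rewrite addrA -[X in _ <= X + _]/(a ^+ D.*2.+2 + D.*2.+2%:R * a ^+ D.*2.+1 * b n * v).
  apply: lerD.
    rewrite /bump /= subn0 subn1 expr0 mulr1 expr1 bin0 bin1 mulr1n.
    by rewrite lerD2l -mulr_natl le_eqVlt; apply/orP; left; apply/eqP; ring.
  have TT : \sum_(i < D.*2.+1) 'C(D.*2.+2, i.+2)%:R * `|v| ^+ i.+2 <= T v.
    rewrite [T v]big_ord_recl [X in _ <= _ + X]big_ord_recl /= addrA lerDr.
    by apply: addr_ge0; apply: mulr_ge0 => //; exact: exprn_ge0.
  have bA : 0 <= b n ^+ 2 * A by apply: mulr_ge0 => //; exact: sqr_ge0.
  apply: le_trans (ler_wpM2l bA TT).
  rewrite big_distrr /=; apply: ler_sum => i _; rewrite /bump /= !add1n.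
  rewrite -mulr_natl [X in _ <= X]mulrCA ler_wpM2l//.
  apply: le_trans (ler_norm _) _; rewrite normrM !normrX normrM exprMn.
  rewrite [X in _ <= X](_ : _ = (b n ^+ 2 * `|v| ^+ i.+2) * A); last by ring.
  rewrite [X in X <= _](_ : _ = (`|b n| ^+ i.+2 * `|v| ^+ i.+2) * `|a| ^+ (D.*2.+2 - i.+2)); last by ring.
  apply: ler_pM; [by apply: mulr_ge0; exact: exprn_ge0|exact: exprn_ge0| |
    by apply: am; exact: leq_subr].
  rewrite ler_wpM2r ?exprn_ge0//.
  rewrite -[b n ^+ 2]real_normK ?num_real// -addn2 exprD.
  by rewrite ler_piMl ?exprn_ge0// exprn_ile1.
apply: le_trans (le_coord_mean V w_ge0 n step) _.
rewrite !coord_meanD coord_mean_cst// !coord_meanZ w_mean0 mulr0 addr0 lerD2l.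
rewrite [X in _ <= X](_ : _ = b n ^+ 2 * A * (4 ^+ D.+1 * K)); last by ring.
apply: ler_wpM2l; first by apply: mulr_ge0 => //; exact: sqr_ge0.
rewrite /T coord_mean_sum.
apply: (@le_trans _ _ (\sum_(i < D.+1.*2.+1) 'C(D.+1.*2, i)%:R * K)).
  by apply: ler_sum => i _; rewrite coord_meanZ ler_wpM2l// HK// -ltnS.
rewrite -big_distrl /= ler_wpM2r//.
have -> : (4 : R) ^+ D.+1 = ((1 + 1) ^ D.+1.*2)%N%:R.
  by rewrite natrX -mul2n exprM; congr (_ ^+ _); rewrite -natrX.
rewrite expnDn natr_sum; apply: ler_sum => i _.
by rewrite !exp1n !muln1.
Qed.

End finite_model.

(** * Stein's identity for the squared modulus of a normalized sum *)

Section stein.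
Context {R : realType}.
Variables (V : nat -> seq R) (w : nat -> R -> R) (K : nat -> R).
Hypothesis w_ge0 : forall j v, 0 <= w j v.
Hypothesis w_sum1 : forall j, \sum_(v <- V j) w j v = 1.
Hypothesis w_mean0 : forall j, coord_mean V w j id = 0.
Hypothesis w_var1 : forall j, coord_mean V w j (fun v => v ^+ 2) = 1.
Hypothesis w_moment : forall Q j i, (i <= Q.*2)%N ->
  coord_mean V w j (fun v => `|v| ^+ i) <= K Q.

Local Notation mean := (coord_mean V w).

Lemma moment_bound_ge0 Q : 0 <= K Q.
Proof.
apply: le_trans (w_moment 0%N (leq0n _)).
by rewrite -(coord_mean_cst w_sum1 0%N 0); apply: le_coord_mean.
Qed.

(** For a variable of mean 0 and variance 1, [E (v f(v)) - E f'(v)] only sees the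
    second-order Taylor remainders of [f] at 0. *)
Lemma stein_one_variable (f df ddf B : R -> R) j :
  (forall x : R, is_derive x 1 f (df x)) -> (forall x : R, is_derive x 1 df (ddf x)) ->
  (forall v x, `|x| <= `|v| -> `|ddf x| <= B v) ->
  `|mean j (fun v => v * f v) - mean j df| <=
    mean j (fun v => (`|v| ^+ 3 + `|v|) * B v).
Proof.
move=> fd dfd HB.
have -> : mean j (fun v => v * f v) - mean j df =
    mean j (fun v => v * (f v - f 0 - v * df 0) - (df v - df 0)).
  have -> : (fun v => v * (f v - f 0 - v * df 0) - (df v - df 0)) =
      (fun v => (v * f v - df v) + ((- f 0) * v + (- df 0 * v ^+ 2 + df 0))).
    by apply/funext => v; ring.
  rewrite coord_meanD coord_meanB coord_meanD coord_meanD !coord_meanZ.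
  by rewrite coord_mean_cst// w_var1 w_mean0; ring.
apply: le_trans (coord_mean_norm V w_ge0 _ _) _; apply: le_coord_mean => // v.
apply: le_trans (ler_normB _ _) _; rewrite mulrDl; apply: lerD.
  rewrite normrM exprS -mulrA ler_wpM2l// [leRHS]mulrC.
  by apply: (taylor2_le fd dfd) => x; exact: HB.
by rewrite [leRHS]mulrC; apply: (taylor1_le dfd) => x; exact: HB.
Qed.

Variables (n : nat) (c s : nat -> R).
Hypothesis n_gt0 : (0 < n)%N.
Hypothesis cs_norm : forall j, c j ^+ 2 + s j ^+ 2 = n%:R^-1.

Local Notation E := (prod_mean V w n).
Local Notation X := (lin_form c n).
Local Notation Y := (lin_form s n).

(** [|sum_j a_j x_j|^2] for the complex coefficients [a_j = c_j + i s_j]. *)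
Definition sq_modulus (x : nat -> R) : R := X x ^+ 2 + Y x ^+ 2.

Local Notation r := sq_modulus.

(** The exponential bounds the product of the factors [1 + C b_j^2], where
    [sum_j b_j^2 <= 1]; the result is uniform in [n]. *)
Definition moment_const Q : R := 4 ^+ Q * (1 + 4 * expR (4 ^+ Q * K Q) + K Q).

Lemma sq_modulus_ge0 x : 0 <= r x.
Proof. by apply: addr_ge0; exact: sqr_ge0. Qed.

Let nV_le1 : n%:R^-1 <= 1 :> R.
Proof. by rewrite invf_le1 ?ler1n ?ltr0n. Qed.

Let coef_moment (b : nat -> R) Q : (forall j, b j ^+ 2 <= n%:R^-1) ->
  E (fun x => lin_form b n x ^+ Q.*2) <= 2 * expR (4 ^+ Q * K Q).
Proof.
move=> bn; have b1 j : `|b j| <= 1.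
  rewrite -(@ler_pXn2r _ 2)// ?nnegrE// expr1n real_normK ?num_real//.
  exact: le_trans (bn j) nV_le1.
have := lin_form_moment_le w_ge0 w_sum1 w_mean0 n (moment_bound_ge0 Q)
  (w_moment (Q := Q)) b1.
move=> H; apply: le_trans (le_trans H _); first by rewrite lerDr.
rewrite ler_wpM2l// ler_expR -[leRHS]mulr1 ler_wpM2l//.
  by apply: mulr_ge0; [exact: exprn_ge0 | exact: moment_bound_ge0].
apply: (@le_trans _ _ (\sum_(j < n) n%:R^-1)); first by apply: ler_sum.
by rewrite sumr_const card_ord -[leLHS]mulr_natr mulVf// pnatr_eq0 -lt0n.
Qed.

Let c_le j : c j ^+ 2 <= n%:R^-1.
Proof. by rewrite -(cs_norm j) lerDl sqr_ge0. Qed.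

Let s_le j : s j ^+ 2 <= n%:R^-1.
Proof. by rewrite -(cs_norm j) lerDr sqr_ge0. Qed.

(** The summand [x_j^2] makes room for the Taylor remainder in the coordinate
    [x_j], evaluated between 0 and [x_j]. *)
Lemma sq_modulus_coord_moment Q j : (j < n)%N ->
  E (fun x => (1 + r x + x j ^+ 2) ^+ Q) <= moment_const Q.
Proof.
move=> jn; rewrite /moment_const.
apply: (@le_trans _ _ (E (fun x => 4 ^+ Q * ((1 + lin_form c n x ^+ Q.*2) +
    (lin_form s n x ^+ Q.*2 + x j ^+ Q.*2))))).
  apply: le_prod_mean => // x.
  pose a (i : 'I_4) : R := [:: 1; lin_form c n x ^+ 2; lin_form s n x ^+ 2; x j ^+ 2]`_i.
  have a0 i : 0 <= a i.
    by rewrite /a; case: i => [[|[|[|[|]]]]] //= _; exact: sqr_ge0.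
  have := sum_pow_le Q a0.
  rewrite !big_ord_recl !big_ord0 /= /a /= expr1n -!exprM mul2n !addr0.
  by rewrite /r !addrA.
rewrite prod_meanZ ler_wpM2l ?exprn_ge0// !prod_meanD// prod_mean_cst//.
have Hc := coef_moment Q c_le; have Hs := coef_moment Q s_le.
have Hx : E (fun x => x j ^+ Q.*2) <= K Q.
  rewrite -(prod_mean_coord w_sum1 _ jn) -(prod_mean_cst w_sum1 n (K Q)).
  apply: le_prod_mean => // x; apply: le_trans (w_moment j (leqnn _)).
  apply: le_coord_mean => // v; rewrite upd_same.
  by rewrite -mul2n !exprM real_normK// num_real.
lra.
Qed.

Lemma sq_modulus_moment Q : E (fun x => (1 + r x) ^+ Q) <= moment_const Q.
Proof.
apply: le_trans (sq_modulus_coord_moment Q n_gt0).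
apply: le_prod_mean => // x; apply: lerXn2r.
- by rewrite nnegrE addr_ge0// sq_modulus_ge0.
- by rewrite nnegrE !addr_ge0// ?sqr_ge0.
- by rewrite lerDl sqr_ge0.
Qed.

Hypothesis c_norm : \sum_(j < n) c j ^+ 2 = 2^-1.
Hypothesis s_norm : \sum_(j < n) s j ^+ 2 = 2^-1.
Hypothesis cs_orth : \sum_(j < n) c j * s j = 0.

Section test_function.
Variables (g dg ddg : R -> R) (C : R) (p : nat).
Hypothesis g_der : forall x : R, is_derive x 1 g (dg x).
Hypothesis dg_der : forall x : R, is_derive x 1 dg (ddg x).
Hypothesis dg_le : forall x : R, 0 <= x -> `|dg x| <= C * (1 + x) ^+ p.
Hypothesis ddg_le : forall x : R, 0 <= x -> `|ddg x| <= C * (1 + x) ^+ p.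

Let sd : R := Num.sqrt n%:R^-1.
Let sd_ge0 : 0 <= sd. Proof. exact: sqrtr_ge0. Qed.
Let sdE : sd ^+ 2 = n%:R^-1. Proof. by rewrite sqr_sqrtr// invr_ge0. Qed.
Let C_ge0 : 0 <= C.
Proof.
have := le_trans (normr_ge0 _) (dg_le (lexx 0)).
by rewrite addr0 expr1n mulr1.
Qed.

Let q := (p + 3)%N.

(* The component of the sum in the direction of coordinate j. *)
Let proj j x := c j * X x + s j * Y x.

Let proj_le j x : `|proj j x| <= sd * (1 + r x).
Proof.
have r0 := sq_modulus_ge0 x.
have : proj j x ^+ 2 <= sd ^+ 2 * r x.
  rewrite sdE -(cs_norm j) /proj /r.
  by have := sqr_ge0 (c j * Y x - s j * X x); nra.
have t0 : 0 <= sd * (1 + r x) by apply: mulr_ge0 => //; exact: addr_ge0.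
move=> H; rewrite -(@ler_pXn2r _ 2) ?nnegrE//.
rewrite real_normK ?num_real// exprMn; apply: le_trans H _.
rewrite ler_wpM2l ?sqr_ge0//; nra.
Qed.

(* Only the projection and the modulus depend on coordinate j, so that the
   second derivative in x_j is of order n^(-3/2). *)
Let coord_stein j x : (j < n)%N ->
  `|mean j (fun v => v * (proj j (upd x j v) * g (r (upd x j v)))) -
    mean j (fun v => n%:R^-1 * g (r (upd x j v)) +
                     2 * proj j (upd x j v) ^+ 2 * dg (r (upd x j v)))| <=
  mean j (fun v => (20 * C * sd ^+ 3 * 8 ^+ q) *
     (1 + r (upd x j v) + (upd x j v) j ^+ 2) ^+ (q + 2)).
Proof.
move=> jn.
have Xv v : X (upd x j v) = X (upd x j 0) + c j * v.
  by rewrite !lin_form_reset//; ring.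
have Yv v : Y (upd x j v) = Y (upd x j 0) + s j * v.
  by rewrite !lin_form_reset//; ring.
set X0 := X (upd x j 0) in Xv *; set Y0 := Y (upd x j 0) in Yv *.
pose P (v : R) := (c j * X0 + s j * Y0) + n%:R^-1 * v.
have Pv v : proj j (upd x j v) = P v.
  by rewrite /proj Xv Yv /P -(cs_norm j); ring.
pose rho (v : R) := (X0 ^+ 2 + Y0 ^+ 2) + (2 * (c j * X0 + s j * Y0)) * v + n%:R^-1 * v ^+ 2.
have rv v : r (upd x j v) = rho v.
  by rewrite /r Xv Yv /rho -(cs_norm j); ring.
have Pd (v : R) : is_derive v 1 P n%:R^-1.
  by apply: is_derive_eq; rewrite /GRing.scale /=; ring.
have rd (v : R) : is_derive v 1 rho (2 * P v).
  by apply: is_derive_eq; rewrite /GRing.scale /= /P; ring.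
have gd (v : R) : is_derive v 1 (fun v => g (rho v)) (dg (rho v) * (2 * P v)).
  by apply: is_derive1_comp.
have dgd (v : R) : is_derive v 1 (fun v => dg (rho v)) (ddg (rho v) * (2 * P v)).
  by apply: is_derive1_comp.
pose f (v : R) := P v * g (rho v).
pose df (v : R) := n%:R^-1 * g (rho v) + 2 * P v ^+ 2 * dg (rho v).
pose ddf (v : R) := 6 * n%:R^-1 * P v * dg (rho v) + 4 * P v ^+ 3 * ddg (rho v).
have fd (v : R) : is_derive v 1 f (df v).
  apply: is_derive_eq; rewrite /GRing.scale /= /df; ring.
have dfd (v : R) : is_derive v 1 df (ddf v).
  apply: is_derive_eq; rewrite /GRing.scale /= /ddf; ring.
pose B (v : R) := 10 * C * sd ^+ 3 * 8 ^+ q * (1 + rho v + v ^+ 2) ^+ q.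
have rho0 v : 0 <= rho v by rewrite -rv sq_modulus_ge0.
have ddfB u : `|ddf u| <= 10 * C * sd ^+ 3 * (1 + rho u) ^+ q.
  have ru := rho0 u; have t1 : 1 <= 1 + rho u by rewrite lerDl.
  have Pu : `|P u| <= sd * (1 + rho u) by rewrite -Pv -rv proj_le.
  have H1 : `|6 * n%:R^-1 * P u * dg (rho u)| <= 6 * C * sd ^+ 3 * (1 + rho u) ^+ q.
    have nn : `|n%:R^-1 : R| = sd ^+ 2 by rewrite sdE ger0_norm// invr_ge0.
    rewrite !normrM (ger0_norm (x := 6))// nn.
    rewrite [X in _ <= X](_ : _ = 6 * sd ^+ 2 * (sd * (1 + rho u)) *
      (C * (1 + rho u) ^+ p * (1 + rho u) ^+ 2)); last by rewrite /q exprD; ring.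
    apply: ler_pM => //; first by apply: mulr_ge0 => //; apply: mulr_ge0 => //; exact: sqr_ge0.
      by rewrite ler_wpM2l// mulr_ge0// sqr_ge0.
    apply: le_trans (dg_le ru) _; rewrite ler_peMr ?exprn_ege1//.
    by apply: mulr_ge0 => //; apply: exprn_ge0; exact: le_trans t1.
  have H2 : `|4 * P u ^+ 3 * ddg (rho u)| <= 4 * C * sd ^+ 3 * (1 + rho u) ^+ q.
    rewrite normrM (normrM 4) (ger0_norm (x := 4))// normrX.
    rewrite [X in _ <= X](_ : _ = 4 * (sd * (1 + rho u)) ^+ 3 *
      (C * (1 + rho u) ^+ p)); last by rewrite /q exprD; ring.
    apply: ler_pM => //; last exact: ddg_le.
    by rewrite ler_wpM2l// lerXn2r// nnegrE ?normr_ge0// mulr_ge0// (le_trans _ t1).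
  apply: le_trans (ler_normD _ _) _; lra.
have HB v u : `|u| <= `|v| -> `|ddf u| <= B v.
  move=> uv; apply: le_trans (ddfB u) _.
  rewrite /B -[X in _ <= X]mulrA -exprMn; apply: ler_wpM2l.
    by apply: mulr_ge0; [exact: mulr_ge0|exact: exprn_ge0].
  have rv0 := rho0 v.
  apply: lerXn2r; rewrite ?nnegrE; [exact: addr_ge0| |].
    by apply: mulr_ge0 => //; apply: addr_ge0; [exact: addr_ge0|exact: sqr_ge0].
  have du : (u - v) ^+ 2 <= 4 * v ^+ 2.
    have : u ^+ 2 <= v ^+ 2 by rewrite -[u ^+ 2]real_normK ?num_real// -[v ^+ 2]real_normK ?num_real// lerXn2r.
    by have := sqr_ge0 (u + v); nra.
  (* |z|^2 <= 2 |z'|^2 + 2 |z - z'|^2 for the values z, z' of the complex sum. *)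
  have : rho u <= 2 * rho v + 2 * n%:R^-1 * (u - v) ^+ 2.
    rewrite -!rv /r !Xv !Yv -(cs_norm j).
    rewrite -subr_ge0 [leRHS](_ : _ = (X0 + c j * v - c j * (u - v)) ^+ 2 +
      (Y0 + s j * v - s j * (u - v)) ^+ 2); last by ring.
    by apply: addr_ge0; exact: sqr_ge0.
  have : n%:R^-1 * (u - v) ^+ 2 <= (u - v) ^+ 2 by rewrite ler_piMl ?sqr_ge0.
  rewrite -mulrA => h1 h2; have h3 := sqr_ge0 v.
  by move: rv0 h1 h2 h3 du; move: (rho u) (rho v) (n%:R^-1 * _) => ? ? ?; lra.
have := @stein_one_variable f df ddf B j fd dfd HB.
have -> : (fun v => v * f v) = (fun v => v * (proj j (upd x j v) * g (r (upd x j v)))).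
  by apply/funext => v; rewrite Pv rv.
have -> : df = (fun v => n%:R^-1 * g (r (upd x j v)) +
                     2 * proj j (upd x j v) ^+ 2 * dg (r (upd x j v))).
  by apply/funext => v; rewrite Pv rv.
move=> H; apply: le_trans H _; apply: le_coord_mean => // v.
rewrite upd_same rv /B exprD.
have v2 : `|v| ^+ 2 = v ^+ 2 by rewrite real_normK ?num_real.
have hv : `|v| ^+ 3 + `|v| <= 2 * (1 + rho v + v ^+ 2) ^+ 2.
  have := rho0 v; have := normr_ge0 v; rewrite -v2 => a0 b0.
  have : `|v| <= 1 + `|v| ^+ 2 by have := sqr_ge0 (`|v| - 1); nra.
  nra.
set Z := 1 + rho v + v ^+ 2 in hv *.
have Z0 : 0 <= Z by apply: addr_ge0; [exact: addr_ge0|exact: sqr_ge0].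
rewrite [X in _ <= X](_ : _ = (2 * Z ^+ 2) * (10 * C * sd ^+ 3 * 8 ^+ q * Z ^+ q)); last by ring.
apply: ler_wpM2r => //; apply: mulr_ge0; last exact: exprn_ge0.
by apply: mulr_ge0 => //; apply: mulr_ge0; [exact: mulr_ge0|exact: exprn_ge0].
Qed.

(** Stein's identity for the exponential law, up to [n^(-1/2)]: integrating by
    parts in each coordinate, the conditions on [c] and [s] (the sum is
    asymptotically circular) turn the sum of the partial derivatives into
    [(r g)'(r) = g r + r g' r]. *)
Lemma stein_exponential :
  `|E (fun x => r x * g (r x)) - E (fun x => g (r x) + r x * dg (r x))| <=
   20 * C * 8 ^+ q * moment_const (q + 2) * sd.
Proof.
have E1 : E (fun x => r x * g (r x)) =
    \sum_(j < n) E (fun x => x j * (proj j x * g (r x))).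
  rewrite -prod_mean_sum; congr prod_mean; apply/funext => x.
  under eq_bigr do rewrite mulrA.
  rewrite -big_distrl /=; congr (_ * _).
  rewrite /r !expr2 {1}/lin_form {2}/lin_form !big_distrl -big_split /=.
  by apply: eq_bigr => j _; rewrite /proj; ring.
have E2 : E (fun x => g (r x) + r x * dg (r x)) =
    \sum_(j < n) E (fun x => n%:R^-1 * g (r x) + 2 * proj j x ^+ 2 * dg (r x)).
  rewrite -prod_mean_sum; congr prod_mean; apply/funext => x.
  rewrite big_split /= sumr_const card_ord -[X in _ = X + _]mulr_natl mulrA.
  rewrite mulfV ?pnatr_eq0 -?lt0n// mul1r; congr (_ + _).
  rewrite -big_distrl -big_distrr /=; congr (_ * _).
  under eq_bigr => j _.
    rewrite (_ : proj j x ^+ 2 = X x ^+ 2 * c j ^+ 2 + (Y x ^+ 2 * s j ^+ 2 +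
      (2 * X x * Y x) * (c j * s j))); last by rewrite /proj; ring.
    over.
  rewrite !big_split -!big_distrr /= c_norm s_norm cs_orth /r.
  by field.
rewrite E1 E2 -sumrB; apply: le_trans (ler_norm_sum _ _ _) _.
have sd2 : 20 * C * 8 ^+ q * moment_const (q + 2) * sd =
    \sum_(j < n) (20 * C * sd ^+ 3 * 8 ^+ q * moment_const (q + 2)).
  rewrite sumr_const card_ord -mulr_natl exprS sdE.
  by field; rewrite pnatr_eq0 -lt0n.
rewrite sd2; apply: ler_sum => j _.
rewrite -(prod_mean_coord w_sum1 _ (ltn_ord j)).
rewrite -[X in _ - X](prod_mean_coord w_sum1 _ (ltn_ord j)) -prod_meanB.
apply: le_trans (prod_mean_norm V w_ge0 _ _) _.
apply: (@le_trans _ _ (E (fun x => mean j (fun v => (20 * C * sd ^+ 3 * 8 ^+ q) *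
     (1 + r (upd x j v) + (upd x j v) j ^+ 2) ^+ (q + 2))))).
  apply: le_prod_mean => // x.
  have -> : (fun v => upd x j v j * (proj j (upd x j v) * g (r (upd x j v)))) =
      (fun v => v * (proj j (upd x j v) * g (r (upd x j v)))).
    by apply/funext => v; rewrite upd_same.
  exact: coord_stein.
rewrite (prod_mean_coord w_sum1 (fun x => (20 * C * sd ^+ 3 * 8 ^+ q) *
     (1 + r x + x j ^+ 2) ^+ (q + 2)) (ltn_ord j)) prod_meanZ.
apply: ler_wpM2l; last exact: sq_modulus_coord_moment.
by apply: mulr_ge0; [apply: mulr_ge0; [exact: mulr_ge0|]|]; exact: exprn_ge0.
Qed.

End test_function.

End stein.

Section limit_laws.
Context {R : realType}.

(** [K Q] bounds the moments of order up to [2 Q] of all coordinates, so that the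
    error terms below depend on [K] alone. *)
Definition standard_laws (K : nat -> R) (V : nat -> seq R) (w : nat -> R -> R) :=
  [/\ forall j v, 0 <= w j v,
      forall j, \sum_(v <- V j) w j v = 1,
      forall j, coord_mean V w j id = 0,
      forall j, coord_mean V w j (fun v => v ^+ 2) = 1
    & forall Q j i, (i <= Q.*2)%N ->
        coord_mean V w j (fun v => `|v| ^+ i) <= K Q].

(** The real and imaginary parts of the coefficients [a_j] of a sum with
    [|a_j|^2 = 1/n], [sum |a_j|^2 = 1] and [sum a_j^2 = 0]. *)
Definition circular_coefs n (c s : nat -> R) :=
  [/\ forall j, c j ^+ 2 + s j ^+ 2 = n%:R^-1,
      \sum_(j < n) c j ^+ 2 = 2^-1, \sum_(j < n) s j ^+ 2 = 2^-1
    & \sum_(j < n) c j * s j = 0].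

Lemma is_derive_exprn (k : nat) (x : R) :
  is_derive x 1 (fun x : R => x ^+ k) (k%:R * x ^+ k.-1).
Proof.
have -> : (fun x : R => x ^+ k) = (id : R -> R) ^+ k.
  by apply/funext => y; rewrite exprfctE.
by apply: is_derive_eq; rewrite /GRing.scale /= mulr1.
Qed.

Lemma is_derive_coord_mean (V : nat -> seq R) w j (F dF : R -> R -> R) (t : R) :
  (forall v, is_derive t (1 : R) (F^~ v) (dF t v)) ->
  is_derive t (1 : R) (fun t => coord_mean V w j (F t)) (coord_mean V w j (dF t)).
Proof.
move=> Fd; rewrite /coord_mean; elim: (V j) => [|v s IH].
  under eq_fun do rewrite big_nil.
  by rewrite big_nil; exact: is_derive_cst.
under eq_fun do rewrite big_cons.
by rewrite big_cons; apply: is_deriveD.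
Qed.

Lemma is_derive_prod_mean (V : nat -> seq R) w n (F dF : R -> (nat -> R) -> R) (t : R) :
  (forall x, is_derive t (1 : R) (F^~ x) (dF t x)) ->
  is_derive t (1 : R) (fun t => prod_mean V w n (F t)) (prod_mean V w n (dF t)).
Proof.
elim: n F dF => [|n IH] F dF Fd //=.
pose G t x := coord_mean V w n (fun v => F t (upd x n v)).
pose dG t x := coord_mean V w n (fun v => dF t (upd x n v)).
apply: (IH G dG) => x.
exact: (@is_derive_coord_mean V w n (fun t v => F t (upd x n v))
  (fun t v => dF t (upd x n v))).
Qed.

Lemma sq_modulus_moment_le (K : nat -> R) (V : nat -> seq R) w n c s m :
  standard_laws K V w -> (0 < n)%N ->
  (forall j, c j ^+ 2 + s j ^+ 2 = n%:R^-1) ->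
  prod_mean V w n (fun x => sq_modulus n c s x ^+ m) <= moment_const K m.
Proof.
move=> [w0 w1 wm wv wK] n0 cs.
apply: le_trans (sq_modulus_moment w0 w1 wm wK n0 cs m).
apply: le_prod_mean => // x; move: (sq_modulus _ _ _ _) (sq_modulus_ge0 n c s x) => y y0.
by apply: lerXn2r; rewrite ?nnegrE ?lerDr// addr_ge0.
Qed.

(** For [g = r^m] Stein's identity reads [E r^(m+1) = (m+1) E r^m] up to the
    error term: the recursion of the factorial. *)
Lemma sq_modulus_moment_factorial (K : nat -> R) m : exists C : R, 0 <= C /\
  forall V w n c s, standard_laws K V w -> (0 < n)%N -> circular_coefs n c s ->
  `|prod_mean V w n (fun x => sq_modulus n c s x ^+ m) - m`!%:R| <=
    C * Num.sqrt n%:R^-1.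
Proof.
(* There are no standard laws if K takes a negative value. *)
have [K0|] := pselect (forall Q, 0 <= K Q); last first.
  move=> K0; exists 0; split => // V w n c s [w0 w1 wm wv wK].
  by case: K0; exact: moment_bound_ge0 w0 w1 wK.
have mc0 Q : 0 <= moment_const K Q.
  apply: mulr_ge0; first exact: exprn_ge0.
  by apply: addr_ge0 => //; apply: addr_ge0 => //; exact: mulr_ge0.
elim: m => [|m [C [C0 IH]]].
  exists 0; split => // V w n c s [w0 w1 wm wv wK] n0 cs.
  have -> : (fun x => sq_modulus n c s x ^+ 0) = (fun=> 1) by [].
  by rewrite prod_mean_cst// fact0 subrr normr0 mul0r.
pose B := 20 * (m%:R ^+ 2) * 8 ^+ (m + 3) * moment_const K (m + 3 + 2) : R.
have B0 : 0 <= B by exact: mulr_ge0.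
exists (m.+1%:R * C + B); split; first by apply: addr_ge0 => //; exact: mulr_ge0.
move=> V w n c s HL n0 HC; have := IH _ _ _ _ _ HL n0 HC.
case: HL HC => [w0 w1 wm wv wK] [cs1 cc ss cs0] {IH}.
pose g (x : R) := x ^+ m; pose dg (x : R) := m%:R * x ^+ m.-1.
pose ddg (x : R) := m%:R * (m.-1%:R * x ^+ m.-2).
have gd (x : R) : is_derive x 1 g (dg x) by exact: is_derive_exprn.
have dgd (x : R) : is_derive x 1 dg (ddg x).
  exact: (@is_deriveZ _ _ _ _ _ _ _ _ (is_derive_exprn m.-1 x)).
have xm (x : R) i : 0 <= x -> (i <= m)%N -> `|x ^+ i| <= (1 + x) ^+ m.
  move=> x0 im; rewrite normrX (ger0_norm x0).
  apply: le_trans (_ : (1 + x) ^+ i <= _).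
    by apply: lerXn2r; rewrite ?nnegrE ?lerDr// addr_ge0.
  by apply: ler_weXn2l => //; rewrite lerDl.
have dgb (x : R) : 0 <= x -> `|dg x| <= m%:R ^+ 2 * (1 + x) ^+ m.
  move=> x0; rewrite normrM normr_nat; apply: ler_pM => //.
    by rewrite -natrX ler_nat; case: (m) => // k; rewrite expnS leq_pmulr ?expn_gt0.
  by apply: xm => //; exact: leq_pred.
have ddgb (x : R) : 0 <= x -> `|ddg x| <= m%:R ^+ 2 * (1 + x) ^+ m.
  move=> x0; rewrite /ddg mulrA normrM -natrM normr_nat; apply: ler_pM => //.
    by rewrite -natrX ler_nat expnS expn1 leq_mul// leq_pred.
  by apply: xm => //; exact: leq_trans (leq_pred _) (leq_pred _).
have := stein_exponential w0 w1 wm wv wK n0 cs1 cc ss cs0 gd dgd dgb ddgb.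
rewrite -/B.
have -> : (fun x => sq_modulus n c s x * g (sq_modulus n c s x)) =
          (fun x => sq_modulus n c s x ^+ m.+1).
  by apply/funext => x; rewrite exprS.
have -> : (fun x => g (sq_modulus n c s x) + sq_modulus n c s x * dg (sq_modulus n c s x))
   = (fun x => m.+1%:R * sq_modulus n c s x ^+ m).
  apply/funext => x; rewrite /g /dg; case: (m) => [|k] /=.
    by rewrite expr0 mul0r mulr0 addr0 mulr1.
  by rewrite mulrCA -exprS -[in RHS]natr1; ring.
rewrite prod_meanZ factS natrM => H1 H2.
set a := prod_mean _ _ _ _ in H1 *; set b := prod_mean _ _ _ _ in H1 H2.
rewrite (_ : a - _ = (a - m.+1%:R * b) + m.+1%:R * (b - m`!%:R)); last by ring.
apply: le_trans (ler_normD _ _) _; rewrite mulrDl addrC; apply: lerD => //.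
by rewrite normrM normr_nat -mulrA ler_wpM2l.
Qed.

(** Since [(g + r g') - r g] is the derivative of [(1 + t) E(g)] in [t] for
    [g = exp (- t r)], Stein's identity is a differential equation for the
    Laplace transform, solved by that of the exponential law. *)
Lemma sq_modulus_laplace (K : nat -> R) (t : R) : 0 <= t -> exists C : R, 0 <= C /\
  forall V w n c s, standard_laws K V w -> (0 < n)%N -> circular_coefs n c s ->
  `|prod_mean V w n (fun x => expR (- (t * sq_modulus n c s x))) - (1 + t)^-1| <=
    C * Num.sqrt n%:R^-1.
Proof.
move=> t0.
(* There are no standard laws if K takes a negative value. *)
have [K0|] := pselect (forall Q, 0 <= K Q); last first.
  move=> K0; exists 0; split => // V w n c s [w0 w1 wm wv wK].
  by case: K0; exact: moment_bound_ge0 w0 w1 wK.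
have mc0 Q : 0 <= moment_const K Q.
  apply: mulr_ge0; first exact: exprn_ge0.
  by apply: addr_ge0 => //; apply: addr_ge0 => //; exact: mulr_ge0.
pose B := 20 * (t + t ^+ 2) * 8 ^+ (0 + 3) * moment_const K (0 + 3 + 2) : R.
have tt0 : 0 <= t + t ^+ 2 by rewrite addr_ge0 ?sqr_ge0.
have B0 : 0 <= B.
  apply: mulr_ge0 => //; apply: mulr_ge0 => //. exact: mulr_ge0.
exists (B * t); split; first exact: mulr_ge0.
move=> V w n c s [w0 w1 wm wv wK] n0 [cs1 cc ss cs0].
set r := sq_modulus n c s; set sd := Num.sqrt _.
have sd0 : 0 <= sd by exact: sqrtr_ge0.
pose F u x := expR (- (u * r x)); pose dF u x := - (r x) * F u x.
have Fd (u : R) x : is_derive u (1 : R) (F^~ x) (dF u x).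
  have gd : is_derive u (1 : R) (fun u => - (u * r x)) (- r x).
    by apply: is_derive_eq; rewrite /GRing.scale /=; ring.
  rewrite /dF mulrC.
  exact: (is_derive1_comp (f := expR) (g := fun u => - (u * r x)) (is_derive_expR _) gd).
pose f u := (1 + u) * prod_mean V w n (F u).
pose df u := prod_mean V w n (F u) + (1 + u) * prod_mean V w n (dF u).
have fd (u : R) : is_derive u (1 : R) f (df u).
  have Ed := is_derive_prod_mean V w n (Fd u).
  apply: is_derive_eq; rewrite /GRing.scale /= /df; ring.
have dfB u : 0 <= u -> u <= t -> `|df u| <= B * sd.
  move=> u0 ut.
  pose g (x : R) := expR (- (u * x)).
  pose dg (x : R) := - u * g x; pose ddg (x : R) := u ^+ 2 * g x.
  have gd (x : R) : is_derive x 1 g (dg x).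
    have hd : is_derive x (1 : R) (fun x => - (u * x)) (- u).
      by apply: is_derive_eq; rewrite /GRing.scale /=; ring.
    rewrite /dg mulrC.
    exact: (is_derive1_comp (f := expR) (g := fun x => - (u * x)) (is_derive_expR _) hd).
  have dgd (x : R) : is_derive x 1 dg (ddg x).
    by apply: is_derive_eq; rewrite /GRing.scale /= /ddg /dg; ring.
  have g01 x : 0 <= x -> 0 <= g x <= 1.
    by move=> x0; rewrite expR_ge0 -expR0 ler_expR oppr_le0 mulr_ge0.
  have t2 : 0 <= t ^+ 2 by exact: sqr_ge0.
  have dgb (x : R) : 0 <= x -> `|dg x| <= (t + t ^+ 2) * (1 + x) ^+ 0.
    move=> x0; have /andP[g0 g1] := g01 _ x0.
    by rewrite normrM normrN !ger0_norm// mulr1; nra.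
  have ddgb (x : R) : 0 <= x -> `|ddg x| <= (t + t ^+ 2) * (1 + x) ^+ 0.
    move=> x0; have /andP[g0 g1] := g01 _ x0.
    have u2 : u ^+ 2 <= t ^+ 2 by rewrite lerXn2r.
    rewrite normrM !ger0_norm ?sqr_ge0// mulr1.
    by have := sqr_ge0 u; nra.
  have := stein_exponential w0 w1 wm wv wK n0 cs1 cc ss cs0 gd dgd dgb ddgb.
  rewrite -/B -/sd -/r distrC.
  rewrite (_ : _ - _ = df u)// /df -prod_meanB -prod_meanZ -prod_meanD.
  by congr prod_mean; apply/funext => x; rewrite /dF /dg /F /g; ring.
have cf A : {within A, continuous f}.
  apply: continuous_subspaceT => x; apply/differentiable_continuous.
  by apply/derivable1_diffP; case: (fd x).
have [z] := MVT_segment t0 (fun z _ => fd z) (cf _).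
rewrite in_itv /= subr0 => /andP[z0 zt].
have -> : f 0 = 1.
  rewrite /f addr0 mul1r -[RHS](prod_mean_cst w1 n); congr prod_mean.
  by apply/funext => x; rewrite /F mul0r oppr0 expR0.
move=> ft; have t1 : 0 < 1 + t by apply: (lt_le_trans ltr01); rewrite lerDl.
rewrite (_ : _ - _ = (f t - 1) / (1 + t)); last by rewrite /f /F; field; exact: lt0r_neq0.
rewrite ft normrM normfV (gtr0_norm t1) ler_pdivrMr// normrM (ger0_norm t0).
have := dfB z z0 zt => H.
have : 0 <= B * sd * t by apply: mulr_ge0 => //; exact: mulr_ge0.
have : `|df z| * t <= B * sd * t by rewrite ler_wpM2r.
rewrite [B * t * sd]mulrAC; nra.
Qed.

End limit_laws.

(** * The trigonometric tight frame *)

Section trigonometric_sums.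
Context {R : realType}.
Implicit Types a b t x : R.

Lemma sinD_natpi m x : sin (x + m%:R * pi) = (-1) ^+ m * sin x.
Proof.
elim: m => [|m IH]; first by rewrite mul0r addr0 expr0 mul1r.
by rewrite -[m.+1%:R]natr1 mulrDl mul1r addrA sinDpi IH exprS mulN1r mulNr.
Qed.

Lemma cosD_natpi m x : cos (x + m%:R * pi) = (-1) ^+ m * cos x.
Proof.
elim: m => [|m IH]; first by rewrite mul0r addr0 expr0 mul1r.
by rewrite -[m.+1%:R]natr1 mulrDl mul1r addrA cosDpi IH exprS mulN1r mulNr.
Qed.

Lemma sum_cos_telescope a b m :
  2 * sin a * \sum_(i < m) cos (b + i%:R * (2 * a)) =
  sin (b + m%:R * (2 * a) - a) - sin (b - a).
Proof.
elim: m => [|m IH]; first by rewrite big_ord0 mulr0 mul0r addr0 subrr.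
rewrite big_ord_recr /= mulrDr IH -[m.+1%:R]natr1.
set y := b + m%:R * (2 * a).
have -> : b + (m%:R + 1) * (2 * a) - a = y + a by rewrite /y; ring.
by rewrite !sinB !sinD; ring.
Qed.

Lemma sum_sin_telescope a b m :
  2 * sin a * \sum_(i < m) sin (b + i%:R * (2 * a)) =
  cos (b - a) - cos (b + m%:R * (2 * a) - a).
Proof.
elim: m => [|m IH]; first by rewrite big_ord0 mulr0 mul0r addr0 subrr.
rewrite big_ord_recr /= mulrDr IH -[m.+1%:R]natr1.
set y := b + m%:R * (2 * a).
have -> : b + (m%:R + 1) * (2 * a) - a = y + a by rewrite /y; ring.
by rewrite !cosB !cosD; ring.
Qed.

End trigonometric_sums.

Section frame.
Context {R : realType}.
Variable n : nat.
Local Notation N := n.+1.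
Implicit Types (k j d : nat) (x : nat -> R).

(** [exp (i * angle k)] runs over the [N]-th roots of -1. *)
Definition angle k : R := k.*2.+1%:R * (pi / N%:R).

Definition frame_cos k j : R := cos (j%:R * angle k) / Num.sqrt N%:R.
Definition frame_sin k j : R := sin (j%:R * angle k) / Num.sqrt N%:R.

Let N_neq0 : N%:R != 0 :> R. Proof. by rewrite pnatr_eq0. Qed.
Let sqrtN2 : Num.sqrt (N%:R : R) ^+ 2 = N%:R. Proof. by rewrite sqr_sqrtr. Qed.
Let sqrtN_neq0 : Num.sqrt (N%:R : R) != 0.
Proof. by rewrite sqrtr_eq0 -ltNge ltr0n. Qed.

Let NV : N%:R^-1 = (Num.sqrt (N%:R : R))^-1 ^+ 2.
Proof. by rewrite exprVn sqrtN2. Qed.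

Lemma angle_full k : N%:R * angle k = k.*2.+1%:R * pi.
Proof. by rewrite /angle mulrCA [_ * (pi / _)]mulrC divfK. Qed.

Lemma frame_norm k j : frame_cos k j ^+ 2 + frame_sin k j ^+ 2 = N%:R^-1.
Proof.
by rewrite /frame_cos /frame_sin !exprMn -mulrDl cos2Dsin2 mul1r exprVn sqrtN2.
Qed.

Lemma sum_cos_angle d : (0 < d < N)%N -> \sum_(k < N) cos (d%:R * angle k) = 0.
Proof.
move=> /andP[d0 dN]; pose a : R := d%:R * (pi / N%:R).
have sa : 2 * sin a != 0.
  rewrite mulf_neq0// gt_eqF// sin_gt0_pi// /a.
  rewrite mulr_gt0 ?ltr0n ?divr_gt0 ?pi_gt0 ?ltr0n//=.
  rewrite mulrCA gtr_pMr ?pi_gt0// ltr_pdivrMr ?ltr0n// mul1r ltr_nat//.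
apply: (mulfI sa); rewrite mulr0.
rewrite (eq_bigr (fun k : 'I_N => cos (a + k%:R * (2 * a)))); last first.
  by move=> k _; congr cos; rewrite /angle /a -muln2 -natr1 natrM; ring.
rewrite sum_cos_telescope subrr sin0 subr0.
have -> : a + N%:R * (2 * a) - a = 0 + (2 * d)%N%:R * pi.
  by rewrite /a natrM; field; rewrite addrC natr1.
by rewrite sinD_natpi sin0 mulr0.
Qed.

(** The frame is tight: Parseval's identity in operator form. *)
Lemma frame_orth i j : (i < N)%N -> (j < N)%N ->
  \sum_(k < N) (frame_cos k i * frame_cos k j + frame_sin k i * frame_sin k j) =
  (i == j)%:R.
Proof.
wlog ij : i j / (i <= j)%N.
  move=> W iN jN; have [ij|/ltnW ji] := leqP i j; first exact: W.
  rewrite eq_sym -(W j i)//; apply: eq_bigr => k _.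
  by rewrite [frame_cos _ _ * _]mulrC [frame_sin _ _ * _]mulrC.
move=> iN jN; have [->|nij] := eqVneq i j.
  under eq_bigr do rewrite -!expr2 frame_norm.
  by rewrite sumr_const card_ord -[LHS]mulr_natr mulVf.
transitivity (N%:R^-1 * \sum_(k < N) cos ((j - i)%:R * angle k)).
  rewrite big_distrr; apply: eq_bigr => k _ /=.
  rewrite natrB// mulrBl cosB /frame_cos /frame_sin NV.
  by ring.
by rewrite sum_cos_angle ?mulr0// subn_gt0 ltn_neqAle nij ij /= (leq_ltn_trans (leq_subr _ _)).
Qed.

Lemma frame_parseval x :
  \sum_(k < N) sq_modulus N (frame_cos k) (frame_sin k) x = \sum_(j < N) x j ^+ 2.
Proof.
transitivity (\sum_(k < N) \sum_(i < N) \sum_(j < N) x i * x j *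
  (frame_cos k i * frame_cos k j + frame_sin k i * frame_sin k j)).
  apply: eq_bigr => k _; rewrite /sq_modulus /lin_form !expr2 !big_distrlr -big_split /=.
  apply: eq_bigr => i _; rewrite -big_split; apply: eq_bigr => j _ /=; ring.
rewrite exchange_big; apply: eq_bigr => i _; rewrite exchange_big /=.
under eq_bigr do rewrite -big_distrr /= frame_orth//.
rewrite (bigD1 i)//= eqxx mulr1 big1 ?addr0// => j ji.
by rewrite (_ : (i == j :> nat) = false) ?mulr0//; apply/negbTE; rewrite eq_sym.
Qed.

Section off_real_axis.
Variable k : nat.
Hypotheses (kN : (k < N)%N) (k_mid : k.*2.+1 != N).

Let sin_angle_neq0 : sin (angle k) != 0 :> R.
Proof.
have piN : 0 < pi / N%:R :> R by rewrite divr_gt0 ?pi_gt0 ?ltr0n.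
have [kl|kl] := ltnP k.*2.+1 N.
  rewrite gt_eqF// sin_gt0_pi// /angle mulr_gt0 ?ltr0n//=.
  by rewrite mulrCA gtr_pMr ?pi_gt0// ltr_pdivrMr ?ltr0n// mul1r ltr_nat.
have {}kl : (N < k.*2.+1)%N by rewrite ltn_neqAle eq_sym k_mid.
have -> : angle k = (angle k - pi) + pi by rewrite subrK.
rewrite sinDpi oppr_eq0 gt_eqF// sin_gt0_pi// subr_gt0 ltrBlDr.
have -> : angle k = pi * (k.*2.+1%:R / N%:R) by rewrite /angle mulrCA.
rewrite ltr_pMr ?pi_gt0// ltr_pdivlMr ?ltr0n// mul1r ltr_nat kl /=.
rewrite (_ : pi + pi = pi * 2); last by ring.
rewrite ltr_pM2l ?pi_gt0// ltr_pdivrMr ?ltr0n// -natrM ltr_nat.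
by have := kN; rewrite -leq_double mul2n doubleS.
Qed.

Lemma sum_cos_double_angle : \sum_(j < N) cos (j%:R * (2 * angle k)) = 0.
Proof.
have sa : 2 * sin (angle k) != 0 by rewrite mulf_neq0.
apply: (mulfI sa); rewrite mulr0.
under eq_bigr => j _ do rewrite -[j%:R * _]add0r.
rewrite sum_cos_telescope !add0r mulrCA angle_full sinN.
have -> : 2 * (k.*2.+1%:R * pi) - angle k = - angle k + (2 * k.*2.+1)%N%:R * pi.
  by rewrite natrM; ring.
by rewrite sinD_natpi exprM sqrrN !expr1n mul1r sinN subrr.
Qed.

Lemma sum_sin_double_angle : \sum_(j < N) sin (j%:R * (2 * angle k)) = 0.
Proof.
have sa : 2 * sin (angle k) != 0 by rewrite mulf_neq0.
apply: (mulfI sa); rewrite mulr0.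
under eq_bigr => j _ do rewrite -[j%:R * _]add0r.
rewrite sum_sin_telescope !add0r mulrCA angle_full cosN.
have -> : 2 * (k.*2.+1%:R * pi) - angle k = - angle k + (2 * k.*2.+1)%N%:R * pi.
  by rewrite natrM; ring.
by rewrite cosD_natpi exprM sqrrN !expr1n mul1r cosN subrr.
Qed.

(** The eigenvalue is a genuinely complex sum, asymptotically circular, unless
    the root of unity is the real number -1. *)
Lemma frame_circular : circular_coefs N (frame_cos k) (frame_sin k).
Proof.
have c2 j : frame_cos k j ^+ 2 = (2 * N%:R)^-1 + (2 * N%:R)^-1 * cos (j%:R * (2 * angle k)).
  have -> : j%:R * (2 * angle k) = (j%:R * angle k) *+ 2 by rewrite -mulr_natr; ring.
  rewrite cos_mulr2n /frame_cos invfM NV -[_ *+ 2]mulr_natr.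
  by field.
have s2 j : frame_sin k j ^+ 2 = (2 * N%:R)^-1 - (2 * N%:R)^-1 * cos (j%:R * (2 * angle k)).
  have := frame_norm k j; rewrite c2 => H.
  have -> : frame_sin k j ^+ 2 = N%:R^-1 - ((2 * N%:R)^-1 + (2 * N%:R)^-1 * cos (j%:R * (2 * angle k))).
    by rewrite -H; ring.
  by field; rewrite addrC natr1.
have cs j : frame_cos k j * frame_sin k j = (2 * N%:R)^-1 * sin (j%:R * (2 * angle k)).
  have -> : j%:R * (2 * angle k) = (j%:R * angle k) *+ 2 by rewrite -mulr_natr; ring.
  rewrite sin_mulr2n /frame_cos /frame_sin invfM NV -[_ *+ 2]mulr_natr.
  by field.
have half : \sum_(j < N) (2 * N%:R)^-1 = 2^-1 :> R.
  by rewrite sumr_const card_ord -[LHS]mulr_natr; field; rewrite addrC natr1.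
split; first by move=> j; exact: frame_norm.
- under eq_bigr do rewrite c2.
  by rewrite big_split /= half -big_distrr /= sum_cos_double_angle mulr0 addr0.
- under eq_bigr do rewrite s2.
  by rewrite sumrB /= half -big_distrr /= sum_cos_double_angle mulr0 subr0.
- under eq_bigr do rewrite cs.
  by rewrite -big_distrr /= sum_sin_double_angle mulr0.
Qed.

End off_real_axis.

End frame.

(** * Spectrum of the left skew-circulant matrix *)

Section skew_circulant.
Context {R : realType}.
Variables (n : nat) (l : nat -> R).
Local Notation N := n.+1.
Local Notation M := ((Num.sqrt N%:R)^-1 *: LScirc N l : 'M[R]_N).
Local Notation X k := (lin_form (frame_cos n k) N l).
Local Notation Y k := (lin_form (frame_sin n k) N l).
Local Notation r k := (sq_modulus N (frame_cos n k) (frame_sin n k) l).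

Let vc k : 'cV[R]_N := \col_(j < N) frame_cos n k j.
Let vs k : 'cV[R]_N := \col_(j < N) frame_sin n k j.

(* The index i + j is read modulo N; both l and the frame vectors change sign
   when an index is shifted by N, so the two signs cancel. *)
Let LScirc_entry k (i j : 'I_N) :
  LScirc N l i j * cos (j%:R * angle n k) =
    l (i + j)%R * cos ((i + j)%R%:R * angle n k - i%:R * angle n k) /\
  LScirc N l i j * sin (j%:R * angle n k) =
    l (i + j)%R * sin ((i + j)%R%:R * angle n k - i%:R * angle n k).
Proof.
rewrite !mxE /=; set t := angle n k; case: ltnP => ij.
  rewrite modn_small// natrD.
  by rewrite (_ : (i%:R + j%:R) * t - i%:R * t = j%:R * t)//; ring.
have -> : ((i + j) %% N = i + j - N)%N.
  rewrite -[in LHS](subnK ij) modnDr modn_small// ltn_subLR//.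
  have := ltn_ord i; have := ltn_ord j; lia.
have -> : j%:R * t = ((i + j - N)%:R * t - i%:R * t) + k.*2.+1%:R * pi.
  by rewrite -(angle_full n k) -/t natrB// natrD; ring.
rewrite sinD_natpi cosD_natpi -signr_odd /= odd_double /= expr1.
by rewrite !mulN1r !mulrNN.
Qed.

(** With [v = vc k + i vs k] this and the next lemma say that the matrix maps [v]
    to [X k + i Y k] times the conjugate of [v]; hence its square acts as the
    scalar [r k] on the plane of [vc k] and [vs k]. *)
Lemma LScirc_frame_cos k : M *m vc k = X k *: vc k + Y k *: vs k.
Proof.
apply/colP => i; rewrite !mxE.
transitivity (\sum_(j < N) N%:R^-1 * (l j * cos (j%:R * angle n k - i%:R * angle n k))).
  rewrite [RHS](reindex_inj (addrI i)); apply: eq_bigr => j _.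
  rewrite -(LScirc_entry k i j).1 mxE [vc k j 0]mxE /frame_cos.
  have -> : N%:R^-1 = (Num.sqrt N%:R)^-1 * (Num.sqrt N%:R)^-1 :> R.
    by rewrite -invfM -expr2 sqr_sqrtr.
  ring.
have -> : N%:R^-1 = (Num.sqrt N%:R)^-1 * (Num.sqrt N%:R)^-1 :> R.
  by rewrite -invfM -expr2 sqr_sqrtr.
rewrite /lin_form !big_distrl -big_split; apply: eq_bigr => j _ /=.
by rewrite cosB /frame_cos /frame_sin; ring.
Qed.

Lemma LScirc_frame_sin k : M *m vs k = Y k *: vc k - X k *: vs k.
Proof.
apply/colP => i; rewrite !mxE.
transitivity (\sum_(j < N) N%:R^-1 * (l j * sin (j%:R * angle n k - i%:R * angle n k))).
  rewrite [RHS](reindex_inj (addrI i)); apply: eq_bigr => j _.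
  rewrite -(LScirc_entry k i j).2 mxE [vs k j 0]mxE /frame_sin.
  have -> : N%:R^-1 = (Num.sqrt N%:R)^-1 * (Num.sqrt N%:R)^-1 :> R.
    by rewrite -invfM -expr2 sqr_sqrtr.
  ring.
have -> : N%:R^-1 = (Num.sqrt N%:R)^-1 * (Num.sqrt N%:R)^-1 :> R.
  by rewrite -invfM -expr2 sqr_sqrtr.
rewrite /lin_form !big_distrl -sumrB; apply: eq_bigr => j _ /=.
by rewrite sinB /frame_cos /frame_sin; ring.
Qed.

Let frame_sqr k (v : 'cV[R]_N) : v = vc k \/ v = vs k ->
  M *m (M *m v) = r k *: v.
Proof.
case=> ->.
  rewrite LScirc_frame_cos mulmxDr -!scalemxAr LScirc_frame_cos LScirc_frame_sin.
  by apply/colP => i; rewrite !mxE /sq_modulus; ring.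
rewrite LScirc_frame_sin mulmxBr -!scalemxAr LScirc_frame_cos LScirc_frame_sin.
by apply/colP => i; rewrite !mxE /sq_modulus; ring.
Qed.

Let frame_even_power k (v : 'cV[R]_N) q : v = vc k \/ v = vs k ->
  M ^+ (2 * q) *m v = r k ^+ q *: v.
Proof.
move=> Hv; elim: q => [|q IH]; first by rewrite muln0 !expr0 scale1r mul1mx.
rewrite mulnS addnC exprD expr2 -mulmxA.
rewrite [(M * M) *m v](_ : _ = r k *: v); last first.
  by rewrite -[(M * M)]/(M *m M) -mulmxA (frame_sqr Hv).
by rewrite -scalemxAr IH scalerA exprS.
Qed.

Let trace_frame (A : 'M[R]_N) : \tr A =
  \sum_(k < N) \sum_(i < N) ((A *m vc k) i 0 * vc k i 0 + (A *m vs k) i 0 * vs k i 0).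
Proof.
rewrite exchange_big /mxtrace; apply: eq_bigr => i _ /=.
transitivity (\sum_(j < N) A i j * (j == i)%:R).
  by rewrite (bigD1 i)//= eqxx mulr1 big1 ?addr0// => j /negPf ->; rewrite mulr0.
transitivity (\sum_(j < N) \sum_(k < N) A i j *
    (frame_cos n k j * frame_cos n k i + frame_sin n k j * frame_sin n k i)).
  by apply: eq_bigr => j _; rewrite -big_distrr /= frame_orth.
rewrite exchange_big; apply: eq_bigr => k _ /=.
rewrite !mxE !big_distrl -big_split; apply: eq_bigr => j _ /=.
by rewrite !mxE; ring.
Qed.

(** The failure of the frame vectors [exp (i * j * angle k)] to be isotropic;
    it is the contribution of index [k] to the trace. *)
Definition trace_defect k : R :=
  X k * (\sum_(j < N) (frame_cos n k j ^+ 2 - frame_sin n k j ^+ 2)) +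
  2 * Y k * \sum_(j < N) frame_cos n k j * frame_sin n k j.

Lemma trace_even_power q : \tr (M ^+ (2 * q)) = \sum_(k < N) r k ^+ q.
Proof.
rewrite trace_frame; apply: eq_bigr => k _.
rewrite (frame_even_power q (or_introl (erefl (vc k)))).
rewrite (frame_even_power q (or_intror (erefl (vs k)))).
transitivity (\sum_(i < N) r k ^+ q * N%:R^-1).
  by apply: eq_bigr => i _; rewrite !mxE -(frame_norm n k i); ring.
by rewrite sumr_const card_ord -[LHS]mulr_natr divfK ?pnatr_eq0.
Qed.

Lemma trace_odd_power q :
  \tr (M ^+ (2 * q).+1) = \sum_(k < N) r k ^+ q * trace_defect k.
Proof.
rewrite trace_frame; apply: eq_bigr => k _.
rewrite exprS -[M * _]/(M *m _) -!mulmxA.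
rewrite (frame_even_power q (or_introl (erefl (vc k)))).
rewrite (frame_even_power q (or_intror (erefl (vs k)))).
rewrite -!scalemxAr LScirc_frame_cos LScirc_frame_sin /trace_defect.
rewrite [X k * \sum_(_ < _) _]big_distrr [2 * Y k * _]big_distrr -big_split.
rewrite big_distrr /=.
by apply: eq_bigr => i _; rewrite !mxE; ring.
Qed.

Lemma trace_defect_eq0 k : (k < N)%N -> k.*2.+1 != N -> trace_defect k = 0.
Proof.
move=> kN km; have [_ cc ss cs] := @frame_circular R n k kN km.
by rewrite /trace_defect sumrB cc ss cs subrr !mulr0 addr0.
Qed.

(** The coefficients of [X k] and [Y k] in the defect are at most 1 in modulus. *)
Lemma trace_defect_le k : trace_defect k ^+ 2 <= 4 * r k.
Proof.
rewrite /trace_defect; set a := \sum_(j < N) _; set b := \sum_(j < N) _.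
have one : \sum_(j < N) N%:R^-1 = 1 :> R.
  by rewrite sumr_const card_ord -[LHS]mulr_natr mulVf ?pnatr_eq0.
have a1 : `|a| <= 1.
  apply: le_trans (ler_norm_sum _ _ _) _; rewrite -[leRHS]one; apply: ler_sum => j _.
  rewrite -(frame_norm n k j) ler_norml.
  have := sqr_ge0 (frame_cos n k j : R); have := sqr_ge0 (frame_sin n k j : R).
  by move=> ? ?; apply/andP; split; lra.
have b1 : `|2 * b| <= 1.
  rewrite big_distrr; apply: le_trans (ler_norm_sum _ _ _) _.
  rewrite -[leRHS]one; apply: ler_sum => j _; rewrite -(frame_norm n k j) ler_norml /=.
  have := sqr_ge0 (frame_cos n k j + frame_sin n k j : R).
  have := sqr_ge0 (frame_cos n k j - frame_sin n k j : R).
  by move=> ? ?; apply/andP; split; lra.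
have a2 : a ^+ 2 <= 1 by rewrite -[a ^+ 2]real_normK ?num_real// exprn_ile1.
have b2 : (2 * b) ^+ 2 <= 1 by rewrite -[_ ^+ 2]real_normK ?num_real// exprn_ile1.
rewrite (_ : 2 * Y k * b = Y k * (2 * b)); last by ring.
move: a2 b2; move: (2 * b) => c a2 b2; rewrite /sq_modulus.
set u := lin_form _ _ _; set v := lin_form _ _ _.
have h1 : u ^+ 2 * a ^+ 2 <= u ^+ 2 by rewrite ler_piMr// sqr_ge0.
have h2 : v ^+ 2 * c ^+ 2 <= v ^+ 2 by rewrite ler_piMr// sqr_ge0.
have h3 := sqr_ge0 (u * a - v * c); have h4 := sqr_ge0 u; have h5 := sqr_ge0 v.
by nra.
Qed.

End skew_circulant.

Section eigenvalue_sums.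
Context {R : realType}.

Lemma conj_diag_power (F : fieldType) n (S : 'M[F]_n.+1) (D : 'rV[F]_n.+1) p :
  S \in unitmx ->
  (invmx S *m diag_mx D *m S : 'M[F]_n.+1) ^+ p =
  invmx S *m diag_mx (\row_i D 0 i ^+ p) *m S.
Proof.
move=> uS; elim: p => [|p IH].
  rewrite (_ : \row_i _ = const_mx 1); last by apply/rowP => i; rewrite !mxE.
  by rewrite diag_const_mx mulmx1 mulVmx.
rewrite exprS IH -mulmxE !mulmxA mulmxK// -!mulmxA; congr (_ *m _).
rewrite !mulmxA mulmx_diag; congr (diag_mx _ *m _).
by apply/rowP => i; rewrite !mxE exprS.
Qed.

(** By diagonalization over the complex numbers, where the eigenvalues are those
    of the real matrix because the characteristic polynomials agree. *)
Lemma eigenvalues_trace n (A : 'M[R]_n.+1) p : A^T = A ->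
  \sum_(x <- eigenvalues A) x ^+ p = \tr (A ^+ p).
Proof.
move=> symA; pose toC := real_complex R; pose B := map_mx toC A.
have hB : B \is hermsymmx.
  apply/is_hermitianmxP; rewrite expr0 scale1r.
  apply/matrixP => i j; rewrite !mxE -{1}symA mxE.
  exact/esym/CrealP/complex_realP/(ex_intro _ (A j i)).
have /hermitian_normalmx/orthomx_spectralP EB := hB.
set S := spectralmx B in EB; set D := spectral_diag B in EB.
have uS : S \in unitmx by exact: spectral_unit.
have powB : B ^+ p = invmx S *m diag_mx (\row_i D 0 i ^+ p) *m S.
  transitivity ((invmx S *m diag_mx D *m S : 'M[R[i]]_n.+1) ^+ p); first by congr (_ ^+ p).
  exact: conj_diag_power.
have trB : \tr (B ^+ p) = \sum_i D 0 i ^+ p.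
  rewrite powB mxtrace_mulC mulmxA mulmxV// mul1mx mxtrace_diag.
  by apply: eq_bigr => i _; rewrite mxE.
have cpB : \prod_(x <- map toC (eigenvalues A)) ('X - x%:P) =
    \prod_(x <- [seq D 0 i | i <- index_enum 'I_n.+1]) ('X - x%:P).
  transitivity (char_poly B).
    rewrite -map_char_poly char_poly_eigenvalues// rmorph_prod big_map.
    by apply: eq_bigr => x _; rewrite /= map_polyXsubC.
  rewrite {1}EB char_poly_sim// char_poly_trig ?diag_mx_is_trig// big_map.
  by apply: eq_bigr => i _; rewrite mxE eqxx mulr1n.
have pe : perm_eq (map toC (eigenvalues A)) [seq D 0 i | i <- index_enum 'I_n.+1].
  by apply/allP => x _ /=; rewrite -!mu_prod_XsubC cpB.
apply: (fmorph_inj toC); rewrite -trace_map_mx rmorphXn /= -/B trB rmorph_sum /=.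
under eq_bigr do rewrite rmorphXn.
rewrite -(big_map toC predT (fun x => x ^+ p)) (perm_big _ pe) /=.
by rewrite big_map.
Qed.

Lemma interpolation (f : R -> R) (s : seq R) :
  exists p : {poly R}, forall x, x \in s -> p.[x] = f x.
Proof.
elim: s => [|y s [p Hp]]; first by exists 0.
have [ys|ys] := boolP (y \in s).
  by exists p => x; rewrite inE => /predU1P[->|]; exact: Hp.
pose q : {poly R} := \prod_(z <- s) ('X - z%:P).
have q0 x : x \in s -> q.[x] = 0.
  by move=> xs; apply/rootP; rewrite root_prod_XsubC.
have qy : q.[y] != 0 by rewrite -[_ == 0]/(root q y) root_prod_XsubC.
exists (p + ((f y - p.[y]) / q.[y]) *: q) => x; rewrite inE hornerD hornerZ.
by move=> /predU1P[->|xs]; [field|by rewrite (q0 _ xs) mulr0 addr0 Hp].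
Qed.

(** Only the sums of powers of the eigenvalues are known, from the traces; any
    [f] agrees with a polynomial on the finitely many points involved. *)
Lemma eigenvalues_LScirc_sum n (l : nat -> R) (f : R -> R) (B : R) :
  (forall x, `|f x| <= B) ->
  `| \sum_(x <- eigenvalues ((Num.sqrt n.+1%:R)^-1 *: LScirc n.+1 l)) f x -
     \sum_(k < n.+1) 2^-1 *
       (f (Num.sqrt (sq_modulus n.+1 (frame_cos n k) (frame_sin n k) l)) +
        f (- Num.sqrt (sq_modulus n.+1 (frame_cos n k) (frame_sin n k) l))) | <= 2 * B.
Proof.
move=> fB; have B0 : 0 <= B := le_trans (normr_ge0 _) (fB 0).
set M := _ *: _; pose r k := sq_modulus n.+1 (frame_cos n k) (frame_sin n k) l.
have r0 k : 0 <= r k by exact: sq_modulus_ge0.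
have symM : M^T = M by rewrite /M linearZ /= LScirc_sym.
pose pts := eigenvalues M ++ ([seq Num.sqrt (r k) | k <- iota 0 n.+1] ++
  [seq - Num.sqrt (r k) | k <- iota 0 n.+1]).
have [p Hp] := interpolation f pts.
have Hp1 x : x \in eigenvalues M -> p.[x] = f x.
  by move=> xs; apply: Hp; rewrite mem_cat xs.
have Hp2 k : (k < n.+1)%N -> p.[Num.sqrt (r k)] = f (Num.sqrt (r k)).
  move=> kn; apply: Hp; rewrite !mem_cat; apply/orP; right; apply/orP; left.
  by apply: (map_f (fun k => Num.sqrt (r k))); rewrite mem_iota.
have Hp3 k : (k < n.+1)%N -> p.[- Num.sqrt (r k)] = f (- Num.sqrt (r k)).
  move=> kn; apply: Hp; rewrite !mem_cat; apply/orP; right; apply/orP; right.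
  by apply: (map_f (fun k => - Num.sqrt (r k))); rewrite mem_iota.
have pE x : p.[x] = (even_poly p).[x ^+ 2] + x * (odd_poly p).[x ^+ 2].
  by rewrite -{1}(poly_even_odd p) hornerD hornerM !horner_comp hornerXn hornerX [x * _]mulrC.
have -> : \sum_(x <- eigenvalues M) f x =
    \sum_(k < n.+1) (even_poly p).[r k] +
    \sum_(k < n.+1) (odd_poly p).[r k] * trace_defect n l k.
  under eq_big_seq => x xs do rewrite -Hp1// pE.
  rewrite big_split /=; congr (_ + _).
    under eq_bigr do rewrite horner_coef.
    under [RHS]eq_bigr do rewrite horner_coef.
    rewrite exchange_big [RHS]exchange_big; apply: eq_bigr => i _ /=.
    rewrite -!big_distrr /=; congr (_ * _).
    under eq_bigr do rewrite -exprM.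
    by rewrite eigenvalues_trace// trace_even_power.
  under eq_bigr do rewrite horner_coef big_distrr.
  under [RHS]eq_bigr do rewrite horner_coef big_distrl.
  rewrite exchange_big [RHS]exchange_big; apply: eq_bigr => i _ /=.
  under eq_bigr do rewrite mulrCA -exprM -exprS.
  under [RHS]eq_bigr do rewrite -mulrA.
  rewrite -!big_distrr /=; congr (_ * _).
  by rewrite eigenvalues_trace// trace_odd_power.
have -> : \sum_(k < n.+1) 2^-1 * (f (Num.sqrt (r k)) + f (- Num.sqrt (r k))) =
    \sum_(k < n.+1) (even_poly p).[r k].
  apply: eq_bigr => k _; rewrite -Hp2// -Hp3// !pE sqrrN sqr_sqrtr//.
  by field.
rewrite addrAC subrr add0r.
have small k : (k < n.+1)%N -> `|(odd_poly p).[r k] * trace_defect n l k| <= 2 * B.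
  move=> kn; apply: (@le_trans _ _ `|f (Num.sqrt (r k)) - f (- Num.sqrt (r k))|).
    rewrite -Hp2// -Hp3// !pE sqrrN sqr_sqrtr//.
    rewrite [X in _ <= `|X|](_ : _ = (odd_poly p).[r k] * (2 * Num.sqrt (r k))); last by ring.
    rewrite !normrM ler_wpM2l// -normrM -(@ler_pXn2r _ 2) ?nnegrE//.
    rewrite !real_normK ?num_real// exprMn sqr_sqrtr//.
    have -> : (2 : R) ^+ 2 = 4 by ring.
    exact: trace_defect_le.
  by apply: le_trans (ler_normB _ _) _; rewrite mulr_natl mulr2n lerD.
have [[k km]|nomid] := pselect (exists k : 'I_n.+1, k.*2.+1 = n.+1).
  rewrite (bigD1 k)//= big1 ?addr0; first exact: small.
  move=> j jk; rewrite trace_defect_eq0 ?mulr0//; apply: contra jk => /eqP jm.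
  by apply/eqP/val_inj/double_inj/succn_inj; exact: etrans jm (esym km).
rewrite big1 ?normr0 ?mulr_ge0// => k _; rewrite trace_defect_eq0 ?mulr0//.
by apply/eqP => km; apply: nomid; exists k.
Qed.

End eigenvalue_sums.

(** * Concentration of the empirical Laplace transform *)

Section bounded_support.
Context {R : realType}.
Variables (V : nat -> seq R) (w : nat -> R -> R) (K : R).
Hypothesis w_ge0 : forall j v, 0 <= w j v.
Hypothesis w_sum1 : forall j, \sum_(v <- V j) w j v = 1.
Hypothesis K_ge0 : 0 <= K.
Hypothesis V_le : forall j v, v \in V j -> `|v| <= K.

Lemma le_prod_mean_bounded n F G :
  (forall x, (forall i, `|x i| <= K) -> F x <= G x) ->
  prod_mean V w n F <= prod_mean V w n G.
Proof.
elim: n F G => [|n IH] F G FG /=; first by apply: FG => i; rewrite normr0.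
apply: IH => x xK; rewrite /coord_mean !big_seq; apply: ler_sum => v vV.
apply: ler_wpM2l => //; apply: FG => i; rewrite /upd.
by case: eqP => _ //; exact: V_le vV.
Qed.

(** Applying the Efron-Stein inequality to [F], then to [(F - E F)^2]. *)
Lemma efron_stein_fourth n (F : (nat -> R) -> R) (B : R) : 0 <= B ->
  (forall x, (forall i, `|x i| <= K) ->
    \sum_(j < n) (F x - F (upd x j 0)) ^+ 2 <= B) ->
  prod_mean V w n (fun x => (F x - prod_mean V w n F) ^+ 4) <= 11 * B ^+ 2.
Proof.
move=> B0 FB; set m := prod_mean V w n F.
have varF : prod_mean V w n (fun x => (F x - m) ^+ 2) <= B.
  have -> : prod_mean V w n (fun x => (F x - m) ^+ 2) =
      prod_mean V w n (fun x => F x ^+ 2) - m ^+ 2.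
    have -> : (fun x => (F x - m) ^+ 2) =
        (fun x => (F x ^+ 2 + - 2 * m * F x) + m ^+ 2).
      by apply/funext => x; ring.
    by rewrite !prod_meanD prod_meanZ prod_mean_cst// -/m; ring.
  apply: le_trans (efron_stein w_ge0 w_sum1 n F) _.
  rewrite -prod_mean_sum -(prod_mean_cst w_sum1 n B).
  exact: le_prod_mean_bounded.
pose H x := (F x - m) ^+ 2.
have varH : \sum_(j < n) prod_mean V w n (fun x => (H x - H (upd x j 0)) ^+ 2) <=
    10 * B ^+ 2.
  rewrite -prod_mean_sum.
  apply: (@le_trans _ _ (prod_mean V w n (fun x => (8 * B) * (F x - m) ^+ 2 + 2 * B ^+ 2))).
    apply: le_prod_mean_bounded => x xK.
    apply: (@le_trans _ _ (\sum_(j < n) (F x - F (upd x j 0)) ^+ 2 *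
        (8 * (F x - m) ^+ 2 + 2 * B))).
      apply: ler_sum => j _.
      have dB : (F x - F (upd x j 0)) ^+ 2 <= B.
        apply: le_trans (FB x xK); rewrite (bigD1 j)//= lerDl.
        by apply: sumr_ge0 => i _; exact: sqr_ge0.
      rewrite /H; set a := F x - m; set D := F x - F _ in dB *.
      rewrite (_ : F _ - m = a - D); last by rewrite /a /D; ring.
      rewrite (_ : (a ^+ 2 - (a - D) ^+ 2) ^+ 2 = D ^+ 2 * (2 * a - D) ^+ 2); last by ring.
      by apply: ler_wpM2l; [exact: sqr_ge0 | have := sqr_ge0 (2 * a + D); nra].
    rewrite -big_distrl /=.
    apply: le_trans (_ : _ <= B * (8 * (F x - m) ^+ 2 + 2 * B)) _.
      apply: ler_wpM2r; last exact: FB.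
      by apply: addr_ge0; apply: mulr_ge0 => //; exact: sqr_ge0.
    by rewrite le_eqVlt; apply/orP; left; apply/eqP; ring.
  rewrite prod_meanD prod_meanZ prod_mean_cst//.
  by have : 8 * B * prod_mean V w n (fun x => (F x - m) ^+ 2) <= 8 * B * B;
    [apply: ler_wpM2l => //; exact: mulr_ge0 | lra].
have := le_trans (efron_stein w_ge0 w_sum1 n H) varH.
have -> : (fun x => H x ^+ 2) = (fun x => (F x - m) ^+ 4).
  by apply/funext => x; rewrite /H -exprM.
have EH0 : 0 <= prod_mean V w n H by apply: prod_mean_ge0 => // x; exact: sqr_ge0.
have : prod_mean V w n H ^+ 2 <= B ^+ 2 by rewrite lerXn2r// nnegrE.
lra.
Qed.

End bounded_support.

Section empirical_laplace_transform.
Context {R : realType}.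
Variables (n : nat) (t : R).
Hypothesis t_ge0 : 0 <= t.
Local Notation N := n.+1.
Local Notation X k := (lin_form (frame_cos n k) N).
Local Notation Y k := (lin_form (frame_sin n k) N).
Local Notation r k := (sq_modulus N (frame_cos n k) (frame_sin n k)).

Definition empirical_laplace (x : nat -> R) : R :=
  N%:R^-1 * \sum_(k < N) expR (- (t * r k x)).

Lemma average_cst (c : R) : N%:R^-1 * \sum_(k < N) c = c.
Proof. by rewrite sumr_const card_ord -[c *+ _]mulr_natl mulKf// pnatr_eq0. Qed.

Lemma mulr_expRN_le1 (y : R) : 0 <= y -> y * expR (- y) <= 1.
Proof.
move=> y0; rewrite expRN ler_pdivrMr ?expR_gt0// mul1r.
by apply: le_trans (expR_ge1Dx y); rewrite lerDr.
Qed.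

Let r_ge0 k (x : nat -> R) : 0 <= r k x. Proof. exact: sq_modulus_ge0. Qed.

(** Analysis with respect to a tight frame is an isometry, so that synthesis
    is a contraction. *)
Lemma frame_bessel (a b : nat -> R) :
  \sum_(j < N) (\sum_(k < N) (frame_cos n k j * a k + frame_sin n k j * b k)) ^+ 2
  <= \sum_(k < N) (a k ^+ 2 + b k ^+ 2).
Proof.
pose y j := \sum_(k < N) (frame_cos n k j * a k + frame_sin n k j * b k).
have E : \sum_(j < N) y j ^+ 2 = \sum_(k < N) (X k y * a k + Y k y * b k).
  transitivity (\sum_(j < N) \sum_(k < N)
      (frame_cos n k j * y j * a k + frame_sin n k j * y j * b k)).
    apply: eq_bigr => j _; rewrite expr2 {2}/y big_distrr; apply: eq_bigr => k _ /=.
    by ring.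
  rewrite exchange_big; apply: eq_bigr => k _ /=.
  by rewrite big_split /= -!big_distrl.
have L : \sum_(k < N) (X k y * a k + Y k y * b k) <=
    2^-1 * \sum_(k < N) r k y + 2^-1 * \sum_(k < N) (a k ^+ 2 + b k ^+ 2).
  rewrite !big_distrr -big_split /=; apply: ler_sum => k _; rewrite /sq_modulus.
  have := sqr_ge0 (X k y - a k); have := sqr_ge0 (Y k y - b k).
  lra.
have := L; rewrite frame_parseval -E; lra.
Qed.

Let single_difference k j (x : nat -> R) : (j < N)%N ->
  `|expR (- (t * r k (upd x j 0))) - expR (- (t * r k x)) -
    x j * (2 * t * (frame_cos n k j * X k x + frame_sin n k j * Y k x) *
           expR (- (t * r k x)))| <= 6 * t * N%:R^-1 * `|x j| ^+ 2.
Proof.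
move=> jN; set c := frame_cos n k j; set s := frame_sin n k j.
set p := c * X k x + s * Y k x.
pose rho (u : R) := r k x - 2 * p * u + N%:R^-1 * u ^+ 2.
have cs : c ^+ 2 + s ^+ 2 = N%:R^-1 by exact: frame_norm.
have rhoE u : r k (upd x j (x j - u)) = rho u.
  rewrite /sq_modulus !lin_form_reset// -/c -/s /rho /p -cs /sq_modulus; ring.
have rhox : rho (x j) = r k (upd x j 0) by rewrite -rhoE subrr.
have rho0 : rho 0 = r k x by rewrite -rhoE subr0 upd_id.
pose f (u : R) := expR (- (t * rho u)).
pose q (u : R) := p - N%:R^-1 * u.
pose df (u : R) := 2 * t * q u * f u.
pose ddf (u : R) := (4 * t ^+ 2 * q u ^+ 2 - 2 * t * N%:R^-1) * f u.
have rhod (u : R) : is_derive u (1 : R) (fun u => - (t * rho u)) (2 * t * q u).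
  by apply: is_derive_eq; rewrite /GRing.scale /= /q; ring.
have fd (u : R) : is_derive u (1 : R) f (df u).
  rewrite /df mulrC.
  exact: (is_derive1_comp (f := expR) (g := fun u => - (t * rho u)) (is_derive_expR _) (rhod u)).
have qd (u : R) : is_derive u (1 : R) q (- N%:R^-1).
  by apply: is_derive_eq; rewrite /GRing.scale /=; ring.
have dfd (u : R) : is_derive u (1 : R) df (ddf u).
  by apply: is_derive_eq; rewrite /GRing.scale /= /ddf /df; ring.
have NV0 : 0 <= N%:R^-1 :> R by rewrite invr_ge0.
have ddfB (u : R) : `|ddf u| <= 6 * t * N%:R^-1.
  have r0 : 0 <= rho u by rewrite -rhoE r_ge0.
  have q2 : q u ^+ 2 <= N%:R^-1 * rho u.
    rewrite /q /rho /p -cs /sq_modulus.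
    by have := sqr_ge0 (c * (Y k x - s * u) - s * (X k x - c * u)); nra.
  have f0 : 0 <= f u by exact: expR_ge0.
  have f1 : f u <= 1 by rewrite -expR0 ler_expR oppr_le0 mulr_ge0.
  have tf : t * rho u * f u <= 1 by apply: mulr_expRN_le1; exact: mulr_ge0.
  have A0 : 0 <= 4 * t ^+ 2 * q u ^+ 2 * f u.
    by apply: mulr_ge0 => //; apply: mulr_ge0 => //; [apply: mulr_ge0|]; rewrite ?sqr_ge0.
  have A : 4 * t ^+ 2 * q u ^+ 2 * f u <= 4 * t * N%:R^-1.
    apply: (@le_trans _ _ (4 * t ^+ 2 * (N%:R^-1 * rho u) * f u)).
      apply: ler_wpM2r => //; apply: ler_wpM2l => //.
      by apply: mulr_ge0 => //; exact: sqr_ge0.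
    rewrite (_ : _ * f u = (4 * t * N%:R^-1) * (t * rho u * f u)); last by ring.
    by rewrite ler_piMr//; apply: mulr_ge0 => //; exact: mulr_ge0.
  have B0 : 0 <= 2 * t * N%:R^-1 by apply: mulr_ge0 => //; exact: mulr_ge0.
  have B1 : 2 * t * N%:R^-1 * f u <= 2 * t * N%:R^-1 by rewrite ler_piMr.
  have B2 : 0 <= 2 * t * N%:R^-1 * f u by exact: mulr_ge0.
  move: A0 A B0 B1 B2; rewrite /ddf mulrBl -!(mulrA _ t) ler_norml.
  move: (t * N%:R^-1) (_ * f u) (_ * f u) => u1 u2 u3 ? ? ? ? ?.
  by apply/andP; split; lra.
have := taylor2_le (v := x j) fd dfd (fun u _ => ddfB u).
rewrite /f rhox rho0 /df /q /f mulr0 subr0 rho0.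
by congr (_ <= _); congr normr; ring.
Qed.

(** To first order in [x_j], the differences are the coefficients of a synthesis
    in the tight frame, and [frame_bessel] bounds the sum of their squares; the
    second-order term contributes [O(1/N^2)] to each square. *)
Lemma empirical_laplace_differences (K : R) (x : nat -> R) : 0 <= K -> (forall i, `|x i| <= K) ->
  \sum_(j < N) (empirical_laplace x - empirical_laplace (upd x j 0)) ^+ 2 <=
  (8 * K ^+ 2 * t + 72 * t ^+ 2 * K ^+ 4) * N%:R^-1.
Proof.
move=> K0 xK; have NV0 : 0 <= N%:R^-1 :> R by rewrite invr_ge0.
pose e k := expR (- (t * r k x)).
pose y j := \sum_(k < N) (frame_cos n k j * (X k x * e k) + frame_sin n k j * (Y k x * e k)).
have diff (j : 'I_N) : (empirical_laplace x - empirical_laplace (upd x j 0)) ^+ 2 <=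
    8 * t ^+ 2 * K ^+ 2 * N%:R^-1 ^+ 2 * y j ^+ 2 + 72 * t ^+ 2 * K ^+ 4 * N%:R^-1 ^+ 2.
  pose rest := empirical_laplace (upd x j 0) - empirical_laplace x -
    N%:R^-1 * (2 * t * x j) * y j.
  have restB : `|rest| <= 6 * t * K ^+ 2 * N%:R^-1.
    have -> : rest = N%:R^-1 * \sum_(k < N) (expR (- (t * r k (upd x j 0))) - e k -
        x j * (2 * t * (frame_cos n k j * X k x + frame_sin n k j * Y k x) * e k)).
      rewrite /rest /empirical_laplace !sumrB !mulrBr; congr (_ - _).
      rewrite -mulrA; congr (_ * _); rewrite big_distrr /=.
      by apply: eq_bigr => k _; ring.
    rewrite normrM ger0_norm//.
    apply: (@le_trans _ _ (N%:R^-1 * \sum_(k < N) (6 * t * N%:R^-1 * K ^+ 2))).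
      apply: ler_wpM2l => //; apply: le_trans (ler_norm_sum _ _ _) _.
      apply: ler_sum => k _; apply: le_trans (single_difference k x (ltn_ord j)) _.
      apply: ler_wpM2l; first by apply: mulr_ge0 => //; exact: mulr_ge0.
      by rewrite lerXn2r// nnegrE.
    rewrite average_cst.
    by rewrite le_eqVlt; apply/orP; left; apply/eqP; ring.
  have rest2 : rest ^+ 2 <= 36 * t ^+ 2 * K ^+ 4 * N%:R^-1 ^+ 2.
    rewrite -[rest ^+ 2]real_normK ?num_real//.
    apply: le_trans (_ : _ <= (6 * t * K ^+ 2 * N%:R^-1) ^+ 2) _.
      rewrite lerXn2r// nnegrE; apply: mulr_ge0 => //; apply: mulr_ge0; last exact: sqr_ge0.
      exact: mulr_ge0.
    by rewrite le_eqVlt; apply/orP; left; apply/eqP; ring.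
  have main2 : (N%:R^-1 * (2 * t * x j) * y j) ^+ 2 <=
      4 * t ^+ 2 * K ^+ 2 * N%:R^-1 ^+ 2 * y j ^+ 2.
    have x2 : x j ^+ 2 <= K ^+ 2.
      by rewrite -[x j ^+ 2]real_normK ?num_real// lerXn2r// nnegrE.
    rewrite [leLHS](_ : _ = (4 * t ^+ 2 * N%:R^-1 ^+ 2 * y j ^+ 2) * x j ^+ 2); last by ring.
    rewrite [leRHS](_ : _ = (4 * t ^+ 2 * N%:R^-1 ^+ 2 * y j ^+ 2) * K ^+ 2); last by ring.
    apply: ler_wpM2l => //; apply: mulr_ge0; last exact: sqr_ge0.
    by apply: mulr_ge0; last exact: sqr_ge0; apply: mulr_ge0 => //; exact: sqr_ge0.
  rewrite (_ : _ - _ = - (rest + N%:R^-1 * (2 * t * x j) * y j)); last by rewrite /rest; ring.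
  move: rest2 main2; clearbody rest; move: (_ * _ * y j) => v rest2 main2.
  rewrite sqrrN [leRHS](_ : _ = 2 * (36 * t ^+ 2 * K ^+ 4 * N%:R^-1 ^+ 2) +
    2 * (4 * t ^+ 2 * K ^+ 2 * N%:R^-1 ^+ 2 * y j ^+ 2)); last by ring.
  have := sqr_ge0 (rest - v); move: rest2 main2.
  by move: (36 * _ * _ * _) (4 * _ * _ * _ * _) => p q; lra.
apply: le_trans (ler_sum _ (fun j _ => diff j)) _.
rewrite big_split /= -big_distrr /= sumr_const card_ord.
have sumy : t * \sum_(j < N) y j ^+ 2 <= N%:R.
  apply: le_trans (_ : _ <= t * \sum_(k < N) (r k x * e k ^+ 2)) _.
    apply: ler_wpM2l => //; apply: le_trans
      (frame_bessel (fun k => X k x * e k) (fun k => Y k x * e k)) _.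
    by apply: ler_sum => k _; rewrite !exprMn -mulrDl.
  rewrite big_distrr /=; apply: (@le_trans _ _ (\sum_(k < N) 1)); last first.
    by rewrite sumr_const card_ord.
  apply: ler_sum => k _; rewrite expr2 !mulrA.
  have e0 : 0 <= e k by exact: expR_ge0.
  have e1 : e k <= 1 by rewrite -expR0 ler_expR oppr_le0 mulr_ge0.
  have te : t * r k x * e k <= 1 by apply: mulr_expRN_le1; exact: mulr_ge0.
  have te0 : 0 <= t * r k x * e k by apply: mulr_ge0 => //; exact: mulr_ge0.
  by move: te te0; move: (t * _ * _) => z te te0; nra.
rewrite [leRHS]mulrDl; apply: lerD.
  rewrite [leLHS](_ : _ = 8 * t * K ^+ 2 * N%:R^-1 ^+ 2 *
    (t * \sum_(j < N) y j ^+ 2)); last by ring.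
  apply: le_trans (_ : _ <= 8 * t * K ^+ 2 * N%:R^-1 ^+ 2 * N%:R) _.
    apply: ler_wpM2l => //; apply: mulr_ge0; last exact: sqr_ge0.
    by apply: mulr_ge0; [exact: mulr_ge0|exact: sqr_ge0].
  rewrite expr2 -!mulrA mulVf ?pnatr_eq0// mulr1.
  by rewrite le_eqVlt; apply/orP; left; apply/eqP; ring.
rewrite -[leLHS]mulr_natr expr2 -!mulrA mulVf ?pnatr_eq0// mulr1.
by rewrite !mulrA.
Qed.

(* The modulus sqrt r is a Lipschitz function of the entries, while r is not. *)
Let gaussian_lipschitz (a b : R) :
  `|expR (- (t * a ^+ 2)) - expR (- (t * b ^+ 2))| <= (t + 1) * `|a - b|.
Proof.
pose f (u : R) := expR (- (t * u ^+ 2)); pose df (u : R) := f u * (- (2 * t * u)).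
have fd (u : R) : is_derive u (1 : R) f (df u).
  have hd : is_derive u (1 : R) (fun u => - (t * u ^+ 2)) (- (2 * t * u)).
    by apply: is_derive_eq; rewrite /GRing.scale /=; ring.
  exact: (is_derive1_comp (f := expR) (g := fun u => - (t * u ^+ 2)) (is_derive_expR _) hd).
have [z _] := mean_value fd b a; rewrite /f => ->.
rewrite normrM ler_wpM2r// /df -/(f z).
have f0 : 0 <= f z by exact: expR_ge0.
have z2 := sqr_ge0 z.
have tz : 0 <= t * z ^+ 2 by exact: mulr_ge0.
have f1 : f z <= 1 by rewrite -expR0 ler_expR oppr_le0.
have tf : t * z ^+ 2 * f z <= 1 by exact: mulr_expRN_le1.
rewrite normrM normrN (ger0_norm f0) !normrM normr_nat (ger0_norm t_ge0).
have h : 2 * `|z| <= 1 + z ^+ 2.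
  by have := sqr_ge0 (`|z| - 1); rewrite -[z ^+ 2]real_normK ?num_real//; nra.
apply: le_trans (_ : _ <= t * f z + t * z ^+ 2 * f z) _.
  rewrite [leRHS](_ : _ = (f z * t) * (1 + z ^+ 2)); last by ring.
  rewrite [leLHS](_ : _ = (f z * t) * (2 * `|z|)); last by ring.
  by apply: ler_wpM2l => //; exact: mulr_ge0.
by apply: lerD => //; rewrite ler_piMr.
Qed.

(** The moduli [sqrt (r k)] are Lipschitz in the entries, and Parseval's identity
    sums their squared increments.  In place of the distance [d] of the entries
    there is [h + d^2 / h], which dominates it for every [h]. *)
Lemma empirical_laplace_lipschitz (x y : nat -> R) (h : R) : 0 < h ->
  `|empirical_laplace x - empirical_laplace y| <=
  (t + 1) * (h + h^-1 * (N%:R^-1 * \sum_(j < N) (x j - y j) ^+ 2)).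
Proof.
move=> h0; have NV0 : 0 <= N%:R^-1 :> R by rewrite invr_ge0.
have t1 : 0 <= t + 1 by exact: addr_ge0.
have one k : `|expR (- (t * r k x)) - expR (- (t * r k y))| <=
    (t + 1) * (h + h^-1 * r k (fun j => x j - y j)).
  set a := Num.sqrt (r k x); set b := Num.sqrt (r k y).
  have a2 : a ^+ 2 = r k x by rewrite sqr_sqrtr.
  have b2 : b ^+ 2 = r k y by rewrite sqr_sqrtr.
  rewrite -a2 -b2; apply: le_trans (gaussian_lipschitz a b) _.
  apply: ler_wpM2l => //.
  have Xd : X k (fun j => x j - y j) = X k x - X k y.
    by rewrite /lin_form -sumrB; apply: eq_bigr => j _; rewrite mulrBr.
  have Yd : Y k (fun j => x j - y j) = Y k x - Y k y.
    by rewrite /lin_form -sumrB; apply: eq_bigr => j _; rewrite mulrBr.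
  have d2 : (a - b) ^+ 2 <= r k (fun j => x j - y j).
    have ab : X k x * X k y + Y k x * Y k y <= a * b.
      have ab0 : 0 <= a * b by apply: mulr_ge0; exact: sqrtr_ge0.
      apply: le_trans (ler_norm _) _.
      rewrite -(@ler_pXn2r _ 2) ?nnegrE// real_normK ?num_real// exprMn a2 b2.
      rewrite /sq_modulus.
      by have := sqr_ge0 (X k x * Y k y - X k y * Y k x); nra.
    rewrite [leRHS]/sq_modulus Xd Yd.
    move: a2 b2; rewrite /sq_modulus; nra.
  apply: le_trans (_ : _ <= h + h^-1 * (a - b) ^+ 2) _; last first.
    by rewrite lerD2l ler_wpM2l// invr_ge0 ltW.
  rewrite -[(a - b) ^+ 2]real_normK ?num_real//.
  rewrite -(ler_pM2l h0) mulrDr mulrA mulfV ?gt_eqF// mul1r.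
  by have := sqr_ge0 (`|a - b| - h); nra.
rewrite /empirical_laplace -mulrBr -sumrB normrM ger0_norm//.
apply: (@le_trans _ _ (N%:R^-1 * \sum_(k < N)
    (t + 1) * (h + h^-1 * r k (fun j => x j - y j)))).
  apply: ler_wpM2l => //; apply: le_trans (ler_norm_sum _ _ _) _.
  by apply: ler_sum => k _; exact: one.
rewrite -big_distrr big_split /= -big_distrr /= frame_parseval mulrCA.
by apply: ler_wpM2l => //; rewrite mulrDr average_cst lerD2l mulrCA.
Qed.

End empirical_laplace_transform.

Section laplace_concentration.
Context {R : realType}.

(** At most one [k < n + 1] is exceptional, and it weighs [1/(n + 1)]. *)
Lemma average_except_middle n (u : nat -> R) (c A D : R) : 0 <= D ->
  (forall k, (k < n.+1)%N -> k.*2.+1 != n.+1 -> `|u k - c| <= A) ->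
  (forall k, (k < n.+1)%N -> `|u k - c| <= A + D) ->
  `|n.+1%:R^-1 * (\sum_(k < n.+1) u k) - c| <= A + D * n.+1%:R^-1.
Proof.
move=> D0 uA uD; have N0 : 0 <= n.+1%:R^-1 :> R by rewrite invr_ge0.
have one : \sum_(k < n.+1) (nat_of_ord k == n./2)%:R <= 1 :> R.
  have hn : (n./2 < n.+1)%N by lia.
  rewrite (bigD1 (Ordinal hn))//= eqxx big1 ?addr0// => k kn.
  suff -> : (nat_of_ord k == n./2) = false by [].
  by apply/negbTE; apply: contra kn => /eqP kn; apply/eqP/val_inj.
rewrite -[X in _ - X](average_cst n c) -mulrBr -sumrB normrM ger0_norm//.
apply: (@le_trans _ _ (n.+1%:R^-1 * \sum_(k < n.+1) (A + D * (nat_of_ord k == n./2)%:R))).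
  apply: ler_wpM2l => //; apply: le_trans (ler_norm_sum _ _ _) _.
  apply: ler_sum => k _; have [kn|kn] := eqVneq (nat_of_ord k) n./2.
    by rewrite mulr1; exact: uD.
  rewrite mulr0 addr0; apply: uA => //; apply: contra kn => /eqP kn; apply/eqP; lia.
rewrite big_split /= mulrDr average_cst lerD2l -big_distrr /= mulrCA ler_wpM2l//.
by rewrite ler_piMr.
Qed.

(** Bias and fluctuation are both of order [n^(-1/2)]; the fourth power makes the
    bound summable in [n]. *)
Lemma laplace_fourth_moment (Km : nat -> R) (K t : R) : 0 <= K -> 0 <= t ->
  exists C : R, 0 <= C /\ forall V w n, standard_laws Km V w ->
    (forall j v, v \in V j -> `|v| <= K) ->
    prod_mean V w n.+1 (fun x => (empirical_laplace n t x - (1 + t)^-1) ^+ 4) <=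
    C * n.+1%:R^-1 ^+ 2.
Proof.
move=> K0 t0; have [C0 [C00 HC0]] := sq_modulus_laplace Km t0.
pose B := 8 * K ^+ 2 * t + 72 * t ^+ 2 * K ^+ 4.
have B0 : 0 <= B.
  by apply: addr_ge0; apply: mulr_ge0 => //; [apply: mulr_ge0|apply: mulr_ge0|]; rewrite ?exprn_ge0 ?sqr_ge0.
exists (8 * (11 * B ^+ 2 + (C0 + 1) ^+ 4)); split.
  apply: mulr_ge0 => //; apply: addr_ge0; last by apply: exprn_ge0; exact: addr_ge0.
  by apply: mulr_ge0 => //; exact: sqr_ge0.
move=> V w n HL VK; have [w0 w1 _ _ _] := HL.
set N := n.+1; set F := empirical_laplace n t; set m := prod_mean V w N F.
set sd : R := Num.sqrt N%:R^-1.
have sd0 : 0 <= sd by exact: sqrtr_ge0.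
have NV0 : 0 <= N%:R^-1 :> R by rewrite invr_ge0.
have sd2 : sd ^+ 2 = N%:R^-1 by rewrite sqr_sqrtr.
have NVsd : N%:R^-1 <= sd.
  rewrite -sd2 expr2 ler_piMr// -(@ler_pXn2r _ 2) ?nnegrE// expr1n sd2.
  by rewrite invf_le1 ?ler1n ?ltr0n.
have tV : 0 <= (1 + t)^-1 <= 1.
  by rewrite invr_ge0 addr_ge0//= invf_le1 ?lerDl// (lt_le_trans ltr01)// lerDl.
have bias : `|m - (1 + t)^-1| <= (C0 + 1) * sd.
  pose u k := prod_mean V w N
    (fun x => expR (- (t * sq_modulus N (frame_cos n k) (frame_sin n k) x))).
  have -> : m = N%:R^-1 * \sum_(k < N) u k by rewrite -prod_mean_sum -prod_meanZ.
  have u01 k : 0 <= u k <= 1.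
    apply/andP; split; first by apply: prod_mean_ge0 => // x; exact: expR_ge0.
    rewrite -(prod_mean_cst w1 N 1); apply: le_prod_mean => // x.
    by rewrite -expR0 ler_expR oppr_le0 mulr_ge0// sq_modulus_ge0.
  have Csd : 0 <= C0 * sd by exact: mulr_ge0.
  apply: (@le_trans _ _ (C0 * sd + 1 * N%:R^-1)); last by lra.
  apply: average_except_middle => //.
    by move=> k kN km; apply: HC0 => //; exact: frame_circular.
  by move=> k _; have := u01 k; rewrite ler_norml => /andP[? ?]; apply/andP; split; lra.
have FB := @efron_stein_fourth R V w K w0 w1 K0 VK N F (B * N%:R^-1)
  (mulr_ge0 B0 NV0) (fun x => empirical_laplace_differences n t0 K0).
set a4 := prod_mean V w N (fun x => (F x - m) ^+ 4) in FB.
have : prod_mean V w N (fun x => (F x - (1 + t)^-1) ^+ 4) <=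
    8 * (a4 + (m - (1 + t)^-1) ^+ 4).
  rewrite /a4 -[(m - (1 + t)^-1) ^+ 4](prod_mean_cst w1 N) -prod_meanD -prod_meanZ.
  apply: le_prod_mean => // x.
  have -> : F x - (1 + t)^-1 = (F x - m) + (m - (1 + t)^-1) by ring.
  move: (F x - m) (m - _) => u v.
  have e4 (z : R) : z ^+ 4 = (z ^+ 2) ^+ 2 by rewrite -exprM.
  have h1 : (u + v) ^+ 2 <= 2 * (u ^+ 2 + v ^+ 2) by have := sqr_ge0 (u - v); nra.
  rewrite !e4; apply: le_trans (_ : _ <= (2 * (u ^+ 2 + v ^+ 2)) ^+ 2) _.
    rewrite lerXn2r// nnegrE ?sqr_ge0//; apply: mulr_ge0 => //.
    by apply: addr_ge0; exact: sqr_ge0.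
  by have := sqr_ge0 (u ^+ 2 - v ^+ 2); nra.
move=> /le_trans; apply; rewrite -mulrA ler_wpM2l// mulrDl; apply: lerD.
  by apply: le_trans FB _; rewrite exprMn mulrA.
have -> : (m - (1 + t)^-1) ^+ 4 = `|m - (1 + t)^-1| ^+ 4.
  by rewrite -[4%N]/(2 * 2)%N !exprM real_normK// num_real.
apply: le_trans (_ : _ <= ((C0 + 1) * sd) ^+ 4) _.
  by rewrite lerXn2r// nnegrE mulr_ge0// addr_ge0.
by rewrite exprMn -sd2 -exprM.
Qed.

End laplace_concentration.

(** * Expectations of finite-valued independent variables *)

Section real_expectation.
Context {d : measure_display} {T : measurableType d} {R : realType}.
Variable P : probability T R.

Definition pr (A : set T) : R := fine (P A).

Lemma prE A : measurable A -> P A = (pr A)%:E.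
Proof. by move=> mA; rewrite /pr fineK// fin_num_measure. Qed.

Lemma pr_ge0 A : 0 <= pr A.
Proof. by apply: fine_ge0; exact: measure_ge0. Qed.

Lemma pr_setT : pr setT = 1.
Proof. by rewrite /pr; have -> : P setT = 1%E by exact: probability_setT. Qed.

Lemma Rintegral_indic (A : set T) : measurable A ->
  \int[P]_t (\1_A t : R) = pr A.
Proof.
by move=> mA; rewrite /Rintegral integral_indic// setIT.
Qed.

Lemma integrable_cst (c : R) : P.-integrable setT (EFin \o (fun=> c)).
Proof. exact: (finite_measure_integrable_cst P c measurableT). Qed.

Lemma Rintegral_cst1 (c : R) : \int[P]_t c = c.
Proof. by rewrite Rintegral_cst// -/(pr setT) pr_setT mulr1. Qed.

Lemma integrable_scale (c : R) (f : T -> R) : P.-integrable setT (EFin \o f) ->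
  P.-integrable setT (EFin \o (fun t => c * f t)).
Proof. by move=> intf; exact: (integrableZl measurableT c intf). Qed.

Lemma integrable_add (f g : T -> R) :
  P.-integrable setT (EFin \o f) -> P.-integrable setT (EFin \o g) ->
  P.-integrable setT (EFin \o (fun t => f t + g t)).
Proof. by move=> intf intg; exact: (integrableD measurableT intf intg). Qed.

Lemma integrable_bigsum (I : Type) (s : seq I) (f : I -> T -> R) :
  (forall i, P.-integrable setT (EFin \o f i)) ->
  P.-integrable setT (EFin \o (fun t => \sum_(i <- s) f i t)).
Proof.
move=> intf; elim: s => [|i s IH].
  by under eq_fun do rewrite big_nil; exact: integrable_cst.
by under eq_fun do rewrite big_cons; exact: integrable_add.
Qed.

Lemma Rintegral_bigsum (I : Type) (s : seq I) (f : I -> T -> R) :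
  (forall i, P.-integrable setT (EFin \o f i)) ->
  \int[P]_t (\sum_(i <- s) f i t) = \sum_(i <- s) \int[P]_t (f i t).
Proof.
move=> intf; elim: s => [|i s IH].
  by under eq_Rintegral do rewrite big_nil; rewrite big_nil Rintegral_cst1.
under eq_Rintegral do rewrite big_cons.
by rewrite big_cons RintegralD// ?IH//; exact: integrable_bigsum.
Qed.

Lemma le_integrable_real (f g : T -> R) : measurable_fun setT f ->
  (forall t, `|f t| <= g t) -> P.-integrable setT (EFin \o g) ->
  P.-integrable setT (EFin \o f).
Proof.
move=> mf fg; apply: le_integrable => //; first exact/measurable_EFinP.
by move=> t _ /=; rewrite lee_fin; exact: le_trans (fg t) (ler_norm _).
Qed.

Lemma integrable_bounded (f : T -> R) (M : R) : measurable_fun setT f ->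
  (forall t, `|f t| <= M) -> P.-integrable setT (EFin \o f).
Proof. by move=> mf fM; apply: le_integrable_real mf fM _; exact: integrable_cst. Qed.

End real_expectation.

Section finite_valued.
Context {d : measure_display} {T : measurableType d} {R : realType}.
Variable P : probability T R.
Variables (X : nat -> T -> R) (V : nat -> seq R).
Hypothesis mX : forall j, measurable_fun setT (X j).
Hypothesis uV : forall j, uniq (V j).
Hypothesis XV : forall j t, X j t \in V j.
Hypothesis indX : forall n (B : nat -> set R), (forall j, measurable (B j)) ->
  pr P (\bigcap_(j in `I_n) X j @^-1` B j) = \prod_(j < n) pr P (X j @^-1` B j).

Definition law j v : R := pr P (X j @^-1` [set v]).

Let mpre j (B : set R) : measurable B -> measurable (X j @^-1` B).
Proof. by move=> mB; rewrite -[_ @^-1` _]setTI; exact: mX. Qed.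

Lemma law_ge0 j v : 0 <= law j v.
Proof. exact: pr_ge0. Qed.

Lemma coord_mean_law j (f : R -> R) :
  P.-integrable setT (EFin \o (fun t => f (X j t))) /\
  \int[P]_t (f (X j t)) = coord_mean V law j f.
Proof.
have E : (fun t => f (X j t)) =
    (fun t => \sum_(v <- V j) f v * \1_(X j @^-1` [set v]) t).
  apply/funext => t; rewrite (bigD1_seq (X j t))//= indicE mem_set// mulr1.
  rewrite big1_seq ?addr0// => v /andP[vX _]; rewrite indicE memNset ?mulr0//.
  by move=> /= Xv; rewrite Xv eqxx in vX.
have intI v : P.-integrable setT
    (EFin \o (fun t => f v * \1_(X j @^-1` [set v]) t)).
  by apply: integrable_scale; apply: integrable_indic => //; exact: mpre.
rewrite E; split; first exact: integrable_bigsum.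
rewrite Rintegral_bigsum//; apply: eq_bigr => v _.
rewrite RintegralZl//; last by apply: integrable_indic => //; exact: mpre.
by rewrite (Rintegral_indic P (mpre j (measurable_set1 v))) mulrC.
Qed.

Lemma law_sum1 j : \sum_(v <- V j) law j v = 1.
Proof.
have [_] := coord_mean_law j (fun=> 1).
by rewrite Rintegral_cst1 => ->; apply: eq_bigr => v _; rewrite mulr1.
Qed.

Definition truncate n (x : nat -> R) : nat -> R := fun i => if (i < n)%N then x i else 0.

Let tail_sets m (B : nat -> set R) (j : nat) := if (j < m)%N then [set: R] else B j.

Let event m n B := \bigcap_(j in `I_n) X j @^-1` tail_sets m B j.

Let mtail m (B : nat -> set R) : (forall j, measurable (B j)) -> forall j, measurable (tail_sets m B j).
Proof. by move=> mB j; rewrite /tail_sets; case: ifP => _ //; exact: measurableT. Qed.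

Let mevent m n (B : nat -> set R) : (forall j, measurable (B j)) -> measurable (event m n B).
Proof. by move=> mB; apply: bigcap_measurableType => j _; apply: mpre; exact: mtail. Qed.

Let fix_set m v (B : nat -> set R) j := if j == m then [set v] else B j.

Let mfix m v (B : nat -> set R) : (forall j, measurable (B j)) -> forall j, measurable (fix_set m v B j).
Proof. by move=> mB j; rewrite /fix_set; case: ifP. Qed.

Let pr_event m n v (B : nat -> set R) : (forall j, measurable (B j)) -> (m < n)%N ->
  pr P (event m n (fix_set m v B)) = law m v * pr P (event m.+1 n B).
Proof.
move=> mB mn; rewrite !indX; [|exact: mtail|by apply: mtail; exact: mfix].
rewrite (bigD1 (Ordinal mn))//= [in RHS](bigD1 (Ordinal mn))//=.
have -> : tail_sets m (fix_set m v B) m = [set v] by rewrite /tail_sets ltnn /fix_set eqxx.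
have -> : tail_sets m.+1 B m = setT by rewrite /tail_sets ltnSn.
rewrite preimage_setT pr_setT mul1r.
congr (_ * _); apply: eq_bigr => j jm; congr (pr _ (_ @^-1` _)).
have {}jm : (nat_of_ord j == m) = false.
  by apply/negbTE; apply: contra jm => /eqP jm; apply/eqP/val_inj.
by rewrite /tail_sets /fix_set ltnS [(j <= m)%N]leq_eqVlt jm /=.
Qed.

(* The first m coordinates are averaged, the others confined to given sets. *)
Let partial_mean m n (B : nat -> set R) F : (m <= n)%N ->
  (forall j, measurable (B j)) ->
  P.-integrable setT (EFin \o (fun t => \1_(event m n B) t * F (truncate m (X^~ t)))) /\
  \int[P]_t (\1_(event m n B) t * F (truncate m (X^~ t))) =
  pr P (event m n B) * prod_mean V law m F.
Proof.
elim: m B F => [|m IH] B F mn mB.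
  have -> : (fun t => \1_(event 0 n B) t * F (truncate 0 (X^~ t))) =
      (fun t => F (fun=> 0) * \1_(event 0 n B) t).
    by apply/funext => t; rewrite mulrC.
  have intI := integrable_indic P (mevent 0 n mB).
  split; first exact: integrable_scale.
  by rewrite RintegralZl// (Rintegral_indic P (mevent 0 n mB)) mulrC.
have E : (fun t => \1_(event m.+1 n B) t * F (truncate m.+1 (X^~ t))) =
    (fun t => \sum_(v <- V m) \1_(event m n (fix_set m v B)) t *
                 F (upd (truncate m (X^~ t)) m v)).
  apply/funext => t; rewrite (bigD1_seq (X m t))//=.
  rewrite big1_seq ?addr0 => [|v /andP[vX _]]; last first.
    rewrite indicE memNset ?mul0r// => /(_ m mn) /=.
    by rewrite /tail_sets ltnn /fix_set eqxx => Xv; rewrite -Xv eqxx in vX.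
  congr (_ * F _); last first.
    apply/funext => i; rewrite /truncate /upd ltnS [(i <= m)%N]leq_eqVlt.
    by case: eqP => [->|_].
  rewrite !indicE; congr (_%:R); apply: congr1; apply/idP/idP => /set_mem H; apply/mem_set => j jn.
    have := H j jn; rewrite /= /tail_sets ltnS [(j <= m)%N]leq_eqVlt /fix_set.
    by have [->|] := eqVneq j m => /=; rewrite ?ltnn.
  have := H j jn; rewrite /= /tail_sets ltnS [(j <= m)%N]leq_eqVlt /fix_set.
  by have [->|] := eqVneq j m => /=; rewrite ?ltnn.
have IHv v := IH (fix_set m v B) (fun x => F (upd x m v)) (ltnW mn) (mfix m v mB).
rewrite E; split; first by apply: integrable_bigsum => v; exact: (IHv v).1.
rewrite Rintegral_bigsum => [|v]; last exact: (IHv v).1.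
under eq_bigr do rewrite (IHv _).2 pr_event// -mulrA mulrCA.
rewrite -big_distrr /=; congr (_ * _).
rewrite /coord_mean prod_mean_sum; apply: eq_bigr => v _.
by rewrite prod_meanZ.
Qed.

(** The joint law of finitely many of the variables is the product model. *)
Lemma Rintegral_prod_mean n (F : (nat -> R) -> R) :
  (forall x, F (truncate n x) = F x) ->
  P.-integrable setT (EFin \o (fun t => F (X^~ t))) /\
  \int[P]_t (F (X^~ t)) = prod_mean V law n F.
Proof.
move=> FT; have ET : event n n (fun=> setT) = setT.
  by apply/seteqP; split => // t _ j jn /=; rewrite /tail_sets; case: ifP.
have [] := partial_mean F (leqnn n) (fun=> measurableT : measurable [set: R]).
rewrite ET pr_setT mul1r.
have -> // : (fun t => \1_[set: T] t * F (truncate n (X^~ t))) = (fun t => F (X^~ t)).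
by apply/funext => t; rewrite indicT mul1r FT.
Qed.

Lemma lin_form_truncate b n x : lin_form b n (truncate n x) = lin_form b n x.
Proof. by apply: eq_bigr => j _; rewrite /truncate ltn_ord. Qed.

End finite_valued.

Section transformed_independence.
Context {d : measure_display} {T : measurableType d} {R : realType}.
Variable P : probability T R.
Variable l : nat -> {RV P >-> R}.

Lemma independent_comp (f : nat -> R -> R) n (B : nat -> set R) :
  mutually_independent l -> (forall j, measurable_fun setT (f j)) ->
  (forall j, measurable (B j)) ->
  pr P (\bigcap_(j in `I_n) (fun t => f j (l j t)) @^-1` B j) =
  \prod_(j < n) pr P ((fun t => f j (l j t)) @^-1` B j).
Proof.
move=> ind mf mB; pose C j := f j @^-1` B j.
have mC j : measurable (C j) by rewrite /C -[_ @^-1` _]setTI; exact: mf.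
have := ind (iota 0 n) C (iota_uniq _ _) mC.
have -> : [set` iota 0 n] = `I_n.
  by apply/seteqP; split => j /=; rewrite mem_iota.
move=> /(congr1 fine); rewrite -/(pr P _) => ->.
have mlC j : measurable (l j @^-1` C j).
  by rewrite -[_ @^-1` _]setTI; exact: (measurable_funP (l j)).
have E (s : seq nat) : (\prod_(j <- s) P (l j @^-1` C j))%E =
    (\prod_(j <- s) pr P (l j @^-1` C j))%:E.
  elim: s => [|j s IH]; first by rewrite !big_nil.
  by rewrite !big_cons IH prE// EFinM.
by rewrite E /= -[X in iota 0 X]subn0 -[iota _ _]/(index_iota 0 n) big_mkord.
Qed.

End transformed_independence.

(** * Approximation by finite-valued variables *)

Section dominated_convergence.
Context {d : measure_display} {T : measurableType d} {R : realType}.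
Variable P : probability T R.

Lemma Rintegral_dominated (f : nat -> T -> R) (f0 g : T -> R) :
  (forall M, measurable_fun setT (f M)) -> measurable_fun setT f0 ->
  (forall t, f^~ t @ \oo --> f0 t) -> P.-integrable setT (EFin \o g) ->
  (forall M t, `|f M t| <= g t) ->
  \int[P]_t (f M t) @[M --> \oo] --> \int[P]_t (f0 t).
Proof.
move=> mf mf0 ff0 ig fg.
have [] := @dominated_convergence _ _ _ P setT measurableT
  (fun M => EFin \o f M) (EFin \o f0) (EFin \o g).
- by move=> M; exact/measurable_EFinP.
- exact/measurable_EFinP.
- by apply: aeW => t _; apply: cvg_EFin; [exact: nearW | exact: ff0].
- exact: ig.
- by apply: aeW => t M _ /=; rewrite lee_fin.
move=> if0 _ H; rewrite /Rintegral.
apply: fine_cvg; rewrite fineK//.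
exact: integrable_fin_num.
Qed.

End dominated_convergence.

Section quantizer.
Context {R : realType}.

Definition quantize M (x : R) : R :=
  if `|x| <= M.+1%:R then (Num.floor (x * M.+1%:R))%:~R / M.+1%:R else 0.

Definition quantize_values M : seq R :=
  undup [seq (k%:R - (M.+1 ^ 2)%:R) / M.+1%:R | k <- iota 0 (M.+1 ^ 2).*2.+1].

Let M_gt0 M : 0 < M.+1%:R :> R. Proof. by rewrite ltr0n. Qed.

Lemma quantize_in M x : quantize M x \in quantize_values M.
Proof.
rewrite mem_undup /quantize; case: ifP => xM; last first.
  apply/mapP; exists (M.+1 ^ 2)%N; last by rewrite subrr mul0r.
  by rewrite mem_iota /= add0n ltnS -addnn leq_addr.
set z := Num.floor _; set B := (M.+1 ^ 2)%N.
have zB : - B%:Z <= z <= B%:Z.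
  have xB : `|x * M.+1%:R| <= B%:R.
    by rewrite normrM normr_nat /B natrX expr2 ler_wpM2r.
  move: xB; rewrite ler_norml => /andP[xB1 xB2]; apply/andP; split.
    by rewrite floor_ge_int// rmorphN.
  by rewrite -(ler_int R) (le_trans (floor_le _)).
apply/mapP; exists (absz (z + B%:Z)).
  rewrite mem_iota /= add0n ltnS -addnn.
  move: zB; lia.
congr (_ / _); rewrite natr_absz ger0_norm; last by move: zB; lia.
by rewrite rmorphD /= addrK.
Qed.

Lemma quantize_dist M x : `|x| <= M.+1%:R -> `|quantize M x - x| <= M.+1%:R^-1.
Proof.
move=> xM; rewrite /quantize xM.
have /andP[z1 z2] := floor_itv (x * M.+1%:R).
rewrite -(ler_pM2r (M_gt0 M)) mulVf ?gt_eqF//.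
rewrite -[X in _ * X <= _](gtr0_norm (M_gt0 M)) -normrM mulrBl divfK ?gt_eqF//.
by move: z2; rewrite rmorphD /= ler_norml => z2; apply/andP; split; lra.
Qed.

Lemma quantize_below M x : `|x| <= M.+1%:R -> quantize M x <= x.
Proof. by move=> xM; rewrite /quantize xM ler_pdivrMr// floor_le. Qed.

Lemma quantize_le M x : `|quantize M x| <= `|x| + 1.
Proof.
have [xM|xM] := leP `|x| M.+1%:R; last first.
  by rewrite /quantize [`|x| <= M.+1%:R]leNgt xM /= normr0 addr_ge0.
rewrite -{1}[quantize M x](subrK x); apply: le_trans (ler_normD _ _) _.
rewrite addrC lerD2l; apply: le_trans (quantize_dist xM) _.
by rewrite invf_le1 ?ler1n.
Qed.

Lemma quantize_cvg x : quantize M x @[M --> \oo] --> x.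
Proof.
apply/cvgrPdist_le => e e0; near=> M.
rewrite distrC; apply: le_trans (quantize_dist _) _.
  near: M; exists (Num.truncn `|x|) => // M /= HM.
  by apply/ltW; apply: lt_le_trans (truncnS_gt _) _; rewrite ler_nat ltnS.
near: M; exists (Num.truncn e^-1) => // M /= HM.
rewrite -[e]invrK lef_pV2 ?posrE ?invr_gt0//.
by apply/ltW; apply: lt_le_trans (truncnS_gt _) _; rewrite ler_nat ltnS.
Unshelve. all: by end_near. Qed.

Lemma measurable_quantize M : measurable_fun setT (quantize M).
Proof.
pose A (v : R) := quantize M @^-1` [set v].
have mA v : measurable (A v).
  pose z := Num.floor (v * M.+1%:R).
  pose D : set R := `[- M.+1%:R, M.+1%:R]%classic.
  pose I : set R := `[z%:~R / M.+1%:R, (z + 1)%:~R / M.+1%:R[%classic.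
  have xD (x : R) : D x <-> `|x| <= M.+1%:R by rewrite /D /= in_itv /= ler_norml.
  have xI (x : R) : I x <-> Num.floor (x * M.+1%:R) = z.
    rewrite /I /= in_itv /= ler_pdivrMr// ltr_pdivlMr// -floor_eq.
    by split => /eqP.
  have -> : A v = (if z%:~R / M.+1%:R == v then D `&` I else set0) `|`
                  (if v == 0 then ~` D else set0).
    apply/seteqP; split => x /=.
      rewrite /A /= /quantize; case: ifPn => xM.
        move=> vE; left; have zE : Num.floor (x * M.+1%:R) = z.
          by rewrite /z -vE divfK ?gt_eqF// intrKfloor.
        by rewrite -zE vE eqxx; split; [exact/xD | exact/xI].
      by move=> <-; right; rewrite eqxx /=; move=> /xD xM'; rewrite xM' in xM.
    rewrite /A /= /quantize; case=> H.
      move: H; case: eqP => // vE [/xD xM /xI xz]; rewrite xM xz; exact: vE.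
    move: H; case: eqP => // -> xND; case: ifPn => // xM.
    by exfalso; apply: xND; apply/xD.
  have mD : measurable D by exact: measurable_itv.
  have mI : measurable I by exact: measurable_itv.
  by apply: measurableU; case: ifP => _ //; [exact: measurableI|exact: measurableC].
rewrite (_ : quantize M = fun x => \sum_(v <- quantize_values M) v * \1_(A v) x).
  apply: measurable_sum => v; apply: measurable_funM; first exact: measurable_cst.
  by apply: measurable_indic; exact: mA.
apply/funext => x; rewrite (bigD1_seq (quantize M x)) ?undup_uniq ?quantize_in//=.
rewrite indicE mem_set// mulr1 big1_seq ?addr0// => v /andP[vx _].
by rewrite indicE memNset ?mulr0// => /= xv; rewrite -xv eqxx in vx.
Qed.

End quantizer.

Section finite_approximation.
Context {d : measure_display} {T : measurableType d} {R : realType}.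
Variable P : probability T R.
Variable X : T -> R.
Hypothesis mX : measurable_fun setT X.
Hypothesis intX : P.-integrable setT (EFin \o X).
Hypothesis intX2 : P.-integrable setT (EFin \o (fun t => X t ^+ 2)).
Hypothesis meanX : \int[P]_t (X t) = 0.
Hypothesis varX : \int[P]_t (X t ^+ 2) = 1.

Let qX M t := quantize M (X t).

Let mqX M : measurable_fun setT (qX M).
Proof. by apply: measurableT_comp => //; exact: measurable_quantize. Qed.

Let intXn : P.-integrable setT (EFin \o (fun t => `|X t|)).
Proof. by have := integrable_norm intX. Qed.

Let intX1 : P.-integrable setT (EFin \o (fun t => `|X t| + 1)).
Proof. by apply: integrable_add => //; exact: integrable_cst. Qed.

Let intX12 : P.-integrable setT (EFin \o (fun t => (`|X t| + 1) ^+ 2)).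
Proof.
have -> : (fun t => (`|X t| + 1) ^+ 2) = (fun t => X t ^+ 2 + (2 * `|X t| + 1)).
  by apply/funext => t; rewrite -[X t ^+ 2]real_normK ?num_real//; ring.
apply: integrable_add => //; apply: integrable_add; last exact: integrable_cst.
exact: integrable_scale.
Qed.

Let intq M : P.-integrable setT (EFin \o qX M).
Proof. by apply: le_integrable_real intX1 => // t; exact: quantize_le. Qed.

Let q2_le M t : `|qX M t ^+ 2| <= (`|X t| + 1) ^+ 2.
Proof.
rewrite normrX; apply: lerXn2r; rewrite ?nnegrE ?addr_ge0//.
exact: quantize_le.
Qed.

Let mq2 M : measurable_fun setT (fun t => qX M t ^+ 2).
Proof. by apply: measurable_funX. Qed.

Let intq2 M : P.-integrable setT (EFin \o (fun t => qX M t ^+ 2)).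
Proof. by apply: le_integrable_real intX12 => // t; exact: q2_le. Qed.

Let mu M := \int[P]_t (qX M t).
Let var M := \int[P]_t (qX M t ^+ 2) - mu M ^+ 2.

Let cvg_mu : mu M @[M --> \oo] --> (0 : R).
Proof.
rewrite -meanX; apply: (@Rintegral_dominated _ _ _ P qX X _ mqX mX _ intX1).
  by move=> t; exact: quantize_cvg.
by move=> M t; exact: quantize_le.
Qed.

Let cvg_var : var M @[M --> \oo] --> (1 : R).
Proof.
rewrite -[X in _ --> X](_ : 1 - 0 ^+ 2 = 1); last by rewrite expr0n subr0.
apply: cvgB; last by rewrite expr2; apply: cvgM; exact: cvg_mu.
rewrite -varX; apply: (@Rintegral_dominated _ _ _ P (fun M t => qX M t ^+ 2)
  (fun t => X t ^+ 2) _ mq2 _ _ intX12).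
- exact: measurable_funX.
- by move=> t; apply: cvgM; exact: quantize_cvg.
- exact: q2_le.
Qed.

Let normX_le1 : \int[P]_t `|X t| <= 1.
Proof.
have -> : (1 : R) = \int[P]_t (2^-1 * X t ^+ 2 + 2^-1).
  rewrite RintegralD//; [|exact: integrable_scale|exact: integrable_cst].
  by rewrite RintegralZl// varX Rintegral_cst1; field.
apply: le_Rintegral => //.
  by apply: integrable_add; [exact: integrable_scale|exact: integrable_cst].
move=> t _; rewrite -[X t ^+ 2]real_normK ?num_real//.
by have := sqr_ge0 (`|X t| - 1); lra.
Qed.

Let mu_le M : `|mu M| <= 2.
Proof.
apply: le_trans (le_normr_Rintegral _ _) _ => //.
apply: (@le_trans _ _ (\int[P]_t (`|X t| + 1))).
  apply: le_Rintegral => //; first by have := integrable_norm (intq M).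
  by move=> t _; exact: quantize_le.
rewrite RintegralD//; last exact: integrable_cst.
by rewrite Rintegral_cst1; have := normX_le1; lra.
Qed.

(** Round, then centre and rescale.  Means and variances converge by dominated
    convergence; the first few indices are skipped to keep the variance of the
    rounded variable above 1/4, which bounds the rescaling factor by 2. *)
Lemma finite_approximation :
  exists (psi : nat -> R -> R) (V : nat -> seq R), forall M,
  [/\ [/\ measurable_fun setT (psi M), uniq (V M) & forall x, psi M x \in V M],
      \int[P]_t (psi M (X t)) = 0, \int[P]_t (psi M (X t) ^+ 2) = 1,
      forall x, `|psi M x| <= 2 * `|x| + 6 &
      forall x, psi m x @[m --> \oo] --> x].
Proof.
have [M0 _ HM0] : \forall M \near \oo, 4^-1 <= var M.
  have /cvgrPdist_le/(_ (2^-1)) : var M @[M --> \oo] --> (1 : R) := cvg_var.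
  have h : 0 < 2^-1 :> R by [].
  move=> /(_ h); apply: filterS => M; rewrite ler_norml => /andP[_ H]; lra.
pose s M := Num.sqrt (var (M0 + M)).
pose psi M x := (quantize (M0 + M) x - mu (M0 + M)) / s M.
have var_ge M : 4^-1 <= var (M0 + M) by apply: HM0; rewrite /= leq_addr.
have s2 M : s M ^+ 2 = var (M0 + M).
  by rewrite sqr_sqrtr// (le_trans _ (var_ge M)).
have s_ge M : 2^-1 <= s M.
  rewrite -(@ler_pXn2r _ 2) ?nnegrE ?sqrtr_ge0// s2.
  by apply: le_trans (var_ge M); rewrite exprVn; have -> : (2 : R) ^+ 2 = 4 by ring.
have s_gt0 M : 0 < s M by apply: lt_le_trans (s_ge M).
have shift (u : nat -> R) (a : R) : u M @[M --> \oo] --> a ->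
    u (M0 + M)%N @[M --> \oo] --> a.
  by move=> ua; exact: (cvg_comp _ _ (cvg_addnl M0) ua).
exists psi, (fun M => undup [seq (v - mu (M0 + M)) / s M | v <- quantize_values (M0 + M)]) => M.
have intc : P.-integrable setT (EFin \o (fun t => qX (M0 + M) t - mu (M0 + M))).
  by apply: integrable_add => //; exact: integrable_cst.
split.
- split; last 2 first.
  + exact: undup_uniq.
  + by move=> x; rewrite mem_undup; apply: (map_f (fun v => (v - _) / _)); exact: quantize_in.
  apply: measurable_funM => //; apply: measurable_funB => //.
  exact: measurable_quantize.
- rewrite RintegralZr// RintegralB//; [|exact: intq|exact: integrable_cst].
  by rewrite Rintegral_cst1 subrr mul0r.
- transitivity (\int[P]_t (s M ^- 2 *
      (qX (M0 + M) t ^+ 2 + (- 2 * mu (M0 + M) * qX (M0 + M) t + mu (M0 + M) ^+ 2)))).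
    by apply: eq_Rintegral => t _; rewrite /psi -/(qX _ _) exprMn exprVn; ring.
  have i1 : P.-integrable setT (EFin \o (fun t =>
      - 2 * mu (M0 + M) * qX (M0 + M) t + mu (M0 + M) ^+ 2)).
    by apply: integrable_add; [exact: integrable_scale|exact: integrable_cst].
  rewrite RintegralZl//; last exact: integrable_add.
  rewrite RintegralD// RintegralD//; [|exact: integrable_scale|exact: integrable_cst].
  rewrite RintegralZl// Rintegral_cst1 -/(mu _) s2 /var.
  have := var_ge M; rewrite /var => v4.
  have v0 : \int[P]_t (qX (M0 + M) t ^+ 2) - mu (M0 + M) ^+ 2 != 0.
    by rewrite gt_eqF// (lt_le_trans _ v4).
  rewrite [X in _ * X](_ : _ = \int[P]_t (qX (M0 + M) t ^+ 2) - mu (M0 + M) ^+ 2); last by ring.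
  by rewrite mulVf.
- move=> x.
  rewrite normrM normfV (gtr0_norm (s_gt0 M)) ler_pdivrMr//.
  apply: le_trans (ler_normB _ _) _.
  have := quantize_le (M0 + M) x; have := mu_le (M0 + M); have := normr_ge0 x.
  have := s_ge M; nra.
- move=> x; rewrite -[X in _ --> X](_ : (x - 0) * (Num.sqrt 1)^-1 = x); last first.
    by rewrite sqrtr1 invr1 mulr1 subr0.
  apply: cvgM.
    apply: cvgB; first by apply: (shift (fun M => quantize M x)); exact: quantize_cvg.
    exact: (shift mu).
  apply: cvgV; first by rewrite sqrtr1.
  apply: (@cvg_comp _ _ _ (fun m => var (M0 + m)) Num.sqrt _ (nbhs (1 : R))).
    exact: (shift var).
  exact: sqrt_continuous.
Qed.

End finite_approximation.

(** * Almost sure bounds for averages *)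

Section summable_ae.
Context {d : measure_display} {T : measurableType d} {R : realType}.
Variable P : probability T R.

(** Markov's inequality and the Borel-Cantelli lemma in one step. *)
Lemma ae_cvg0_of_summable (U : nat -> T -> R) (C : R) :
  (forall k, measurable_fun setT (U k)) -> (forall k t, 0 <= U k t) ->
  (forall k, P.-integrable setT (EFin \o U k)) ->
  (forall m, \sum_(k < m) \int[P]_t (U k t) <= C) ->
  {ae P, forall t, U k t @[k --> \oo] --> (0 : R)}.
Proof.
move=> mU U0 iU UC.
have mUE k : measurable_fun setT (fun t => (U k t)%:E) by exact/measurable_EFinP.
have UE0 k (t : T) : (0 <= (U k t)%:E)%E by rewrite lee_fin.
have intS : (\int[P]_t (\sum_(k <oo) (U k t)%:E) <= C%:E)%E.
  rewrite integral_nneseries//.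
  apply: lime_le.
    by apply: is_cvg_nneseries => k _ _; exact: integral_ge0.
  apply: nearW => m; rewrite big_mkord.
  apply: (@le_trans _ _ (\sum_(k < m) \int[P]_t (U k t))%:E); last by rewrite lee_fin.
  rewrite -sumEFin; apply: lee_sum => k _.
  by rewrite /Rintegral fineK//; exact: (integrable_fin_num measurableT (iU k)).
have iS : P.-integrable setT (fun t => \sum_(k <oo) (U k t)%:E)%E.
  apply/integrableP; split.
    by apply: ge0_emeasurable_sum => // k t _ _.
  under eq_integral => t _.
    rewrite gee0_abs; last by apply: nneseries_ge0 => k _ _.
    over.
  exact: le_lt_trans intS (ltry _).
have := integrable_ae measurableT iS.
apply: filterS => t /(_ I) St; apply: cvg_series_cvg_0.
apply: nondecreasing_is_cvgn.
  by apply/nondecreasing_seqP => m; rewrite /series /= big_nat_recr//= lerDl.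
exists (fine (\sum_(k <oo) (U k t)%:E)%E) => _ [m _ <-].
rewrite -lee_fin fineK// /series /= -sumEFin.
by apply: nneseries_lim_ge => k _ _.
Qed.

Variable l : nat -> {RV P >-> R}.

Lemma identically_distributed_integral (f : R -> R) j :
  identically_distributed l -> measurable_fun setT f ->
  P.-integrable setT (EFin \o (fun t => f (l 0%N t))) ->
  P.-integrable setT (EFin \o (fun t => f (l j t))) /\
  \int[P]_t (f (l j t)) = \int[P]_t (f (l 0%N t)).
Proof.
move=> lid mf if0.
have mfl i : measurable_fun setT (fun t => f (l i t)) by exact: measurableT_comp.
have E (g : R -> \bar R) i : measurable_fun setT g -> (forall y, (0 <= g y)%E) ->
    (\int[P]_t (g (l i t)) = \int[P]_t (g (l 0%N t)))%E.
  move=> mg g0; rewrite -[LHS](ge0_integral_distribution (l i) mg g0).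
  rewrite -[RHS](ge0_integral_distribution (l 0%N) mg g0).
  by apply: eq_measure_integral => A mA _; exact: lid.
have ifj : P.-integrable setT (EFin \o (fun t => f (l j t))).
  apply/integrableP; split; first exact/measurable_EFinP.
  have /integrableP[_] := if0.
  rewrite -(E (fun y => `|(f y)%:E|%E) j)//.
  by apply: measurableT_comp => //; exact/measurable_EFinP.
split=> //; congr fine.
have mE : measurable_fun setT (EFin \o f) by exact/measurable_EFinP.
rewrite -[LHS](integral_distribution (X := l j) mE ifj).
rewrite -[RHS](integral_distribution (X := l 0%N) mE if0).
by apply: eq_measure_integral => A mA _; exact: lid.
Qed.

End summable_ae.

Section dyadic_sums.
Context {R : realType}.
Implicit Type z : R.

Lemma dyadic_sum_below z m :
  0 <= z -> \sum_(k < m) (if 2 ^+ k < z then 2 ^+ k else 0) <= 2 * z.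
Proof.
move=> z0; pose a (m : nat) : R := \sum_(k < m) (if 2 ^+ k < z then 2 ^+ k else 0).
have [//] : a m <= 2 * z /\ a m <= 2 ^+ m.
elim: m => [|m [IH1 IH2]].
  by rewrite /a big_ord0 expr0; split => //; exact: mulr_ge0.
rewrite /a big_ord_recr /= -/(a m) exprS; case: ifP => H; last first.
  rewrite addr0; split => //; apply: le_trans IH2 _.
  by rewrite ler_peMl ?exprn_ge0// ler1n.
by split; lra.
Qed.

Lemma dyadic_sum_above z m : 1 <= z ->
  \sum_(k < m) (if z <= 2 ^+ k.+1 then z ^+ 2 / 2 ^+ k else 0) <= 4 * z.
Proof.
move=> z1; have z0 : 0 < z by exact: lt_le_trans z1.
pose a (m : nat) : R := \sum_(k < m) (if z <= 2 ^+ k.+1 then z ^+ 2 / 2 ^+ k else 0).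
have [A B] : (z <= 2 ^+ m -> a m <= 4 * z - 2 * z ^+ 2 / 2 ^+ m) /\ (2 ^+ m < z -> a m = 0); last first.
  have [/A H|/B] := leP z (2 ^+ m); last by rewrite /a => ->; apply: mulr_ge0 => //; exact: ltW.
  apply: le_trans H _; rewrite gerBl; apply: mulr_ge0; last by rewrite invr_ge0 exprn_ge0.
  by apply: mulr_ge0 => //; exact: sqr_ge0.
elim: m => [|m [IH1 IH2]].
  rewrite /a big_ord0 expr0 divr1; split => // z1'.
  have -> : z = 1 by apply/eqP; rewrite eq_le z1 z1'.
  by rewrite expr1n; lra.
have p0 : 0 < 2 ^+ m :> R by rewrite exprn_gt0.
rewrite /a big_ord_recr /= -/(a m); split=> H; last first.
  rewrite [z <= _]leNgt H /= addr0; apply: IH2; apply: le_lt_trans H.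
  by rewrite exprS ler_peMl ?ler1n// ltW.
rewrite H; set q := z ^+ 2 / 2 ^+ m.
have -> : 2 * z ^+ 2 / 2 ^+ m.+1 = q.
  by rewrite /q [2 ^+ m.+1]exprS; field; rewrite gt_eqF.
have [/IH1|/IH2 ->] := leP z (2 ^+ m).
  by rewrite -mulrA -/q; lra.
suff : q <= 2 * z by lra.
rewrite /q ler_pdivrMr// (_ : 2 * z * 2 ^+ m = 2 ^+ m.+1 * z); last first.
  by rewrite [2 ^+ m.+1]exprS; ring.
by rewrite expr2 ler_wpM2r// ltW.
Qed.

End dyadic_sums.

Section truncated_sums.
Context {d : measure_display} {T : measurableType d} {R : realType}.
Variable P : probability T R.
Variable l : nat -> {RV P >-> R}.
Hypothesis l_ind : mutually_independent l.
Hypothesis l_id : identically_distributed l.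
Variable y : R -> R.
Hypothesis my : measurable_fun setT y.
Hypothesis y_ge0 : forall x, 0 <= y x.
Hypothesis inty : P.-integrable setT (EFin \o (fun t => y (l 0%N t))).
Hypothesis meany : \int[P]_t (y (l 0%N t)) <= 1.

(* A finite-valued majorant of y on {y <= 2^k}. *)
Let zeta k x := if y x <= 2 ^+ k then quantize (2 ^ k) (y x) + 1 else 0.

Let pow_le k : 2 ^+ k <= (2 ^ k).+1%:R :> R.
Proof. by rewrite -natrX ler_nat. Qed.

Let zetaP k x : y x <= 2 ^+ k -> y x <= zeta k x <= y x + 1.
Proof.
move=> yk; rewrite /zeta yk.
have yk' : `|y x| <= (2 ^ k).+1%:R by rewrite ger0_norm//; exact: le_trans (pow_le k).
have : `|quantize (2 ^ k) (y x) - y x| <= 1.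
  apply: (@le_trans _ _ (2 ^ k).+1%:R^-1); last by rewrite invf_le1 ?ler1n.
  exact: quantize_dist.
rewrite ler_norml => /andP[? _]; have := quantize_below yk' => ?.
by apply/andP; split; lra.
Qed.

Let zeta_ge0 k x : 0 <= zeta k x.
Proof.
have [/zetaP/andP[H _]|yk] := leP (y x) (2 ^+ k); first exact: le_trans H.
by rewrite /zeta [_ <= 2 ^+ k]leNgt yk.
Qed.

Let mle k : measurable [set x | y x <= 2 ^+ k].
Proof.
have := my measurableT (measurable_itv `]-oo, 2 ^+ k]).
by rewrite setTI; congr measurable; apply/seteqP; split => x /=; rewrite in_itv.
Qed.

Let zetaE k : zeta k = fun x => \1_[set x | y x <= 2 ^+ k] x * (quantize (2 ^ k) (y x) + 1).
Proof.
apply/funext => x; rewrite /zeta indicE; case: ifPn => yk.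
  by rewrite mem_set// mul1r.
by rewrite memNset ?mul0r//; apply/negP.
Qed.

Let mzeta k : measurable_fun setT (zeta k).
Proof.
rewrite zetaE; apply: measurable_funM; first exact: measurable_indic.
apply: measurable_funD; last exact: measurable_cst.
by apply: measurableT_comp => //; exact: measurable_quantize.
Qed.

Let indic_gt k x : R := if 2 ^+ k < y x then 1 else 0.

Let mindic k : measurable_fun setT (indic_gt k).
Proof.
have -> : indic_gt k = fun x => 1 - \1_[set x | y x <= 2 ^+ k] x.
  apply/funext => x; rewrite /indic_gt indicE ltNge; case: ifPn => yk.
    by rewrite memNset ?subr0//; apply/negP.
  by rewrite mem_set ?subrr//; apply: contraNT yk.
by apply: measurable_funB; [exact: measurable_cst|exact: measurable_indic].
Qed.

Let V k := undup (0 :: [seq v + 1 | v <- quantize_values (R := R) (2 ^ k)]).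
Let X k (j : nat) (t : T) := zeta k (l j t).

Let mX k j : measurable_fun setT (X k j).
Proof. exact: measurableT_comp. Qed.

Let XV k j t : X k j t \in V k.
Proof.
rewrite mem_undup /X /zeta; case: ifP => _; rewrite inE ?eqxx//.
by apply/orP; right; apply: (map_f (fun v => v + 1)); exact: quantize_in.
Qed.

Let zeta_le k x : zeta k x <= 2 ^+ k + 1.
Proof.
have [yk|yk] := leP (y x) (2 ^+ k).
  by have /andP[_ H] := zetaP yk; apply: le_trans H _; rewrite lerD2r.
by rewrite /zeta [_ <= 2 ^+ k]leNgt yk /= addr_ge0// exprn_ge0.
Qed.

Let iX k j : P.-integrable setT (EFin \o (X k j)).
Proof.
apply: (@integrable_bounded _ _ _ P _ (2 ^+ k + 1) (mX k j)) => t.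
by rewrite ger0_norm ?zeta_ge0// zeta_le.
Qed.

Let iX2 k j : P.-integrable setT (EFin \o (fun t => X k j t ^+ 2)).
Proof.
apply: (@integrable_bounded _ _ _ P _ ((2 ^+ k + 1) ^+ 2)).
  exact: measurable_funX.
move=> t; rewrite ger0_norm ?sqr_ge0//.
by apply: lerXn2r; rewrite ?nnegrE ?zeta_ge0 ?zeta_le// addr_ge0// exprn_ge0.
Qed.

Let ioner k j : P.-integrable setT (EFin \o (fun t => indic_gt k (l j t))).
Proof.
apply: (@integrable_bounded _ _ _ P _ 1); first exact: measurableT_comp.
by move=> t; rewrite /indic_gt; case: ifP => _; rewrite ?normr1 ?normr0.
Qed.

Let S k n t := \sum_(j < n) X k j t.
Let c k n := \int[P]_t (S k n t).

Let variance_le k n :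
  P.-integrable setT (EFin \o (fun t => (S k n t - c k n) ^+ 2)) /\
  \int[P]_t ((S k n t - c k n) ^+ 2) <= n%:R * \int[P]_t (X k 0%N t ^+ 2).
Proof.
have ind m (B : nat -> set R) : (forall j, measurable (B j)) ->
    pr P (\bigcap_(j in `I_m) X k j @^-1` B j) = \prod_(j < m) pr P (X k j @^-1` B j).
  by move=> mB; exact: (@independent_comp _ _ _ P l (fun=> zeta k) m B l_ind (fun=> mzeta k) mB).
pose w := law P (X k); pose VV : nat -> seq R := fun=> V k.
have w0 : forall j v, 0 <= w j v by move=> j v; exact: law_ge0.
have uV j : uniq (VV j) by exact: undup_uniq.
have w1 : forall j, \sum_(v <- VV j) w j v = 1.
  by move=> j; exact: (@law_sum1 _ _ _ P (X k) VV (mX k) uV (XV k) j).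
have key (F : (nat -> R) -> R) := @Rintegral_prod_mean _ _ _ P (X k) VV (mX k) uV (XV k) ind n F.
pose F0 (x : nat -> R) := \sum_(j < n) x j.
have trunc (x : nat -> R) : F0 (truncate n x) = F0 x.
  by apply: eq_bigr => j _; rewrite /truncate ltn_ord.
have [_ cE] := key F0 trunc.
have [iF FE] := key (fun x => (F0 x - c k n) ^+ 2) (fun x => congr1 (fun u => (u - c k n) ^+ 2) (trunc x)).
split; first exact: iF.
rewrite FE.
have -> : (fun x => (F0 x - c k n) ^+ 2) =
    (fun x => (F0 x ^+ 2 + - 2 * c k n * F0 x) + c k n ^+ 2).
  by apply/funext => x; ring.
rewrite !prod_meanD prod_meanZ prod_mean_cst//.
have -> : prod_mean VV w n F0 = c k n by rewrite -cE.
have := efron_stein w0 w1 n F0.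
have -> : prod_mean VV w n F0 = c k n by rewrite -cE.
have -> : \sum_(j < n) prod_mean VV w n (fun x => (F0 x - F0 (upd x j 0)) ^+ 2) =
    n%:R * \int[P]_t (X k 0%N t ^+ 2).
  rewrite -[n in RHS]card_ord -sumr_const mulr_suml; apply: eq_bigr => j _; rewrite mul1r.
  have -> : (fun x => (F0 x - F0 (upd x j 0)) ^+ 2) = (fun x => x j ^+ 2).
    apply/funext => x; congr (_ ^+ 2); rewrite /F0 (bigD1 j)//= [in X in _ - X](bigD1 j)//=.
    rewrite upd_same add0r [X in _ - X](eq_bigr (fun i : 'I_n => x i)) ?addrK// => i ij.
    by rewrite /upd; case: eqP => // /val_inj ji; rewrite ji eqxx in ij.
  rewrite -(prod_mean_coord w1 (fun x => x j ^+ 2) (ltn_ord j)).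
  have -> : (fun x : nat -> R => coord_mean VV w j (fun v => upd x j v j ^+ 2)) =
      (fun=> \int[P]_t (X k 0%N t ^+ 2)).
    apply/funext => x; under eq_fun do rewrite upd_same.
    have [_ <-] := @coord_mean_law _ _ _ P (X k) VV (mX k) uV (XV k) j (fun v => v ^+ 2).
    have mz2 : measurable_fun setT (fun x => zeta k x ^+ 2) by exact: measurable_funX.
    exact: (identically_distributed_integral j l_id mz2 (iX2 k 0%N)).2.
  by rewrite prod_mean_cst.
lra.
Qed.

(* The number of terms above the truncation level 2^k, plus the squared
   normalized fluctuation of the truncated sum. *)
Let U k t := \sum_(j < (2 ^ k)%N) indic_gt k (l j t) +
  (2 ^+ k) ^- 2 * (S k (2 ^ k) t - c k (2 ^ k)) ^+ 2.

Let iUsum k : P.-integrable setT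
  (EFin \o (fun t => \sum_(j < (2 ^ k)%N) indic_gt k (l j t))).
Proof. by apply: integrable_bigsum => j; exact: ioner. Qed.

Let iU k : P.-integrable setT (EFin \o U k).
Proof.
apply: integrable_add => //; apply: integrable_scale.
exact: (variance_le k (2 ^ k)).1.
Qed.

Let iyb (a b : R) : P.-integrable setT (EFin \o (fun t => a * y (l 0%N t) + b)).
Proof. by apply: integrable_add; [exact: integrable_scale|exact: integrable_cst]. Qed.

Let iX0s k : P.-integrable setT (EFin \o (fun t => 2 ^+ k * indic_gt k (l 0%N t) +
    (2 ^+ k)^-1 * X k 0%N t ^+ 2)).
Proof. by apply: integrable_add; exact: integrable_scale. Qed.

Let U_mean_le k : \int[P]_t (U k t) <=
  \int[P]_t (2 ^+ k * indic_gt k (l 0%N t) + (2 ^+ k)^-1 * X k 0%N t ^+ 2).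
Proof.
have [iv vle] := variance_le k (2 ^ k).
have p0 : 0 < 2 ^+ k :> R by rewrite exprn_gt0.
rewrite RintegralD//; last exact: integrable_scale.
rewrite RintegralZl// RintegralD//; [|exact: integrable_scale..].
rewrite RintegralZl// RintegralZl// Rintegral_bigsum; last by move=> j; exact: ioner.
apply: lerD.
  rewrite (eq_bigr (fun=> \int[P]_t (indic_gt k (l 0%N t)))) => [|j _].
    by rewrite sumr_const card_ord -[leLHS]mulr_natl natrX.
  exact: (identically_distributed_integral j l_id (mindic k) (ioner k 0%N)).2.
apply: le_trans (ler_wpM2l _ vle) _.
  by rewrite invr_ge0 exprn_ge0// ltW.
rewrite natrX mulrA le_eqVlt; apply/orP; left; apply/eqP; congr (_ * _).
by field; rewrite gt_eqF.
Qed.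

Let sum_U_le m : \sum_(k < m) \int[P]_t (U k t) <= 10.
Proof.
apply: le_trans (ler_sum _ (fun (k : 'I_m) _ => U_mean_le k)) _.
rewrite -Rintegral_bigsum; last by move=> k; exact: iX0s.
apply: (@le_trans _ _ (\int[P]_t (6 * y (l 0%N t) + 4))); last first.
  rewrite RintegralD//; [|exact: integrable_scale|exact: integrable_cst].
  by rewrite RintegralZl// Rintegral_cst1; have := meany; lra.
apply: le_Rintegral => //; first by apply: integrable_bigsum => k; exact: iX0s.
move=> t _; rewrite big_split /= /X; move: (l 0%N t) => x.
have -> : 6 * y x + 4 = 2 * y x + 4 * (y x + 1) by ring.
apply: lerD.
  apply: le_trans (dyadic_sum_below m (y_ge0 x)).
  apply: ler_sum => k _; rewrite /indic_gt.
  by case: ifP => _; rewrite ?mulr1 ?mulr0.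
have z1 : 1 <= y x + 1 by rewrite lerDr.
apply: le_trans (dyadic_sum_above m z1).
apply: ler_sum => k _; rewrite mulrC.
have p0 : 0 <= (2 ^+ k)^-1 :> R by rewrite invr_ge0 exprn_ge0.
have p1 : 1 <= 2 ^+ k :> R by rewrite exprn_ege1// ler1n.
have [yk|yk] := leP (y x) (2 ^+ k); last first.
  rewrite /zeta [_ <= 2 ^+ k]leNgt yk /= expr0n mul0r; case: ifP => _ //.
  by apply: mulr_ge0 => //; exact: sqr_ge0.
have /andP[z2 z3] := zetaP yk.
have -> : (y x + 1 <= 2 ^+ k.+1) by rewrite exprS; lra.
rewrite ler_wpM2r//; apply: lerXn2r; rewrite ?nnegrE//.
exact: addr_ge0.
Qed.

(** Upper bound in the strong law of large numbers.  Truncation along the powers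
    of 2 needs only the first moment of [y]; a constant factor is lost between
    consecutive powers and in bounding the mean of the truncated terms. *)
Lemma ae_average_le :
  {ae P, forall t, \forall n \near \oo, \sum_(j < n) y (l j t) <= 6 * n%:R}.
Proof.
have mU k : measurable_fun setT (U k).
  by have /integrableP[/measurable_EFinP] := iU k.
have pk0 k : 0 < 2 ^+ k :> R by rewrite exprn_gt0.
have U1 k t : 0 <= \sum_(j < (2 ^ k)%N) indic_gt k (l j t).
  by apply: sumr_ge0 => j _; rewrite /indic_gt; case: ifP.
have U2 k t : 0 <= (2 ^+ k) ^- 2 * (S k (2 ^ k) t - c k (2 ^ k)) ^+ 2.
  by apply: mulr_ge0; [rewrite invr_ge0 sqr_ge0|exact: sqr_ge0].
have U0 k t : 0 <= U k t by apply: addr_ge0.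
have := ae_cvg0_of_summable mU U0 iU sum_U_le.
apply: filterS => t /cvgrPdist_lt/(_ 1 ltr01) [K _ HK].
have dyadic k : (K <= k)%N -> \sum_(j < (2 ^ k)%N) y (l j t) <= 3 * 2 ^+ k.
  move=> Kk; have := HK k Kk; rewrite sub0r normrN ger0_norm// => Uk.
  have yk (j : 'I_(2 ^ k)%N) : y (l j t) <= 2 ^+ k.
    rewrite leNgt; apply/negP => yj.
    have : U k t < 1 by [].
    rewrite /U (bigD1 j)//= {1}/indic_gt yj -addrA ltNge lerDl; move=> /negP; apply.
    by apply: addr_ge0 => //; apply: sumr_ge0 => i _; rewrite /indic_gt; case: ifP.
  have Sc : S k (2 ^ k) t <= c k (2 ^ k) + 2 ^+ k.
    have : (2 ^+ k) ^- 2 * (S k (2 ^ k) t - c k (2 ^ k)) ^+ 2 < 1.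
      by apply: le_lt_trans Uk; rewrite /U lerDr.
    rewrite mulrC ltr_pdivrMr ?exprn_gt0// mul1r => H.
    rewrite -lerBlDl; apply: le_trans (ler_norm _) _.
    by rewrite -(@ler_pXn2r _ 2) ?nnegrE ?(ltW (pk0 k))// real_normK ?num_real// ltW.
  have ck : c k (2 ^ k) <= 2 * 2 ^+ k.
    rewrite /c /S Rintegral_bigsum; last by move=> j; exact: iX.
    rewrite -natrX mulr_natr -[X in _ *+ X]card_ord -sumr_const; apply: ler_sum => j _.
    rewrite (identically_distributed_integral j l_id (mzeta k) (iX k 0%N)).2.
    apply: (@le_trans _ _ (\int[P]_t (1 * y (l 0%N t) + 1))).
      apply: le_Rintegral => // [|x _]; first exact: iX.
      rewrite mul1r; have [/zetaP/andP[]//|yx] := leP (y (l 0%N x)) (2 ^+ k).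
      by rewrite /zeta [_ <= 2 ^+ k]leNgt yx /= addr_ge0.
    rewrite RintegralD//; [|exact: integrable_scale|exact: integrable_cst].
    by rewrite RintegralZl// Rintegral_cst1 mul1r; have := meany; lra.
  apply: (@le_trans _ _ (S k (2 ^ k) t)); last by lra.
  by apply: ler_sum => j _; have /andP[] := zetaP (yk j).
exists (2 ^ K)%N => // n /= Kn.
have n0 : (0 < n)%N by apply: leq_trans Kn; rewrite expn_gt0.
pose k := (trunc_log 2 n).+1.
have nk : (n < 2 ^ k)%N by exact: trunc_log_ltn.
have kn : (2 ^ k <= 2 * n)%N by rewrite expnS leq_mul2l /= trunc_logP.
have Kk : (K <= k)%N by apply: leqW; exact: trunc_log_max.
apply: le_trans (_ : _ <= 3 * 2 ^+ k) _.
  apply: le_trans (dyadic k Kk).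
  rewrite -(big_mkord predT (fun j => y (l j t))) -(big_mkord predT (fun j => y (l j t))).
  rewrite [leRHS](big_cat_nat (n := n))//=; last exact: ltnW.
  by rewrite lerDl; apply: sumr_ge0.
have : 2 ^+ k <= 2 * n%:R :> R by rewrite -natrX -natrM ler_nat.
lra.
Qed.

End truncated_sums.

(** * From the Laplace transform to weak convergence *)

Section bernstein.
Context {R : realType}.
Implicit Types (a b : nat -> R) (u : R).

(** Bernstein polynomials [sum_k C(m, k) X^k (1 - X)^(m - k) a_k], by the
    recursion of the binomial law. *)
Fixpoint bernstein m a : {poly R} :=
  if m is p.+1 then (1 - 'X) * bernstein p a + 'X * bernstein p (fun k => a k.+1)
  else (a 0%N)%:P.

Lemma bernsteinS m a u : (bernstein m.+1 a).[u] =
  (1 - u) * (bernstein m a).[u] + u * (bernstein m (fun k => a k.+1)).[u].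
Proof. by rewrite /= !hornerE. Qed.

Lemma bernsteinD m a b u : (bernstein m (fun k => a k + b k)).[u] =
  (bernstein m a).[u] + (bernstein m b).[u].
Proof.
elim: m a b => [|m IH] a b; first by rewrite /= !hornerE.
by rewrite !bernsteinS !IH; ring.
Qed.

Lemma bernsteinZ m c a u : (bernstein m (fun k => c * a k)).[u] =
  c * (bernstein m a).[u].
Proof.
elim: m a => [|m IH] a; first by rewrite /= !hornerE.
by rewrite !bernsteinS !IH; ring.
Qed.

Lemma bernstein_cst m c u : (bernstein m (fun=> c)).[u] = c.
Proof.
elim: m => [|m IH]; first by rewrite /= !hornerE.
by rewrite bernsteinS !IH; ring.
Qed.

Lemma bernstein_variance m c u :
  (bernstein m (fun k => (k%:R - c) ^+ 2)).[u] =
  (m%:R * u - c) ^+ 2 + m%:R * u * (1 - u).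
Proof.
elim: m c => [|m IH] c; first by rewrite /= !hornerE.
rewrite bernsteinS IH.
have -> : (fun k => (k.+1%:R - c) ^+ 2) = (fun k => (k%:R - (c - 1)) ^+ 2).
  by apply/funext => k; rewrite -[k.+1%:R]natr1; ring.
by rewrite IH -[m.+1%:R]natr1; ring.
Qed.

Lemma le_bernstein m a b u : 0 <= u <= 1 ->
  (forall k, (k <= m)%N -> a k <= b k) ->
  (bernstein m a).[u] <= (bernstein m b).[u].
Proof.
move=> /andP[u0 u1]; elim: m a b => [|m IH] a b ab.
  by rewrite /= !hornerE; exact: ab.
rewrite !bernsteinS; apply: lerD.
  by rewrite ler_wpM2l ?subr_ge0//; apply: IH => k km; apply: ab; exact: leqW.
by rewrite ler_wpM2l//; apply: IH => k km; apply: ab.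
Qed.

Lemma uniform_continuity01 (G : R -> R) (e : R) : continuous G -> 0 < e ->
  exists2 h, 0 < h & forall u v, 0 <= u <= 1 -> `|u - v| < h -> `|G u - G v| <= e.
Proof.
move=> cG e0; have e20 : 0 < e / 2 by rewrite divr_gt0.
have /compact_near_coveringP K : compact (`[0, 1]%classic : set R) by exact: segment_compact.
have [|n0 _ Hn] := K nat \oo (fun n u => forall v, `|u - v| < n.+1%:R^-1 -> `|G u - G v| <= e).
  move=> u _; have /cvgrPdist_le/(_ _ e20) := cG u.
  move=> /nbhs_ballP[h /= h0 Hh].
  exists (ball u (h / 2), [set n | n.+1%:R^-1 < h / 2]) => /=.
    split; first by apply: nbhsx_ballx; rewrite divr_gt0.
    exists (Num.truncn (h / 2)^-1) => // n /= Hn.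
    rewrite -[h / 2]invrK ltf_pV2 ?posrE ?invr_gt0 ?divr_gt0//.
    by apply: lt_le_trans (truncnS_gt _) _; rewrite ler_nat ltnS.
  move=> [v n] /= [uv Hn] z vz.
  have uv2 : `|u - v| < h / 2 by [].
  have vz2 : `|v - z| < h / 2 by exact: lt_trans Hn.
  have H1 : `|G u - G v| <= e / 2.
    by apply: Hh; rewrite /ball_ /= ; apply: lt_trans uv2 _; rewrite gtr_pMr// invf_lt1// ltr1n.
  have H2 : `|G u - G z| <= e / 2.
    apply: Hh; apply: (@le_lt_trans _ _ (`|u - v| + `|v - z|)).
      exact: ler_distD.
    by rewrite [h]splitr ltrD.
  rewrite (_ : G v - G z = (G u - G z) - (G u - G v)); last by ring.
  by apply: le_trans (ler_normB _ _) _; rewrite [e]splitr lerD.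
exists n0.+1%:R^-1; first by rewrite invr_gt0.
move=> u v u01 uv; have := Hn n0 (leqnn _) u; apply => //=.
Qed.

(** Weierstrass's theorem, from the variance of the binomial law. *)
Lemma bernstein_approximation (G : R -> R) (M e : R) : continuous G ->
  (forall u, 0 <= u <= 1 -> `|G u| <= M) -> 0 < e ->
  exists p : {poly R}, forall u, 0 <= u <= 1 -> `|G u - p.[u]| <= e.
Proof.
move=> cG GM e0; have e20 : 0 < e / 2 by rewrite divr_gt0.
have [h h0 Hh] := uniform_continuity01 cG e20.
have M0 : 0 <= M by apply: le_trans (normr_ge0 (G 0)) (GM 0 _); rewrite lexx ler01.
pose m := (Num.truncn (2 * M / h ^+ 2 / (e / 2))).+1.
have m0 : 0 < m%:R :> R by rewrite ltr0n.
exists (bernstein m (fun k => G (k%:R / m%:R))) => u u01.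
have Gk k : (k <= m)%N -> `|G (k%:R / m%:R) - G u| <= e / 2 + 2 * M / h ^+ 2 * (k%:R / m%:R - u) ^+ 2.
  move=> km; have c0 : 0 <= 2 * M / h ^+ 2.
    by apply: divr_ge0; [exact: mulr_ge0|exact: sqr_ge0].
  have k01 : 0 <= (k%:R / m%:R : R) <= 1.
    apply/andP; split; first by apply: divr_ge0.
    by rewrite ler_pdivrMr// mul1r ler_nat.
  have [kh|hk] := ltP `|u - k%:R / m%:R| h.
    rewrite distrC; apply: le_trans (Hh _ _ u01 kh) _; rewrite lerDl.
    by apply: mulr_ge0 => //; exact: sqr_ge0.
  apply: le_trans (ler_normB _ _) _.
  apply: le_trans (lerD (GM _ k01) (GM _ u01)) _.
  apply: le_trans (_ : _ <= 2 * M / h ^+ 2 * (k%:R / m%:R - u) ^+ 2) _; last by rewrite lerDr ltW.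
  have : h ^+ 2 <= (k%:R / m%:R - u) ^+ 2.
    rewrite -[(_ - u) ^+ 2]real_normK ?num_real// distrC.
    by apply: lerXn2r; rewrite ?nnegrE// ltW.
  move=> /(ler_wpM2l c0); apply: le_trans.
  by rewrite divfK ?expf_neq0 ?gt_eqF//; lra.
set a := fun k => _ in Gk *.
have var : (bernstein m (fun k => (k%:R / m%:R - u) ^+ 2)).[u] = m%:R^-1 * u * (1 - u).
  have -> : (fun k : nat => (k%:R / m%:R - u) ^+ 2) =
      (fun k => m%:R^-1 ^+ 2 * (k%:R - m%:R * u) ^+ 2).
    by apply/funext => k; field; rewrite gt_eqF.
  by rewrite bernsteinZ bernstein_variance subrr expr0n add0r; field; rewrite gt_eqF.
have bound : (bernstein m (fun k => e / 2 + 2 * M / h ^+ 2 * (k%:R / m%:R - u) ^+ 2)).[u] <= e.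
  rewrite bernsteinD bernstein_cst bernsteinZ var.
  have : 2 * M / h ^+ 2 * (m%:R^-1 * u * (1 - u)) <= e / 2.
    have c0 : 0 <= 2 * M / h ^+ 2 by apply: divr_ge0; [exact: mulr_ge0|exact: sqr_ge0].
    apply: (@le_trans _ _ (2 * M / h ^+ 2 * m%:R^-1)).
      apply: ler_wpM2l => //; rewrite -mulrA ler_piMr ?invr_ge0 ?ltW//.
      by move: u01 => /andP[u0 u1]; nra.
    rewrite ler_pdivrMr// [leRHS]mulrC -ler_pdivrMr//.
    exact/ltW/truncnS_gt.
  lra.
have Ga k : (k <= m)%N -> a k - G u <= e / 2 + 2 * M / h ^+ 2 * (k%:R / m%:R - u) ^+ 2.
  by move=> km; exact: le_trans (ler_norm _) (Gk k km).
have aG k : (k <= m)%N -> G u - a k <= e / 2 + 2 * M / h ^+ 2 * (k%:R / m%:R - u) ^+ 2.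
  by move=> km; apply: le_trans (ler_norm _) _; rewrite distrC; exact: Gk.
have B1 := le_bernstein u01 Ga.
have B2 := le_bernstein u01 aG.
have E1 : (bernstein m (fun k => a k - G u)).[u] = (bernstein m a).[u] - G u.
  by rewrite bernsteinD bernstein_cst.
have E2 : (bernstein m (fun k => G u - a k)).[u] = G u - (bernstein m a).[u].
  rewrite bernsteinD bernstein_cst; congr (_ + _).
  rewrite -mulN1r -bernsteinZ; congr (_.[u]); congr bernstein.
  by apply/funext => k; rewrite mulN1r.
rewrite ler_norml; apply/andP; split.
  by have := le_trans B1 bound; rewrite E1; lra.
by have := le_trans B2 bound; rewrite E2.
Qed.

End bernstein.

Section laplace_determines_limit.
Context {d : measure_display} {T : measurableType d} {R : realType}.
Variable P : probability T R.
Variable X : T -> R.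
Hypothesis mX : measurable_fun setT X.
Hypothesis X_ge0 : forall t, 0 <= X t.
Hypothesis laplaceX : forall s : nat, \int[P]_t expR (- (s%:R * X t)) = (1 + s%:R)^-1.
Variable r : nat -> nat -> R.
Hypothesis r_ge0 : forall n k, 0 <= r n k.

Let avg n (f : R -> R) := n.+1%:R^-1 * \sum_(k < n.+1) f (r n k).

Hypothesis laplace_r : forall s : nat,
  avg n (fun x => expR (- (s%:R * x))) @[n --> \oo] --> (1 + s%:R : R)^-1.

Let expRN_unit (x : R) : 0 <= x -> 0 < expR (- x) <= 1.
Proof. by move=> x0; rewrite expR_gt0 -expR0 ler_expR oppr_le0. Qed.

Let expR_pow (i : nat) (x : R) : expR (- x) ^+ i = expR (- (i%:R * x)).
Proof. by rewrite -mulrN expRM_natl. Qed.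

Let mexp (s : nat) : measurable_fun setT (fun t => expR (- (s%:R * X t))).
Proof.
apply: measurableT_comp => //; apply: measurableT_comp => //.
by apply: measurable_funM => //; exact: measurable_cst.
Qed.

Let iexp s : P.-integrable setT (EFin \o (fun t => expR (- (s%:R * X t)))).
Proof.
apply: (integrable_bounded P (M := 1) (mexp s)) => t.
have /andP[/ltW h0 h1] := expRN_unit (mulr_ge0 (ler0n _ s) (X_ge0 t)).
by rewrite ger0_norm.
Qed.

Let polyE (q : {poly R}) (x : R) : q.[expR (- x)] = \sum_(i < size q) q`_i * expR (- (i%:R * x)).
Proof. by rewrite horner_coef; apply: eq_bigr => i _; rewrite expR_pow. Qed.

Let ipoly (q : {poly R}) : P.-integrable setT (EFin \o (fun t => q.[expR (- X t)])).
Proof.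
under eq_fun do rewrite polyE.
by apply: integrable_bigsum => i; exact: integrable_scale.
Qed.

Let cvg_poly (q : {poly R}) :
  avg n (fun x => q.[expR (- x)]) @[n --> \oo] --> \int[P]_t q.[expR (- X t)].
Proof.
have -> : \int[P]_t q.[expR (- X t)] = \sum_(i < size q) q`_i * (1 + i%:R)^-1.
  under eq_Rintegral do rewrite polyE.
  rewrite Rintegral_bigsum => [|i]; last exact: integrable_scale.
  by apply: eq_bigr => i _; rewrite RintegralZl// laplaceX.
have -> : (fun n => avg n (fun x => q.[expR (- x)])) =
    (fun n => \sum_(i < size q) q`_i * avg n (fun x => expR (- (i%:R * x)))).
  apply/funext => n; rewrite /avg; under eq_bigr do rewrite polyE.
  rewrite exchange_big big_distrr; apply: eq_bigr => i _ /=.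
  by rewrite -big_distrr /= mulrCA.
apply: cvg_big => [|i _]; first exact: add_continuous.
by apply: cvgM; [exact: cvg_cst|exact: laplace_r].
Qed.

(* In the variable u = exp (- r) the Laplace transform at integers gives the
   moments of a law on the unit interval; the factor 1 - (1 - u)^m makes the
   test function continuous at u = 0, the image of infinity.  For u <= 0 the
   value of ln u is 0. *)
Let cutoff (g : R -> R) m u : R := g (- ln u) * (1 - (1 - u) ^+ m).

Let cutoff_continuous (g : R -> R) (M : R) m : continuous g ->
  (forall x, `|g x| <= M) -> continuous (cutoff g m).
Proof.
move=> cg gM; pose h (u : R) := 1 - (1 - u) ^+ m.
have ch : continuous h.
  move=> u; apply: cvgB; first exact: cvg_cst.
  apply: (cvg_comp _ (fun v : R => v ^+ m)); last exact: exprn_continuous.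
  by apply: cvgB; [exact: cvg_cst|exact: cvg_id].
move=> u; have [u0|u0|<-] := ltgtP 0 u.
- apply: cvgM; last exact: ch.
  apply: (cvg_comp _ g); last exact: cg.
  by apply: cvgN; exact: continuous_ln.
- apply: cvgM; last exact: ch.
  apply: cvg_near_cst; near=> v.
  have v0 : v < 0 by near: v; exact: lt_nbhsl.
  by rewrite !ln0// ltW.
- have h0 : h 0 = 0 by rewrite /h subr0 expr1n subrr.
  rewrite /continuous_at.
  have -> : cutoff g m 0 = 0 by rewrite /cutoff -[X in _ * X]/(h 0) h0 mulr0.
  apply/cvgrPdist_le => e e0.
  have M1 : 0 < M + 1.
    by have := le_trans (normr_ge0 _) (gM 0); lra.
  have := ch 0; rewrite /continuous_at h0.
  move=> /cvgrPdist_le /(_ (e / (M + 1)) (divr_gt0 e0 M1)); apply: filterS => v.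
  rewrite !sub0r !normrN => hv; rewrite normrM -/(h v).
  apply: le_trans (_ : _ <= M * (e / (M + 1))) _; first exact: ler_pM.
  by rewrite mulrCA ler_piMr ?(ltW e0)// ler_pdivrMr// mul1r lerDl.
Unshelve. all: by end_near. Qed.

(** Convergence of the Laplace transform at the integers implies weak
    convergence of laws on the half-line: by Weierstrass's theorem, the span of
    the functions [exp (- s r)] is dense. *)
Lemma laplace_cvg (g : R -> R) (M : R) : continuous g -> (forall x, `|g x| <= M) ->
  avg n g @[n --> \oo] --> \int[P]_t g (X t).
Proof.
move=> cg gM; have M0 : 0 <= M := le_trans (normr_ge0 _) (gM 0).
have mgX : measurable_fun setT (fun t => g (X t)).
  by apply: measurableT_comp => //; exact: continuous_measurable_fun.
have igX := integrable_bounded P mgX (fun t => gM (X t)).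
apply/cvgrPdist_le => e0 e00.
pose e := e0 / (3 * M + 3).
have M3 : 0 < 3 * M + 3 by rewrite ltr_wpDl// mulr_ge0.
have e_gt0 : 0 < e by exact: divr_gt0.
pose tail m : {poly R} := (1 - 'X) ^+ m.
have tailE m x : (tail m).[expR (- x)] = (1 - expR (- x)) ^+ m.
  by rewrite /tail horner_exp !hornerE.
have tail01 m x : 0 <= x -> 0 <= (tail m).[expR (- x)] <= 1.
  move=> x0; have /andP[h0 h1] := expRN_unit x0.
  by rewrite tailE exprn_ge0 ?subr_ge0//= exprn_ile1 ?subr_ge0// gerBl ltW.
have [m Hm] : exists m, \int[P]_t (tail m).[expR (- X t)] <= e.
  have : \int[P]_t (tail m).[expR (- X t)] @[m --> \oo] --> (0 : R).
    rewrite -(Rintegral_cst1 P 0).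
    apply: (@Rintegral_dominated _ _ _ P (fun m t => (tail m).[expR (- X t)]) (fun=> 0) (fun=> 1)).
    - by move=> m; have /integrableP[/measurable_EFinP] := ipoly (tail m).
    - exact: measurable_cst.
    - move=> t; under eq_fun do rewrite tailE.
      apply: cvg_expr; have /andP[h0 h1] := expRN_unit (X_ge0 t).
      by rewrite ger0_norm ?subr_ge0// gtrBl.
    - exact: integrable_cst.
    - move=> m t; have /andP[h0 h1] := tail01 m _ (X_ge0 t).
      by rewrite ger0_norm.
  move=> /cvgrPdist_le/(_ e e_gt0)[m _ /(_ m (leqnn _))].
  by rewrite sub0r normrN => /(le_trans (ler_norm _)) H; exists m.
have cutM u : 0 <= u <= 1 -> `|cutoff g m u| <= M.
  move=> /andP[u0 u1]; rewrite normrM -[M]mulr1; apply: ler_pM => //.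
  have : 0 <= (1 - u) ^+ m <= 1 by rewrite exprn_ge0 ?subr_ge0//= exprn_ile1 ?subr_ge0// gerBl.
  by move=> /andP[? ?]; rewrite ger0_norm ?subr_ge0// gerBl.
have [p Hp] := bernstein_approximation (cutoff_continuous (m := m) cg gM) cutM e_gt0.
have gp x : 0 <= x -> `|g x - p.[expR (- x)]| <= M * (tail m).[expR (- x)] + e.
  move=> x0; have /andP[h0 h1] := expRN_unit x0.
  have := Hp (expR (- x)); rewrite (ltW h0) h1 => /(_ isT).
  rewrite /cutoff expRK opprK -tailE => H.
  rewrite (_ : g x - _ = g x * (tail m).[expR (- x)] +
    (g x * (1 - (tail m).[expR (- x)]) - p.[expR (- x)])); last by ring.
  apply: le_trans (ler_normD _ _) _; apply: lerD => //.
  have /andP[t0 t1] := tail01 m x x0.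
  by rewrite normrM (ger0_norm t0) ler_wpM2r.
have Pgp : `|\int[P]_t g (X t) - \int[P]_t p.[expR (- X t)]| <= M * e + e.
  rewrite -RintegralB//.
  apply: le_trans (le_normr_Rintegral _ _) _ => //.
    have := integrable_add igX (integrable_scale (-1) (ipoly p)).
    by congr (integrable _ _ _); apply/funext => t /=; rewrite mulN1r.
  apply: (@le_trans _ _ (\int[P]_t (M * (tail m).[expR (- X t)] + e))).
    apply: le_Rintegral => //.
    - have := integrable_norm (integrable_add igX (integrable_scale (-1) (ipoly p))).
      by congr (integrable _ _ _); apply/funext => t /=; rewrite mulN1r.
    - by apply: integrable_add; [exact: integrable_scale (ipoly _)|exact: integrable_cst].
    - by move=> t _; exact: gp.
  rewrite RintegralD//; [|exact: integrable_scale (ipoly _)|exact: integrable_cst].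
  rewrite RintegralZl//.
  by rewrite Rintegral_cst1 lerD2r ler_wpM2l.
have := cvg_poly (q := p) => /cvgrPdist_le/(_ e e_gt0) Hp1.
have := cvg_poly (q := tail m) => /cvgrPdist_le/(_ e e_gt0) Ht1.
near=> n.
have A1 : `|\int[P]_t p.[expR (- X t)] - avg n (fun x => p.[expR (- x)])| <= e.
  by near: n.
have A2 : `|\int[P]_t (tail m).[expR (- X t)] - avg n (fun x => (tail m).[expR (- x)])| <= e.
  by near: n.
have NV0 : 0 <= n.+1%:R^-1 :> R by rewrite invr_ge0.
have Agp : `|avg n g - avg n (fun x => p.[expR (- x)])| <= M * (2 * e) + e.
  rewrite /avg -mulrBr -sumrB normrM ger0_norm//.
  apply: (@le_trans _ _ (n.+1%:R^-1 * \sum_(k < n.+1)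
      (M * (tail m).[expR (- r n k)] + e))).
    apply: ler_wpM2l => //; apply: le_trans (ler_norm_sum _ _ _) _.
    by apply: ler_sum => k _; exact: gp.
  rewrite big_split /= mulrDr average_cst lerD2r -big_distrr mulrCA ler_wpM2l//.
  rewrite -[leLHS]/(avg n (fun x => (tail m).[expR (- x)])).
  by move: A2; rewrite ler_norml => /andP[A2 _]; lra.
have -> : e0 = (3 * M + 3) * e by rewrite /e mulrC divfK// gt_eqF.
rewrite (_ : _ - _ = (\int[P]_t g (X t) - \int[P]_t p.[expR (- X t)]) +
  (\int[P]_t p.[expR (- X t)] - avg n (fun x => p.[expR (- x)])) -
  (avg n g - avg n (fun x => p.[expR (- x)]))); last by ring.
apply: le_trans (ler_normB _ _) _.
apply: le_trans (lerD (ler_normD _ _) (lexx _)) _.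
lra.
Unshelve. all: by end_near. Qed.

End laplace_determines_limit.

Section rayleigh_law.
Context {R : realType}.
Local Notation mu := (@lebesgue_measure R).

Lemma rayleigh_symmetric (A : set R) : measurable A ->
  pushforward (@rayleigh R) (-%R : R -> R) A = rayleigh A.
Proof.
move=> mA; rewrite /pushforward /rayleigh.
have mp : measurable_fun setT (EFin \o @rayleigh_pdf R).
  by apply/measurable_EFinP; exact: measurable_rayleigh_pdf.
transitivity (\int[pushforward mu (-%R : _ -> measurableTypeR R)]_(x in A)
    (rayleigh_pdf x)%:E)%E; last first.
  apply: eq_measure_integral => B mB _; exact: lebesgue_measureN.
rewrite ge0_integral_pushforward//.
- by apply: eq_integral => x _ /=; rewrite /rayleigh_pdf normrN sqrrN.
- exact: measurable_funTS.
- by move=> x _; rewrite lee_fin rayleigh_pdf_ge0.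
Qed.

Import HBNNSimple.

Let rayleigh_nnsfun (f : {nnsfun R >-> R}) :
  (\int[rayleigh]_x (f x)%:E = \int[mu]_x ((f x)%:E * (rayleigh_pdf x)%:E))%E.
Proof.
have mp : measurable_fun setT (EFin \o @rayleigh_pdf R).
  by apply/measurable_EFinP; exact: measurable_rayleigh_pdf.
have p0 (x : R) : (0 <= (rayleigh_pdf x)%:E)%E by rewrite lee_fin rayleigh_pdf_ge0.
have mI (r : R) : measurable_fun setT (\1_(f @^-1` [set r]) : R -> R).
  exact: (measurable_indic (measurable_funPTI f (measurable_set1 r))).
have mIE (r : R) : measurable_fun setT (EFin \o (\1_(f @^-1` [set r]) : R -> R)).
  by apply/measurable_EFinP; exact: (mI r).
have mIr (r : R) : measurable_fun setT (fun x : R => (r * \1_(f @^-1` [set r]) x)%:E).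
  by apply/measurable_EFinP; apply: measurable_funM => //; exact: measurable_cst.
under [LHS]eq_integral do rewrite fimfunE -fsumEFin//.
rewrite [LHS]ge0_integral_fsum//; last first.
  by move=> n x _; rewrite EFinM nnfun_muleindic_ge0.
under [RHS]eq_integral.
  move=> x xD; rewrite fimfunE -fsumEFin// muleC ge0_mule_fsumr; last first.
    by move=> r; rewrite EFinM nnfun_muleindic_ge0.
  over.
rewrite [RHS]ge0_integral_fsum//; last 2 first.
  - move=> r; apply: emeasurable_funM => //.
    exact: mIr.
  - by move=> n x _; apply: mule_ge0 => //; rewrite EFinM nnfun_muleindic_ge0.
apply: eq_fsbigr => r rf.
have r0 : 0 <= r.
  by move: rf; rewrite inE => -[x _ <-].
under [RHS]eq_integral do rewrite [(r * _)%:E]EFinM muleCA.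
rewrite integralZl_indic_nnsfun// integral_indic// setIT.
rewrite ge0_integralZl//; last 2 first.
  - exact: (emeasurable_funM mp (mIE r)).
  - by move=> x _; apply: mule_ge0 => //; rewrite lee_fin.
congr (_ * _)%E.
rewrite -[LHS]/(\int[mu]_(x in f @^-1` [set r]) (rayleigh_pdf x)%:E)%E [LHS]integral_mkcond.
apply: eq_integral => x _; rewrite patchE indicE.
by case: ifP => _; rewrite ?mule1 ?mule0.
Qed.

Lemma integral_rayleigh (f : R -> R) : measurable_fun setT f ->
  (forall x, 0 <= f x) ->
  (\int[rayleigh]_x (f x)%:E = \int[mu]_x (f x * rayleigh_pdf x)%:E)%E.
Proof.
move=> mf f0.
have mfE : measurable_fun setT (EFin \o f) by exact/measurable_EFinP.
have fE0 (x : R) : [set: R] x -> (0 <= (f x)%:E)%E by rewrite lee_fin.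
have p0 (x : R) : (0 <= (rayleigh_pdf x)%:E)%E by rewrite lee_fin rayleigh_pdf_ge0.
have mp : measurable_fun setT (EFin \o @rayleigh_pdf R).
  by apply/measurable_EFinP; exact: measurable_rayleigh_pdf.
pose f_ := nnsfun_approx measurableT mfE.
have mf_ n : measurable_fun setT (fun x => (f_ n x)%:E).
  by apply/measurable_EFinP; exact: measurable_funP.
transitivity (limn (fun n => \int[rayleigh]_x (f_ n x)%:E)%E).
  rewrite -monotone_convergence//=.
  - apply: eq_integral => x _; apply/esym/cvg_lim => //.
    exact: cvg_nnsfun_approx.
  - by move=> n x _; rewrite lee_fin.
  - by move=> x _ a b ab; rewrite lee_fin; exact/lefP/nd_nnsfun_approx.
transitivity (limn (fun n => \int[mu]_x ((f_ n x)%:E * (rayleigh_pdf x)%:E))%E).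
  by apply: congr_lim; apply/funext => n; exact: rayleigh_nnsfun.
rewrite -monotone_convergence//=.
- apply: eq_integral => x _; rewrite [(f x * _)%:E]EFinM; apply/cvg_lim => //.
  by apply: cvgeZr => //; exact: cvg_nnsfun_approx.
- by move=> n; exact: (emeasurable_funM (mf_ n) mp).
- by move=> n x _; apply: mule_ge0 => //; rewrite lee_fin.
- move=> x _ a b ab; apply: lee_wpmul2r; first exact: p0.
  have := nd_nnsfun_approx measurableT mfE ab.
  by move=> /lefP/(_ x); rewrite lee_fin.
Qed.

(** The square of a variable of symmetrized Rayleigh law is exponential. *)
Lemma rayleigh_laplace (s : R) : 0 <= s ->
  \int[rayleigh]_x expR (- (s * x ^+ 2)) = (1 + s)^-1.
Proof.
move=> s0; have s1 : 0 < 1 + s by apply: lt_le_trans ltr01 _; rewrite lerDl.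
rewrite /Rintegral integral_rayleigh//; last first.
  apply: measurableT_comp => //; apply: measurableT_comp => //.
  by apply: measurable_funM.
pose p (x : R) := `|x| * expR (- ((1 + s) * x ^+ 2)).
have pE x : expR (- (s * x ^+ 2)) * rayleigh_pdf x = p x.
  by rewrite /rayleigh_pdf /p mulrCA -expRD; congr (_ * expR _); ring.
under eq_integral do rewrite pE.
have e2 (x : R) : continuous_at x (fun x : R => expR (- ((1 + s) * x ^+ 2))).
  apply: (cvg_comp _ expR); last exact: continuous_expR.
  apply: (@cvgN _ R^o); apply: cvgM; [exact: cvg_cst|exact: sqr_continuous].
have cp : continuous p.
  by move=> x; apply: cvgM; [exact: norm_continuous|exact: e2].
have p0 x : 0 <= p x by rewrite mulr_ge0// expR_ge0.
rewrite ge0_symfun_integralT//; last first.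
  by move=> x; rewrite /p /= normrN sqrrN.
pose F (x : R) := - (2 * (1 + s))^-1 * expR (- ((1 + s) * x ^+ 2)).
have dF (x : R) : is_derive x (1 : R) F (x * expR (- ((1 + s) * x ^+ 2))).
  apply: is_derive_eq.
  rewrite /GRing.scale /= ?mulr1.
  by field; rewrite gt_eqF.
have cF : continuous F.
  by move=> x; apply/differentiable_continuous/derivable1_diffP; case: (dF x).
rewrite -set_itvcy (@ge0_continuous_FTC2y _ _ F 0 0).
- rewrite /F expr0n mulr0 oppr0 expR0 mulr1 sub0e -EFinN opprK -EFinM /=.
  by field; rewrite gt_eqF.
- by move=> x _; exact: p0.
- by apply: continuous_subspaceT => x; exact: cp.
- rewrite -[X in _ --> X](mulr0 (- (2 * (1 + s))^-1)); apply: cvgMl_tmp.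
  apply: (@cvg_comp _ _ _ (fun x : R => (1 + s) * x ^+ 2) (fun x => expR (- x)) _ (pinfty_nbhs R)).
    apply/cvgryPge => M; near=> x.
    have x1 : 1 <= x by near: x; apply: nbhs_pinfty_ge; rewrite num_real.
    have xM : M <= x by near: x; apply: nbhs_pinfty_ge; rewrite num_real.
    by rewrite expr2; nra.
  exact: cvgr_expR.
- by move=> x _; case: (dF x).
- exact/cvg_at_right_filter/cF.
- move=> x; rewrite in_itv/= andbT => x0; rewrite derive1E derive_val.
  by rewrite /p gtr0_norm.
Unshelve. all: by end_near. Qed.

(** The spectral law only sees the even part of a test function. *)
Lemma Rintegral_rayleigh_even (f : R -> R) (M : R) : continuous f ->
  (forall x, `|f x| <= M) ->
  \int[rayleigh]_x (f x) =
  \int[rayleigh]_x (2^-1 * (f (Num.sqrt (x ^+ 2)) + f (- Num.sqrt (x ^+ 2)))).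
Proof.
move=> cf fM; have mf : measurable_fun setT f by exact: continuous_measurable_fun.
have mN : measurable_fun setT (fun x : R => f (- x)).
  exact: (measurableT_comp mf (@oppr_measurable R setT)).
have if1 := integrable_bounded (@rayleigh R) mf fM.
have if2 := integrable_bounded (@rayleigh R) mN (fun x => fM (- x)).
have E : \int[rayleigh]_x (f (- x)) = \int[rayleigh]_x (f x).
  rewrite /Rintegral; congr fine.
  transitivity (\int[pushforward (@rayleigh R) (-%R : R -> R)]_x (f x)%:E)%E.
    rewrite integral_pushforward//.
    exact/measurable_EFinP.
  by apply: eq_measure_integral => A mA _; exact: rayleigh_symmetric.
transitivity (\int[rayleigh]_x (2^-1 * (f x + f (- x)))).
  rewrite RintegralZl//; last exact: integrable_add.
  by rewrite RintegralD// E; move: (Rintegral _ _ _) => A; field.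
apply: eq_Rintegral => x _; rewrite sqrtr_sqr.
have [x0|x0] := ger0P x; first by [].
by rewrite opprK addrC.
Qed.

End rayleigh_law.

Section esd_integral.
Context {R : realType}.

Let esd_integral_ge0 n (A : 'M[R]_n) (f : R -> R) : measurable_fun setT f ->
  (forall x, 0 <= f x) ->
  (\int[esd A]_x (f x)%:E = (n%:R^-1 * \sum_(x <- eigenvalues A) f x)%:E)%E.
Proof.
move=> mf f0; have mfE : measurable_fun setT (EFin \o f) by exact/measurable_EFinP.
rewrite ge0_integral_mscale//; last by move=> x _; rewrite lee_fin.
rewrite ge0_integral_measure_sum//; last by move=> x _; rewrite lee_fin.
rewrite EFinM; congr (_ * _)%E; rewrite (big_nth 0) big_mkord -sumEFin.
by apply: eq_bigr => k _; rewrite integral_dirac// diracT mul1e.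
Qed.

Lemma esd_integral n (A : 'M[R]_n) (f : R -> R) (M : R) : measurable_fun setT f ->
  (forall x, `|f x| <= M) ->
  (\int[esd A]_x (f x)%:E = (n%:R^-1 * \sum_(x <- eigenvalues A) f x)%:E)%E.
Proof.
move=> mf fM; have M0 : 0 <= M := le_trans (normr_ge0 _) (fM 0).
have mc (c : R) : measurable_fun setT (fun _ : R => c) by exact: measurable_cst.
have fin : (esd A setT < +oo)%E.
  have := esd_integral_ge0 A (mc 1) (fun=> ler01).
  by rewrite integral_cst// mul1e => ->; exact: ltry.
have bint (g : R -> R) (B : R) : measurable_fun setT g -> (forall x, `|g x| <= B) ->
    (esd A).-integrable setT (EFin \o g).
  move=> mg gB; apply: measurable_bounded_integrable => //.
  by exists B; split; [exact: num_real|move=> y By x _ /=; exact: le_trans (gB x) (ltW By)].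
have mfM : measurable_fun setT (fun x => f x + M) by exact: measurable_funD.
have fM0 x : 0 <= f x + M by have := fM x; rewrite ler_norml => /andP[]; lra.
have fMB x : `|f x + M| <= 2 * M.
  by apply: le_trans (ler_normD _ _) _; rewrite (ger0_norm M0); have := fM x; lra.
transitivity (\int[esd A]_x ((f x + M)%:E - M%:E))%E.
  by apply: eq_integral => x _; rewrite -EFinB addrK.
have MM (x : R) : `|M| <= M by rewrite ger0_norm.
rewrite integralB//; [|exact: (bint _ _ mfM fMB)|exact: (bint (fun=> M) M (mc M) MM)].
rewrite !esd_integral_ge0// -EFinB -mulrBr -sumrB.
by congr (_ * _)%:E; apply: eq_bigr => x _; rewrite addrK.
Qed.

End esd_integral.

Section esd_limit.
Context {R : realType}.

(** The spectral measure differs from the average of the two-point laws at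
    [+- sqrt r_k] by [O(1/n)], and the squared moduli [r_k] have the limit law of
    [X^2] for [X] of symmetrized Rayleigh law. *)
Lemma esd_weak_cvg (x : nat -> R) :
  (forall s : nat, empirical_laplace n s%:R x @[n --> \oo] --> (1 + s%:R : R)^-1) ->
  weak_cvg (fun n => esd ((Num.sqrt n.+1%:R)^-1 *: LScirc n.+1 x)) rayleigh.
Proof.
move=> lapx f cf [M fM]; have M0 : 0 <= M := le_trans (normr_ge0 _) (fM 0).
have mf : measurable_fun setT f by exact: continuous_measurable_fun.
pose r n k := sq_modulus n.+1 (frame_cos n k) (frame_sin n k) x.
pose g (u : R) := 2^-1 * (f (Num.sqrt u) + f (- Num.sqrt u)).
have cg : continuous g.
  move=> u; apply: cvgM; first exact: cvg_cst.
  have cs : Num.sqrt v @[v --> u] --> Num.sqrt u by exact: sqrt_continuous.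
  apply: cvgD; first by apply: (cvg_comp _ f cs); exact: cf.
  by apply: (cvg_comp _ f (cvgN cs)); exact: cf.
have gM u : `|g u| <= M.
  rewrite normrM ger0_norm ?invr_ge0// mulrC ler_pdivrMr//.
  by apply: le_trans (ler_normD _ _) _; have := fM (Num.sqrt u); have := fM (- Num.sqrt u); lra.
have int_f := integrable_bounded (@rayleigh R) mf fM.
have -> : (\int[rayleigh]_y (f y)%:E = (\int[rayleigh]_y f y)%:E)%E.
  by rewrite fineK// integrable_fin_num.
under eq_fun do rewrite (esd_integral _ mf fM).
apply: cvg_EFin; first by near=> n.
rewrite (Rintegral_rayleigh_even cf fM).
have mX : measurable_fun setT (fun y : R => y ^+ 2) by exact: measurable_funX.
have := @laplace_cvg _ _ R (@rayleigh R) (fun y => y ^+ 2) mX (fun y => sqr_ge0 y)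
  (fun s => rayleigh_laplace (ler0n R s)) r _ lapx g M cg gM.
move=> /(_ (fun n k => sq_modulus_ge0 _ _ _ _)) cvg_g.
have diff0 : n.+1%:R^-1 * \sum_(y <- eigenvalues ((Num.sqrt n.+1%:R)^-1 *: LScirc n.+1 x)) f y -
    n.+1%:R^-1 * \sum_(k < n.+1) g (r n k) @[n --> \oo] --> (0 : R).
  apply/norm_cvg0P.
  apply: (@squeeze_cvgr _ _ _ _ (fun=> 0) (fun n => 2 * M * n.+1%:R^-1)).
  - near=> n; rewrite normr_ge0 -mulrBr normrM ger0_norm ?invr_ge0//= mulrC.
    apply: ler_wpM2r; first by rewrite invr_ge0.
    exact: eigenvalues_LScirc_sum.
  - exact: cvg_cst.
  - rewrite -[X in _ --> X](mulr0 (2 * M)); apply: cvgM; first exact: cvg_cst.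
    exact: cvg_harmonic.
rewrite -[X in _ --> X]add0r.
under eq_cvg => n do rewrite /= -(subrK (n.+1%:R^-1 * \sum_(k < n.+1) g (r n k)) (n.+1%:R^-1 * _)).
exact: cvgD.
Unshelve. all: by end_near. Qed.

End esd_limit.

(** * Discretization of the variables *)

Section standardized_variable.
Context {d : measure_display} {T : measurableType d} {R : realType}.
Variable P : probability T R.

Lemma expectation_real (X : T -> R) : 'E_P[X]%E = (\int[P]_t (X t)%:E)%E.
Proof. by rewrite unlock. Qed.

(** The mean converges because the variance does: [|x| <= 1 + x^2]. *)
Lemma standardized_integrals (X : {RV P >-> R}) :
  'E_P[X]%E = 0%E -> 'V_P[X]%E = 1%E ->
  [/\ P.-integrable setT (EFin \o X),
      P.-integrable setT (EFin \o (fun t => X t ^+ 2)),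
      \int[P]_t (X t) = 0 & \int[P]_t (X t ^+ 2) = 1].
Proof.
move=> EX VX.
have mX : measurable_fun setT X by exact: measurable_funP.
have EX2 : (\int[P]_t (X t ^+ 2)%:E = 1)%E.
  rewrite -VX /variance covariance.unlock EX expectation_real.
  by apply: eq_integral => t _; rewrite [RHS](_ : _ = ((X t - 0) * (X t - 0))%:E)// subr0 expr2.
have iX2 : P.-integrable setT (EFin \o (fun t => X t ^+ 2)).
  apply/integrableP; split; first by apply/measurable_EFinP; exact: measurable_funX.
  under eq_integral => t _ do rewrite /= ger0_norm ?sqr_ge0//.
  by rewrite EX2 ltry.
split => //.
- apply: (@le_integrable_real _ _ _ P _ (fun t => 1 + X t ^+ 2)) => //.
    by move=> t; rewrite -(real_normK (num_real (X t))); have := normr_ge0 (X t); nra.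
  by apply: integrable_add => //; exact: integrable_cst.
- by rewrite /Rintegral -expectation_real EX.
- by rewrite /Rintegral EX2.
Qed.

End standardized_variable.

Section discretized_family.
Context {d : measure_display} {T : measurableType d} {R : realType}.
Variable P : probability T R.
Variable l : nat -> {RV P >-> R}.
Hypothesis l_ind : mutually_independent l.
Variables (f : nat -> R -> R) (V : nat -> seq R) (Km : nat -> R).
Hypothesis mf : forall j, measurable_fun setT (f j).
Hypothesis uV : forall j, uniq (V j).
Hypothesis fV : forall j x, f j x \in V j.
Hypothesis meanf : forall j, \int[P]_t (f j (l j t)) = 0.
Hypothesis varf : forall j, \int[P]_t (f j (l j t) ^+ 2) = 1.
Hypothesis momf : forall Q j i, (i <= Q.*2)%N ->
  \int[P]_t (`|f j (l j t)| ^+ i) <= Km Q.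

Let X j t := f j (l j t).

Let mX j : measurable_fun setT (X j).
Proof. by apply: measurableT_comp => //; exact: measurable_funP. Qed.

Let XV j t : X j t \in V j. Proof. exact: fV. Qed.

Lemma discretized_standard_laws : standard_laws Km V (law P X).
Proof.
have E j (g : R -> R) := (@coord_mean_law _ _ _ P X V mX uV XV j g).2.
split.
- by move=> j v; exact: law_ge0.
- by move=> j; exact: (@law_sum1 _ _ _ P X V mX uV XV j).
- by move=> j; rewrite -E meanf.
- by move=> j; rewrite -E varf.
- by move=> Q j i iQ; rewrite -E; exact: momf.
Qed.

Lemma discretized_mean n (F : (nat -> R) -> R) :
  (forall x, F (truncate n x) = F x) ->
  P.-integrable setT (EFin \o (fun t => F (fun j => f j (l j t)))) /\
  \int[P]_t (F (fun j => f j (l j t))) = prod_mean V (law P X) n F.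
Proof.
move=> FT; apply: (@Rintegral_prod_mean _ _ _ P X V mX uV XV) => // m B mB.
exact: independent_comp.
Qed.

End discretized_family.

(** * Almost sure convergence of the spectral measure *)

Section inverse_squares.
Context {R : realType}.

Lemma sum_inverse_squares m : \sum_(k < m) (k.+1%:R : R)^-1 ^+ 2 <= 2 - 2 * m.+1%:R^-1.
Proof.
elim: m => [|m IH]; first by rewrite big_ord0 invr1 mulr1 subrr.
rewrite big_ord_recr /=; apply: le_trans (lerD IH (lexx _)) _.
have a0 : 0 < m.+1%:R :> R by rewrite ltr0n.
have b0 : 0 < m.+2%:R :> R by rewrite ltr0n.
rewrite -subr_ge0 (_ : _ - _ = m%:R * m.+1%:R^-1 ^+ 2 * m.+2%:R^-1).
  by apply: mulr_ge0; [apply: mulr_ge0; [|exact: sqr_ge0]|rewrite invr_ge0].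
rewrite -[m.+2%:R]natr1 -[m.+1%:R]natr1 in a0 b0 *.
by field; rewrite !gt_eqF.
Qed.

End inverse_squares.

Section laplace_stability.
Context {R : realType}.

(** Passage from square-mean approximations of [x] to [x] itself. *)
Lemma empirical_laplace_cvg (x : nat -> R) (y : nat -> nat -> R) (eps : nat -> R) (s c : R) :
  0 <= s -> eps M @[M --> \oo] --> (0 : R) ->
  (forall M, \forall n \near \oo, \sum_(j < n) (x j - y M j) ^+ 2 <= n%:R * eps M) ->
  (forall M, empirical_laplace n s (y M) @[n --> \oo] --> c) ->
  empirical_laplace n s x @[n --> \oo] --> c.
Proof.
move=> s0 eps0 xy yc; apply/cvgrPdist_le => e e0.
have s1 : 0 < s + 1 by rewrite ltr_wpDl.
pose h := e / 3 / (s + 1).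
have h0 : 0 < h by rewrite !divr_gt0.
have hE : (s + 1) * h = e / 3 by rewrite mulrC divfK// gt_eqF.
have e2 : 0 < h * h by exact: mulr_gt0.
have /cvgrPdist_le/(_ _ e2)[M _ /(_ M (leqnn M)) HM] := eps0.
have {}HM : eps M <= h * h by move: HM; rewrite /= sub0r normrN => /(le_trans (ler_norm _)).
have e3 : 0 < e / 3 by rewrite divr_gt0.
have /cvgrPdist_le/(_ _ e3) yce := yc M.
have [n0 _ xyn] := xy M.
near=> n.
have H1 : `|c - empirical_laplace n s (y M)| <= e / 3 by near: n.
have H2 : \sum_(j < n.+1) (x j - y M j) ^+ 2 <= n.+1%:R * eps M.
  apply: xyn => /=; apply: leqW; near: n; exact: nbhs_infty_ge.
have H3 := empirical_laplace_lipschitz n s0 x (y M) h0.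
have H4 : (s + 1) * (h + h^-1 * (n.+1%:R^-1 * \sum_(j < n.+1) (x j - y M j) ^+ 2)) <= 2 * (e / 3).
  rewrite -hE [leRHS]mulrCA ler_pM2l// [2 * h]mulr_natl mulr2n lerD2l.
  rewrite ler_pdivrMl// ler_pdivrMl ?ltr0n//.
  by apply: le_trans H2 _; rewrite ler_pM2l ?ltr0n.
have H5 := le_trans H3 H4.
rewrite (_ : c - _ = (c - empirical_laplace n s (y M)) -
  (empirical_laplace n s x - empirical_laplace n s (y M))); last by ring.
by apply: le_trans (ler_normB _ _) _; lra.
Unshelve. all: by end_near. Qed.

End laplace_stability.

Section almost_sure_limit.
Context {d : measure_display} {T : measurableType d} {R : realType}.
Variable P : probability T R.
Variable l : nat -> {RV P >-> R}.
Hypothesis l_ind : mutually_independent l.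
Hypothesis l_id : identically_distributed l.

Lemma empirical_laplace_truncate n (s : R) x :
  empirical_laplace n s (truncate n.+1 x) = empirical_laplace n s x.
Proof.
congr (_ * _); apply: eq_bigr => k _.
by rewrite /sq_modulus !lin_form_truncate.
Qed.

(* Finitely many values: the fourth moments are summable in n. *)
Let discrete_laplace_cvg (f : R -> R) (V : seq R) (s : R) : 0 <= s ->
  measurable_fun setT f -> uniq V -> (forall x, f x \in V) ->
  \int[P]_t (f (l 0%N t)) = 0 -> \int[P]_t (f (l 0%N t) ^+ 2) = 1 ->
  {ae P, forall t,
    empirical_laplace n s (fun j => f (l j t)) @[n --> \oo] --> (1 + s)^-1}.
Proof.
move=> s0 mf uV fV meanf varf.
pose K : R := \sum_(v <- V) `|v|.
have K0 : 0 <= K by apply: sumr_ge0.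
have VK v : v \in V -> `|v| <= K.
  by move=> vV; rewrite /K (bigD1_seq v)//= lerDl; apply: sumr_ge0.
pose Km Q : R := (1 + K) ^+ Q.*2.
have ml0 : measurable_fun setT (l 0%N) by exact: measurable_funP.
have bint (g : R -> R) (B : R) : measurable_fun setT g -> (forall x, `|g (f x)| <= B) ->
    P.-integrable setT (EFin \o (fun t => g (f (l 0%N t)))).
  move=> mg gB; apply: (integrable_bounded P (M := B)) => //.
  by apply: (measurableT_comp mg); exact: measurableT_comp.
have same (g : R -> R) (B : R) j : measurable_fun setT g -> (forall x, `|g (f x)| <= B) ->
    \int[P]_t (g (f (l j t))) = \int[P]_t (g (f (l 0%N t))).
  move=> mg gB; have mgf : measurable_fun setT (g \o f) by exact: measurableT_comp.
  exact: (identically_distributed_integral j l_id mgf (bint g B mg gB)).2.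
have fK x : `|f x| <= K by exact: VK.
have law_std : standard_laws Km (fun=> V) (law P (fun j t => f (l j t))).
  apply: (@discretized_standard_laws _ _ _ P l (fun=> f) (fun=> V) Km) => //.
  - by move=> j; rewrite (same id K).
  - move=> j; rewrite (same (fun x => x ^+ 2) (K ^+ 2))// => x.
    by rewrite normrX; apply: lerXn2r; rewrite ?nnegrE.
  - move=> Q j i iQ; rewrite -(Rintegral_cst1 P (Km Q)).
    have fi t : `|f (l j t)| ^+ i <= Km Q.
      apply: (@le_trans _ _ ((1 + K) ^+ i)).
        by apply: lerXn2r; rewrite ?nnegrE ?addr_ge0//; apply: le_trans (fK _) _; rewrite lerDr.
      by apply: ler_weXn2l => //; rewrite lerDl.
    apply: le_Rintegral => //; last exact: integrable_cst.
    apply: (integrable_bounded P (M := Km Q)) => [|t]; last by rewrite ger0_norm ?exprn_ge0.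
    apply: measurable_funX; apply: measurableT_comp => //.
    by apply: measurableT_comp => //; exact: measurable_funP.
have [C [C0 HC]] := laplace_fourth_moment Km K0 s0.
pose F n x := (empirical_laplace n s x - (1 + s)^-1) ^+ 4.
have FT n x : F n (truncate n.+1 x) = F n x by rewrite /F empirical_laplace_truncate.
have FP n := @discretized_mean _ _ _ P l l_ind (fun=> f) (fun=> V) (fun=> mf) (fun=> uV)
  (fun=> fV) n.+1 (F n) (FT n).
have : {ae P, forall t, F n (fun j => f (l j t)) @[n --> \oo] --> (0 : R)}.
  apply: (@ae_cvg0_of_summable _ _ _ P _ (2 * C)).
  - by move=> n; have /integrableP[/measurable_EFinP] := (FP n).1.
  - by move=> n t; exact: exprn_even_ge0.
  - by move=> n; exact: (FP n).1.
  - move=> m; under eq_bigr do rewrite (FP _).2.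
    apply: (@le_trans _ _ (C * \sum_(k < m) k.+1%:R^-1 ^+ 2)).
      rewrite big_distrr /=; apply: ler_sum => k _.
      by apply: HC => // j v; exact: VK.
    rewrite mulrC ler_wpM2r//; apply: le_trans (sum_inverse_squares m) _.
    by rewrite gerBl mulr_ge0.
apply: filterS => t Ft; apply/cvgrPdist_le => e e0.
have e4 : 0 < e ^+ 4 by exact: exprn_gt0.
have /cvgrPdist_le/(_ _ e4) := Ft; apply: filterS => n.
rewrite sub0r normrN /F normrX distrC => H.
by rewrite -(@ler_pXn2r _ 4) ?nnegrE ?(ltW e0).
Qed.

Hypothesis iX : P.-integrable setT (EFin \o l 0%N).
Hypothesis iX2 : P.-integrable setT (EFin \o (fun t => l 0%N t ^+ 2)).
Hypothesis meanX : \int[P]_t (l 0%N t) = 0.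
Hypothesis varX : \int[P]_t (l 0%N t ^+ 2) = 1.

(** The discretized entries [psi M (l j)] are within [6 eps M] of the [l j] in mean
    square over [j < n], almost surely for large [n], by [ae_average_le] applied to
    [(x - psi M x)^2 / eps M].  Countably many null sets, for the integers [s] and
    [M], are discarded. *)
Lemma ae_empirical_laplace_cvg :
  {ae P, forall t, forall s : nat,
    empirical_laplace n s%:R (fun j => l j t) @[n --> \oo] --> (1 + s%:R : R)^-1}.
Proof.
have ml0 : measurable_fun setT (l 0%N) by exact: measurable_funP.
have [psi [V psiP]] := finite_approximation ml0 iX iX2 meanX varX.
have mpsi M : measurable_fun setT (psi M) by have [[]] := psiP M.
pose y M x := (x - psi M x) ^+ 2.
have my M : measurable_fun setT (y M).
  by apply: measurable_funX; apply: measurable_funB.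
have y_ge0 M x : 0 <= y M x by exact: sqr_ge0.
pose D (t : T) := 18 * l 0%N t ^+ 2 + 72.
have iD : P.-integrable setT (EFin \o D).
  by apply: integrable_add; [exact: integrable_scale|exact: integrable_cst].
have yD M t : `|y M (l 0%N t)| <= D t.
  rewrite ger0_norm// /y /D; have [_ _ _ b _] := psiP M.
  have {}b := b (l 0%N t).
  have H : `|l 0%N t - psi M (l 0%N t)| <= 3 * `|l 0%N t| + 6.
    by apply: le_trans (ler_normB _ _) _; lra.
  rewrite -(real_normK (num_real (_ - _))) -(real_normK (num_real (l 0%N t))).
  apply: (@le_trans _ _ ((3 * `|l 0%N t| + 6) ^+ 2)).
    by apply: lerXn2r; rewrite ?nnegrE//; apply: addr_ge0 => //; apply: mulr_ge0.
  rewrite -subr_ge0 (_ : _ - _ = 9 * (`|l 0%N t| - 2) ^+ 2); last by ring.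
  by apply: mulr_ge0 => //; exact: sqr_ge0.
have myl M : measurable_fun setT (fun t => y M (l 0%N t)) by exact: measurableT_comp.
have iy M : P.-integrable setT (EFin \o (fun t => y M (l 0%N t))).
  exact: le_integrable_real (myl M) (yD M) iD.
pose eps M := \int[P]_t (y M (l 0%N t)) + M.+1%:R^-1.
have eps_gt0 M : 0 < eps M.
  by apply: ltr_wpDl; [apply: Rintegral_ge0|rewrite invr_gt0].
have eps0 : eps M @[M --> \oo] --> (0 : R).
  rewrite -[X in _ --> X]addr0; apply: cvgD; last exact: cvg_harmonic.
  rewrite -(Rintegral_cst1 P 0).
  apply: (Rintegral_dominated (g := D)) => //.
  have E0 : (0 : R) = 0 ^+ 2 by rewrite expr0n.
  move=> t; rewrite /y [X in _ --> X]E0.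
  apply: (@cvg_comp _ _ _ _ (fun z : R => z ^+ 2) _ (nbhs (0 : R))); last exact: exprn_continuous.
  rewrite -(subrr (l 0%N t)); apply: cvgB; first exact: cvg_cst.
  by have [_ _ _ _] := psiP 0%N; exact.
have A1 : {ae P, forall t, forall M, \forall n \near \oo,
    \sum_(j < n) (l j t - psi M (l j t)) ^+ 2 <= n%:R * (6 * eps M)}.
  apply: ae_foralln => M.
  have mz : measurable_fun setT (fun x => y M x / eps M).
    by apply: measurable_funM.
  have z0 x : 0 <= y M x / eps M by apply: divr_ge0 => //; exact: ltW.
  have iz : P.-integrable setT (EFin \o (fun t => y M (l 0%N t) / eps M)).
    by under eq_fun do rewrite mulrC; exact: integrable_scale.
  have z1 : \int[P]_t (y M (l 0%N t) / eps M) <= 1.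
    rewrite RintegralZr// ler_pdivrMr// mul1r lerDl invr_ge0.
    exact: ler0n.
  have := ae_average_le l_ind l_id mz z0 iz z1.
  apply: filterS => t; apply: filterS => n.
  rewrite -big_distrl /= ler_pdivrMr// => H; apply: le_trans H _.
  by rewrite mulrAC mulrC.
have A2 : {ae P, forall t, forall s M : nat,
    empirical_laplace n s%:R (fun j => psi M (l j t)) @[n --> \oo] --> (1 + s%:R : R)^-1}.
  apply: ae_foralln => s; apply: ae_foralln => M.
  have [[mM uM VM] E0 E1 _ _] := psiP M.
  exact: discrete_laplace_cvg (ler0n _ s) mM uM VM E0 E1.
apply: filterS2 A1 A2 => t H1 H2 s.
apply: (@empirical_laplace_cvg _ (fun j => l j t) (fun M j => psi M (l j t)) (fun M => 6 * eps M)).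
- exact: ler0n.
- by rewrite -[X in _ --> X](mulr0 6); apply: cvgM; [exact: cvg_cst|].
- exact: H1.
- exact: H2.
Qed.

Lemma ae_esd_weak_cvg :
  {ae P, forall t, weak_cvg
    (fun n => esd ((Num.sqrt n.+1%:R)^-1 *: LScirc n.+1 (fun j => l j t))) rayleigh}.
Proof.
by apply: filterS ae_empirical_laplace_cvg => t H; exact: esd_weak_cvg.
Qed.

End almost_sure_limit.

(** * Convergence of the moments *)

Section moment_limits.
Context {d : measure_display} {T : measurableType d} {R : realType}.
Variable P : probability T R.

Lemma sup_moments (l : nat -> {RV P >-> R}) :
  (forall k : nat, (1 <= k)%N ->
    (ereal_sup (range (fun j => 'E_P[fun t => (`|l j t| ^+ k)%R])) < +oo)%E) ->
  forall k, exists B : R, forall j,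
    P.-integrable setT (EFin \o (fun t => `|l j t| ^+ k)) /\
    \int[P]_t (`|l j t| ^+ k) <= B.
Proof.
move=> supl [|k].
  by exists 1 => j; split; [exact: integrable_cst|rewrite Rintegral_cst1].
have := supl k.+1 isT; set S := ereal_sup _ => Soo.
have le_S j : (\int[P]_t (`|l j t| ^+ k.+1)%:E <= S)%E.
  by rewrite -expectation_real; apply: ereal_sup_ubound; exists j.
have int0 j : (0 <= \int[P]_t (`|l j t| ^+ k.+1)%:E)%E.
  by apply: integral_ge0 => t _; rewrite lee_fin.
have Sfin : S \is a fin_num.
  by rewrite ge0_fin_numE//; exact: le_trans (int0 0%N) (le_S 0%N).
exists (fine S) => j; have mj : measurable_fun setT (fun t => `|l j t| ^+ k.+1).
  by apply: measurable_funX; apply: measurableT_comp.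
have ij : P.-integrable setT (EFin \o (fun t => `|l j t| ^+ k.+1)).
  apply/integrableP; split; first exact/measurable_EFinP.
  under eq_integral => t _ do rewrite /= ger0_norm ?exprn_ge0//.
  exact: le_lt_trans (le_S j) Soo.
split => //; rewrite /Rintegral fine_le//.
exact: (integrable_fin_num measurableT ij).
Qed.

Lemma normc_real (x : R) : Normc.normc (real_complex R x) = `|x|.
Proof. by rewrite /= expr0n addr0 sqrtr_sqr. Qed.

Lemma all_moments_real (f : T -> R) : measurable_fun setT f ->
  (forall k, P.-integrable setT (EFin \o (fun t => `|f t| ^+ k))) ->
  all_moments P (fun t => real_complex R (f t)).
Proof.
move=> mf intf; split; first by split; [exact: mf|exact: measurable_cst].
by move=> k; have := intf k; congr (integrable _ _ _); apply/funext => t; rewrite normc_real.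
Qed.

Lemma integrable_normX (f : T -> R) k :
  all_moments P (fun t => real_complex R (f t)) ->
  P.-integrable setT (EFin \o (fun t => `|f t| ^+ k)).
Proof.
by case=> _ /(_ k); congr (integrable _ _ _); apply/funext => t; rewrite normc_real.
Qed.

Lemma pow_1D_le (a : R) n : 0 <= a -> (1 + a) ^+ n <= 2 ^+ n * (1 + a ^+ n).
Proof.
move=> a0; have [a1|a1] := leP a 1.
  apply: (@le_trans _ _ (2 ^+ n)); first by apply: lerXn2r; rewrite ?nnegrE; lra.
  by rewrite ler_peMr ?exprn_ge0// lerDl exprn_ge0.
apply: (@le_trans _ _ ((2 * a) ^+ n)); first by apply: lerXn2r; rewrite ?nnegrE; lra.
by rewrite exprMn ler_wpM2l ?exprn_ge0// lerDr.
Qed.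

Variable l : nat -> {RV P >-> R}.
Hypothesis l_ind : mutually_independent l.
Hypothesis iX : forall j, P.-integrable setT (EFin \o l j).
Hypothesis iX2 : forall j, P.-integrable setT (EFin \o (fun t => l j t ^+ 2)).
Hypothesis meanX : forall j, \int[P]_t (l j t) = 0.
Hypothesis varX : forall j, \int[P]_t (l j t ^+ 2) = 1.
Variable B : nat -> R.
Hypothesis momX : forall k j, P.-integrable setT (EFin \o (fun t => `|l j t| ^+ k)) /\
    \int[P]_t (`|l j t| ^+ k) <= B k.

(* From (2a + 6)^i <= 14^(2Q) (1 + a^(2Q)) for i <= 2Q. *)
Let Km Q : R := 14 ^+ Q.*2 * (1 + B Q.*2).

Let ml j : measurable_fun setT (l j). Proof. exact: measurable_funP. Qed.

Let all_l j : all_moments P (fun t => real_complex R (l j t)).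
Proof. by apply: all_moments_real => // k; exact: (momX k j).1. Qed.

Let envelope n t : R := \sum_(j < n) (2 * `|l j t| + 6).

Let envelope_moments n : all_moments P (fun t => real_complex R (envelope n t)).
Proof.
have H (j : 'I_n) : all_moments P (fun t => real_complex R 2 * real_complex R `|l j t| + real_complex R 6).
  apply: all_momentsD; last exact: all_moments_cst.
  apply: all_momentsM; first exact: all_moments_cst.
  apply: all_moments_real => [|k]; first exact: measurableT_comp.
  by under eq_fun do rewrite normr_id; exact: (momX k j).1.
have := all_moments_sum H; congr all_moments; apply/funext => t.
by rewrite rmorph_sum; apply: eq_bigr => j _; rewrite [RHS]rmorphD [X in _ = X + _]rmorphM.
Qed.

Let sq_modulus_envelope n c s (x : nat -> R) t : (0 < n)%N ->
  (forall j, c j ^+ 2 + s j ^+ 2 = n%:R^-1) ->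
  (forall j, `|x j| <= 2 * `|l j t| + 6) ->
  sq_modulus n c s x <= 2 * envelope n t ^+ 2.
Proof.
move=> n0 cs xl.
have nV1 : n%:R^-1 <= 1 :> R by rewrite invf_le1 ?ler1n ?ltr0n.
have lin (b b' : nat -> R) : (forall j, b j ^+ 2 + b' j ^+ 2 = n%:R^-1) ->
    lin_form b n x ^+ 2 <= envelope n t ^+ 2.
  move=> bb; have b1 j : `|b j| <= 1.
    rewrite -(@ler_pXn2r _ 2) ?nnegrE// expr1n real_normK ?num_real//.
    by have := bb j; have := sqr_ge0 (b' j); lra.
  rewrite -[_ ^+ 2]real_normK ?num_real//; apply: lerXn2r; rewrite ?nnegrE//.
    by apply: sumr_ge0 => j _; apply: addr_ge0 => //; apply: mulr_ge0.
  apply: le_trans (ler_norm_sum _ _ _) _; apply: ler_sum => j _.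
  by rewrite normrM; apply: le_trans (xl j); rewrite ler_piMl.
rewrite /sq_modulus mulr_natl mulr2n; apply: lerD.
  exact: lin cs.
by apply: (lin s c) => j; rewrite addrC.
Qed.

(** A bound for all finite-valued standard laws passes to [l]: approximate each
    [l j] by finite-valued variables and use dominated convergence. *)
Let transfer n c s m (a b : R) : (0 < n)%N ->
  (forall j, c j ^+ 2 + s j ^+ 2 = n%:R^-1) ->
  (forall V w, standard_laws Km V w ->
    `|prod_mean V w n (fun x => sq_modulus n c s x ^+ m) - a| <= b) ->
  P.-integrable setT (EFin \o (fun t => sq_modulus n c s (fun j => l j t) ^+ m)) /\
  `|\int[P]_t (sq_modulus n c s (fun j => l j t) ^+ m) - a| <= b.
Proof.
move=> n0 cs HVw.
have approx j := finite_approximation (ml j) (iX j) (iX2 j) (meanX j) (varX j).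
have {approx}[psi approx] := choice approx.
have {approx}[V psiP] := choice approx.
have mpsi j M : measurable_fun setT (psi j M) by have [[]] := psiP j M.
have psi_le j M x : `|psi j M x| <= 2 * `|x| + 6 by have [_ _ _] := psiP j M; exact.
pose G t := 2 ^+ m * `|envelope n t| ^+ (2 * m).
have iG : P.-integrable setT (EFin \o G).
  by apply: integrable_scale; exact: integrable_normX.
have le_G (x : nat -> R) t : (forall j, `|x j| <= 2 * `|l j t| + 6) ->
    `|sq_modulus n c s x ^+ m| <= G t.
  move=> xl; rewrite ger0_norm; last by apply: exprn_ge0; exact: sq_modulus_ge0.
  rewrite /G exprM -exprMn real_normK ?num_real//.
  by apply: lerXn2r; rewrite ?nnegrE; [exact: sq_modulus_ge0|apply: mulr_ge0 => //; exact: sqr_ge0|exact: sq_modulus_envelope].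
have momf M Q j i : (i <= Q.*2)%N -> \int[P]_t (`|psi j M (l j t)| ^+ i) <= Km Q.
  move=> iQ; pose H t := 14 ^+ Q.*2 * (1 + `|l j t| ^+ Q.*2).
  have iH : P.-integrable setT (EFin \o H).
    by apply: integrable_scale; apply: integrable_add; [exact: integrable_cst|exact: (momX _ j).1].
  have psiH t : `|psi j M (l j t)| ^+ i <= H t.
    apply: (@le_trans _ _ ((7 * (1 + `|l j t|)) ^+ i)).
      apply: lerXn2r; rewrite ?nnegrE//.
      by apply: le_trans (psi_le j M _) _; have := normr_ge0 (l j t); lra.
    apply: (@le_trans _ _ ((7 * (1 + `|l j t|)) ^+ Q.*2)).
      by apply: ler_weXn2l => //; have := normr_ge0 (l j t); lra.
    rewrite exprMn /H (_ : 14 = 7 * 2 :> R); last by rewrite -natrM.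
    by rewrite [(7 * 2) ^+ _]exprMn -mulrA ler_wpM2l ?exprn_ge0// pow_1D_le.
  have mpl : measurable_fun setT (fun t => `|psi j M (l j t)| ^+ i).
    by apply: measurable_funX; apply: measurableT_comp => //; exact: measurableT_comp.
  apply: (@le_trans _ _ (\int[P]_t H t)).
    apply: le_Rintegral => //; apply: (le_integrable_real mpl _ iH) => t.
    by rewrite ger0_norm ?exprn_ge0.
  rewrite RintegralZl//; last by apply: integrable_add; [exact: integrable_cst|exact: (momX _ j).1].
  rewrite RintegralD//; [|exact: integrable_cst|exact: (momX _ j).1].
  by rewrite Rintegral_cst1 ler_wpM2l ?exprn_ge0// lerD2l; exact: (momX _ j).2.
pose f0 t := sq_modulus n c s (fun j => l j t) ^+ m.
pose f M t := sq_modulus n c s (fun j => psi j M (l j t)) ^+ m.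
have FT x : sq_modulus n c s (truncate n x) ^+ m = sq_modulus n c s x ^+ m.
  by rewrite /sq_modulus !lin_form_truncate.
have fP M : P.-integrable setT (EFin \o f M) /\ `|\int[P]_t (f M t) - a| <= b.
  have uV j : uniq (V j M) by have [[]] := psiP j M.
  have psiV j x : psi j M x \in V j M by have [[]] := psiP j M.
  have E0 j : \int[P]_t (psi j M (l j t)) = 0 by have [] := psiP j M.
  have E1 j : \int[P]_t (psi j M (l j t) ^+ 2) = 1 by have [] := psiP j M.
  have std := @discretized_standard_laws _ _ _ P l (psi^~ M) (V^~ M) Km (mpsi^~ M) uV psiV E0 E1 (momf M).
  have [? ->] := @discretized_mean _ _ _ P l l_ind (psi^~ M) (V^~ M) (mpsi^~ M) uV psiV n
    (fun x => sq_modulus n c s x ^+ m) FT.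
  by split => //; exact: HVw.
have mf M : measurable_fun setT (f M) by have /integrableP[/measurable_EFinP] := (fP M).1.
have lin_cvg (e : nat -> R) t : lin_form e n (fun j => psi j M (l j t)) @[M --> \oo] -->
    lin_form e n (fun j => l j t).
  apply: cvg_big => [|j _]; first exact: add_continuous.
  apply: cvgM; first exact: cvg_cst.
  by have [_ _ _ _] := psiP j 0%N; exact.
have f_cvg t : f^~ t @ \oo --> f0 t.
  apply: (@cvg_comp _ _ _ _ (fun z : R => z ^+ m) _ (nbhs (sq_modulus n c s (fun j => l j t))));
    last exact: exprn_continuous.
  by apply: cvgD; apply: (@cvg_comp _ _ _ _ (fun z : R => z ^+ 2) _ (nbhs (lin_form _ n (fun j => l j t))));
    [exact: lin_cvg|exact: exprn_continuous|exact: lin_cvg|exact: exprn_continuous].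
have mf0 : measurable_fun setT f0 by apply: measurable_fun_cvg mf _ => t _; exact: f_cvg.
split.
  by apply: le_integrable_real mf0 _ iG => t; apply: le_G => j; have := normr_ge0 (l j t); lra.
have Df : \int[P]_t (f M t) @[M --> \oo] --> \int[P]_t (f0 t).
  by apply: (Rintegral_dominated mf mf0 f_cvg iG) => M t; exact: le_G.
have Da : `|\int[P]_t (f M t) - a| @[M --> \oo] --> `|\int[P]_t (f0 t) - a|.
  by apply: cvg_norm; apply: cvgB; [exact: Df|exact: cvg_cst].
apply: (@ler_cvg_to _ _ _ _ _ (fun=> b) _ _ Da); first exact: cvg_cst.
by apply: nearW => M; exact: (fP M).2.
Qed.

Let r n k t := sq_modulus n.+1 (frame_cos n k) (frame_sin n k) (fun j => l j t).

Lemma frame_moment_le m : exists C : R, 0 <= C /\ forall n k,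
  P.-integrable setT (EFin \o (fun t => r n k t ^+ m)) /\
  \int[P]_t (r n k t ^+ m) <= C.
Proof.
exists `|moment_const Km m|; split => // n k.
have [|ir] := @transfer n.+1 (frame_cos n k) (frame_sin n k) m 0 `|moment_const Km m| (ltn0Sn n) (frame_norm n k).
  move=> V w std; have [w0 w1 _ _ _] := std; rewrite subr0 ger0_norm.
    exact: le_trans (@sq_modulus_moment_le _ Km V w n.+1 _ _ m std (ltn0Sn n) (frame_norm n k)) (ler_norm _).
  by apply: prod_mean_ge0 => // x; apply: exprn_ge0; exact: sq_modulus_ge0.
by rewrite subr0 => /(le_trans (ler_norm _)).
Qed.

Lemma frame_moment_factorial m : exists C : R, 0 <= C /\ forall n k,
  (k < n.+1)%N -> k.*2.+1 != n.+1 ->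
  `|\int[P]_t (r n k t ^+ m) - m`!%:R| <= C * Num.sqrt n.+1%:R^-1.
Proof.
have [C [C0 HC]] := sq_modulus_moment_factorial Km m.
exists C; split => // n k kn kn2.
have [|//] := @transfer n.+1 (frame_cos n k) (frame_sin n k) m m`!%:R
  (C * Num.sqrt n.+1%:R^-1) (ltn0Sn n) (frame_norm n k).
by move=> V w std; apply: HC => //; exact: frame_circular.
Qed.

Let trace n p t : R := \tr (((Num.sqrt n.+1%:R)^-1 *: LScirc n.+1 (fun j => l j t)) ^+ p).

Let cvg_error (a b : R) :
  a * Num.sqrt n.+1%:R^-1 + b * n.+1%:R^-1 @[n --> \oo] --> (0 : R).
Proof.
have h0 : n.+1%:R^-1 @[n --> \oo] --> (0 : R) by exact: cvg_harmonic.
rewrite -[X in _ --> X]addr0; apply: cvgD.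
  rewrite -[X in _ --> X](mulr0 a); apply: cvgM; first exact: cvg_cst.
  rewrite -[X in _ --> X](@sqrtr0 R).
  by apply: (cvg_comp _ Num.sqrt h0); exact: sqrt_continuous.
by rewrite -[X in _ --> X](mulr0 b); apply: cvgM; [exact: cvg_cst|exact: h0].
Qed.

Let cvg_of_error (u : nat -> R) (c a b : R) :
  (forall n, `|u n - c| <= a * Num.sqrt n.+1%:R^-1 + b * n.+1%:R^-1) ->
  u n @[n --> \oo] --> c.
Proof.
move=> uc; apply/cvgrPdist_le => e e0.
have /cvgrPdist_le/(_ _ e0) := cvg_error a b; apply: filterS => n.
rewrite sub0r normrN => /(le_trans (ler_norm _)) H.
by rewrite distrC; apply: le_trans (uc n) H.
Qed.

Lemma mean_even_trace_cvg q :
  \int[P]_t (n.+1%:R^-1 * trace n (2 * q) t) @[n --> \oo] --> (q`!%:R : R).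
Proof.
have [C [C0 HC]] := frame_moment_le q; have [K [K0 HK]] := frame_moment_factorial q.
apply: (@cvg_of_error _ _ K (C + q`!%:R)) => n.
have -> : \int[P]_t (n.+1%:R^-1 * trace n (2 * q) t) =
    n.+1%:R^-1 * \sum_(k < n.+1) \int[P]_t (r n k t ^+ q).
  under eq_Rintegral do rewrite /trace trace_even_power.
  rewrite RintegralZl//; last by apply: integrable_bigsum => k; exact: (HC n k).1.
  by rewrite Rintegral_bigsum// => k; exact: (HC n k).1.
apply: (@average_except_middle R n (fun k => \int[P]_t (r n k t ^+ q))); first exact: addr_ge0.
  by move=> k kn kn2; exact: HK.
move=> k _; apply: le_trans (_ : _ <= C + q`!%:R) _; last first.
  by rewrite lerDr; apply: mulr_ge0 => //; exact: sqrtr_ge0.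
apply: le_trans (ler_normB _ _) _; apply: lerD; last by rewrite ger0_norm.
rewrite ger0_norm; first exact: (HC n k).2.
by apply: Rintegral_ge0 => t _; apply: exprn_ge0; exact: sq_modulus_ge0.
Qed.

Lemma mean_odd_trace_cvg q :
  \int[P]_t (n.+1%:R^-1 * trace n (2 * q).+1 t) @[n --> \oo] --> (0 : R).
Proof.
have [C [C0 HC]] := frame_moment_le q; have [K [K0 HK]] := frame_moment_le q.+1.
apply: (@cvg_of_error _ _ 0 (C + K)) => n; rewrite mul0r.
pose v k t := r n k t ^+ q * trace_defect n (fun j => l j t) k.
have r0 k t : 0 <= r n k t by exact: sq_modulus_ge0.
have v_le k t : `|v k t| <= r n k t ^+ q + r n k t ^+ q.+1.
  rewrite normrM ger0_norm ?exprn_ge0// exprSr -{2}[_ ^+ q]mulr1 -mulrDr.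
  apply: ler_wpM2l; first exact: exprn_ge0.
  have := trace_defect_le n (fun j => l j t) k; have := r0 k t.
  rewrite -[X in X <= 4 * _ -> _]real_normK ?num_real// /r.
  move: (sq_modulus _ _ _ _) `|_| (normr_ge0 (trace_defect n (fun j => l j t) k)) => a b b0 a0 ba.
  by rewrite leNgt; apply/negP => H; have := sqr_ge0 (1 - a); nra.
have mlin (c : nat -> R) : measurable_fun setT (fun t => lin_form c n.+1 (fun j => l j t)).
  by apply: measurable_sum => j; apply: measurable_funM.
have mv k : measurable_fun setT (v k).
  apply: measurable_funM; first by have /integrableP[/measurable_EFinP] := (HC n k).1.
  apply: measurable_funD; first by apply: measurable_funM.
  by apply: measurable_funM => //; apply: measurable_funM.
have ib k : P.-integrable setT (EFin \o (fun t => r n k t ^+ q + r n k t ^+ q.+1)).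
  by apply: integrable_add; [exact: (HC n k).1|exact: (HK n k).1].
have iv k : P.-integrable setT (EFin \o v k) := le_integrable_real (mv k) (v_le k) (ib k).
have -> : \int[P]_t (n.+1%:R^-1 * trace n (2 * q).+1 t) =
    n.+1%:R^-1 * \sum_(k < n.+1) \int[P]_t (v k t).
  under eq_Rintegral do rewrite /trace trace_odd_power.
  rewrite RintegralZl//; last by apply: integrable_bigsum => k; exact: iv.
  by rewrite Rintegral_bigsum// => k; exact: iv.
apply: (@average_except_middle R n (fun k => \int[P]_t (v k t))); first exact: addr_ge0.
  move=> k kn kn2; rewrite subr0 /v.
  under eq_Rintegral do rewrite trace_defect_eq0// mulr0.
  by rewrite Rintegral_cst1 normr0.
move=> k _; rewrite subr0 add0r.
apply: le_trans (le_normr_Rintegral _ (iv k)) _ => //.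
apply: (@le_trans _ _ (\int[P]_t (r n k t ^+ q + r n k t ^+ q.+1))).
  apply: le_Rintegral => //; exact: (integrable_norm (iv k)).
rewrite RintegralD//; [|exact: (HC n k).1|exact: (HK n k).1].
by apply: lerD; [exact: (HC n k).2|exact: (HK n k).2].
Qed.

Lemma mean_trace_cvg p :
  \int[P]_t (n.+1%:R^-1 * trace n p t) @[n --> \oo] -->
  (if odd p then 0 else p./2`!%:R : R).
Proof.
case: ifP => op.
  have -> : p = (2 * p./2).+1 by rewrite -[LHS]odd_double_half op mul2n.
  exact: mean_odd_trace_cvg.
rewrite -{1}[p]odd_double_half op add0n -mul2n.
exact: mean_even_trace_cvg.
Qed.

End moment_limits.

(** * Non-commutative probability spaces *)

Section moment_functional.
Variables (C : numClosedFieldType) (mom : nat -> C).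

(** The law of a single self-adjoint variable, given by its moments. *)
Definition moment_functional (p : {poly C}) : C := \sum_(i < size p) p`_i * mom i.

Lemma moment_functional_widen m (p : {poly C}) : (size p <= m)%N ->
  moment_functional p = \sum_(i < m) p`_i * mom i.
Proof.
move=> pm; rewrite /moment_functional (big_ord_widen m (fun i => p`_i * mom i) pm).
rewrite big_mkcond; apply: eq_bigr => i _.
by case: ltnP => // /(nth_default 0) ->; rewrite mul0r.
Qed.

Let moment_functional_scalar : scalar moment_functional.
Proof.
move=> a p q; pose m := maxn (size p) (size q).
have sm : (size (a *: p + q)%R <= m)%N.
  apply: leq_trans (size_polyD _ _) _; rewrite geq_max leq_maxr andbT.
  by apply: leq_trans (size_scale_leq _ _) _; exact: leq_maxl.
rewrite (moment_functional_widen sm) (moment_functional_widen (leq_maxl _ _ : size p <= m)%N).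
rewrite (moment_functional_widen (leq_maxr _ _ : size q <= m)%N) mulr_sumr -big_split.
by apply: eq_bigr => i _; rewrite coefD coefZ mulrDl mulrA.
Qed.

HB.instance Definition _ :=
  GRing.isLinear.Build C {poly C} C _ moment_functional moment_functional_scalar.

Lemma moment_functionalXn m : moment_functional 'X^m = mom m.
Proof.
rewrite /moment_functional size_polyXn big_ord_recr /= coefXn eqxx mul1r.
by rewrite big1 ?add0r// => i _; rewrite coefXn ltn_eqF// mul0r.
Qed.

Definition poly_star (p : {poly C}) : {poly C} := map_poly Num.conj p.

Let poly_starK : involutive poly_star.
Proof. by move=> p; apply/polyP => i; rewrite !coef_map /= conjCK. Qed.

Let poly_starD : {morph poly_star : p q / p + q}.
Proof. by move=> p q; exact: rmorphD. Qed.

Let poly_starM p q : poly_star (p * q) = poly_star q * poly_star p.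
Proof. by rewrite mulrC; exact: rmorphM. Qed.

Let poly_starZ c p : poly_star (c *: p) = c^* *: poly_star p.
Proof. by rewrite /poly_star map_polyZ. Qed.

Hypothesis mom0 : mom 0%N = 1.

Let moment_functional1 : moment_functional 1 = 1.
Proof. by rewrite -(expr0 'X) moment_functionalXn mom0. Qed.

Definition poly_ncp : ncp C :=
  @NCP C {poly C} poly_star poly_starK poly_starD poly_starM poly_starZ
    moment_functional moment_functional1.

Lemma poly_star_X : @star C poly_ncp ('X : {poly C}) = 'X.
Proof. exact: map_polyX. Qed.

Lemma poly_phi_Xn m : @phi C poly_ncp (('X : {poly C}) ^+ m) = mom m.
Proof. exact: moment_functionalXn. Qed.

End moment_functional.

Lemma star_monomial_self_adjoint (C : numClosedFieldType) (A : ncp C) (a : A) Q :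
  star a = a -> star_monomial a Q = a ^+ size Q.
Proof.
move=> aa; rewrite /star_monomial; elim: Q => [|b Q IH]; first by rewrite big_nil.
by rewrite big_cons IH aa if_same exprS.
Qed.

Lemma real_complex_cvg (R : realType) (u : nat -> R) (a : R) :
  u n @[n --> \oo] --> a ->
  (real_complex R (u n) : (R[i] : numClosedFieldType)) @[n --> \oo] -->
  (real_complex R a : (R[i] : numClosedFieldType)).
Proof.
move=> ua; apply/cvgrPdist_le => -[e e']; rewrite ltcE /= => /andP[/eqP -> e0].
have /cvgrPdist_le/(_ _ e0) := ua; apply: filterS => n H.
by rewrite -rmorphB normc_def /= expr0n addr0 sqrtr_sqr lecR.
Qed.

Section skew_circulant.
Context {d : measure_display} {T : measurableType d} {R : realType}.
Variable P : probability T R.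
Variable l : nat -> {RV P >-> R}.
Hypothesis intl : forall k j, P.-integrable setT (EFin \o (fun t => `|l j t| ^+ k)).

Let M n t : 'M[R]_n.+1 := (Num.sqrt n.+1%:R)^-1 *: LScirc n.+1 (fun j => l j t).

Let all_l j : all_moments P (fun t => real_complex R (l j t)).
Proof. by apply: all_moments_real => //; exact: measurable_funP. Qed.

Let skew_circulant_subproof n :
  (fun t => map_mx (real_complex R) (M n t)) \in @random_mx_pred _ _ _ P n.
Proof.
apply/asboolP => i j; pose e : R := (-1) ^+ (n.+1 <= i + j)%N / Num.sqrt n.+1%:R.
pose k := if (i + j < n.+1)%N then (i + j)%N else (i + j - n.+1)%N.
have := all_momentsM (all_moments_cst P (real_complex R e)) (all_l k).
congr all_moments; apply/funext => t; rewrite !mxE /= -rmorphM; congr (real_complex R _).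
rewrite /e /k ltnS ltnNge; case: (i + j <= n)%N => /=.
  by rewrite expr0 mul1r.
by rewrite expr1 mulN1r mulNr mulrN.
Qed.

Definition skew_circulant_mx n : random_mx P n := RandomMx (skew_circulant_subproof n).

Lemma star_skew_circulant n : @star _ (random_mx_ncp P n) (skew_circulant_mx n) = skew_circulant_mx n.
Proof.
apply/val_inj/funext => t; apply/matrixP => i j; rewrite !mxE.
have /matrixP/(_ i j) := LScirc_sym n.+1 (fun j => l j t).
rewrite !mxE => ->; apply/eqP; rewrite eq_complex /=.
by rewrite oppr0 !eqxx.
Qed.

Let random_mx_exp n (X : random_mx P n) p t : (X ^+ p) t = X t ^+ p.
Proof. by elim: p => [|p IH]; rewrite ?expr0// !exprS -IH. Qed.

Lemma phi_skew_circulant n p :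
  @phi _ (random_mx_ncp P n) ((skew_circulant_mx n : random_mx_ncp P n) ^+ p) =
  real_complex R (\int[P]_t (n.+1%:R^-1 * \tr (M n t ^+ p))).
Proof.
have trE t : \tr ((skew_circulant_mx n ^+ p : random_mx P n) t) = real_complex R (\tr (M n t ^+ p)).
  by rewrite random_mx_exp /= -rmorphXn trace_map_mx.
have itr : P.-integrable setT (EFin \o (fun t => \tr (M n t ^+ p))).
  have := all_moments_Re (all_moments_tr (skew_circulant_mx n ^+ p)).
  by congr (integrable _ _ _); apply/funext => t /=; rewrite trE.
rewrite RintegralZl// rmorphM fmorphV rmorph_nat; congr (_ * _).
rewrite /cplx_expectation.
under eq_Rintegral do rewrite trE.
under [X in Complex _ X]eq_Rintegral do rewrite trE.
by rewrite /= (Rintegral_cst1 P 0).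
Qed.

End skew_circulant.

Theorem theorem3p3 (R : realType) (d : measure_display) (T : measurableType d)
    (P : probability T R) (l : nat -> {RV P >-> R}) :
  (mutually_independent l ->
   (forall j, ('E_P[l j] = 0)%E) ->
   (forall j, ('V_P[l j] = 1)%E) ->
   (forall k : nat, (1 <= k)%N ->
      (ereal_sup (range (fun j => 'E_P[fun t => (`|l j t| ^+ k)%R])) < +oo)%E) ->
   exists L : forall n, random_mx_ncp P n,
     (forall n t,
        (L n : random_mx P n) t =
        map_mx (real_complex R)
          ((Num.sqrt n.+1%:R)^-1 *: LScirc n.+1 (fun j => l j t))) /\
     exists (A : ncp R[i]) (a : A),
       [/\ star a = a,
           forall m : nat, odd m -> phi A (a ^+ m) = 0,
           forall m : nat, (1 <= m)%N -> phi A (a ^+ (2 * m)) = (m`!)%:R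
         & cvg_star_distribution L a]) /\
  (mutually_independent l -> identically_distributed l ->
   (forall j, ('E_P[l j] = 0)%E) ->
   (forall j, ('V_P[l j] = 1)%E) ->
   {ae P, forall t,
     weak_cvg
       (fun n => esd ((Num.sqrt n.+1%:R)^-1 *: LScirc n.+1 (fun j => l j t)))
       rayleigh}).
Proof.
split.
- move=> ind EX VX supl.
  have std j := standardized_integrals (EX j) (VX j).
  have iX j : P.-integrable setT (EFin \o l j) by have [] := std j.
  have iX2 j : P.-integrable setT (EFin \o (fun t => l j t ^+ 2)) by have [] := std j.
  have meanX j : \int[P]_t (l j t) = 0 by have [] := std j.
  have varX j : \int[P]_t (l j t ^+ 2) = 1 by have [] := std j.
  have [B momX] := choice (sup_moments supl).
  have intl k j := (momX k j).1.
  exists (skew_circulant_mx intl); split; first by [].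
  pose mom m : R[i] := real_complex R (if odd m then 0 else (m./2)`!%:R).
  have mom0 : mom 0%N = 1 by rewrite /mom /= fact0 rmorph1.
  exists (poly_ncp mom0), ('X : {poly R[i]}); split.
  + exact: poly_star_X.
  + by move=> m om; rewrite poly_phi_Xn /mom om rmorph0.
  + by move=> m _; rewrite poly_phi_Xn /mom mul2n odd_double doubleK rmorph_nat.
  + move=> Q; rewrite (star_monomial_self_adjoint _ (poly_star_X mom0)) poly_phi_Xn.
    under eq_cvg => n do rewrite (star_monomial_self_adjoint _ (star_skew_circulant intl n)) phi_skew_circulant.
    apply: real_complex_cvg.
    exact: (mean_trace_cvg ind iX iX2 meanX varX momX).
- move=> ind idl EX VX.
  have [iX iX2 meanX varX] := standardized_integrals (EX 0%N) (VX 0%N).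
  exact: ae_esd_weak_cvg.
Qed.
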